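(* Let $n\in\mathbb{Z}$, $n\neq0$, let $\pi=\pi_1(S^3-W_{2n-1})$ be the group of the twisted Whitehead link $W_{2n-1}$, let $\mathbb{F}$ be a field of characteristic $p>2$, and let $\mathcal{O}$ be a complete discrete valuation ring of characteristic zero with residue field $\mathcal{O}/\mathfrak{m}_{\mathcal{O}}=\mathbb{F}$. Let $\overline\rho:\pi\to\mathrm{SL}_2\mathbb{F}$ be an absolutely irreducible non-acyclic representation corresponding to a smooth point $(\overline A,\overline B,\overline C)\in\mathbb{F}^3$ of the geometric component $\overline{f_n}=0$ of the character variety. Assume $\partial_z\overline{f_n}(\overline A,\overline B,\overline C)\neq0$. Let $(A,B)\in\mathcal{O}^2$ be any lift of $(\overline A,\overline B)$, and let $z_{f_n}(x,y)\in\mathcal{O}[[x-A,y-B]]$ denote the implicit function given by Hensel's lemma. Then the $L$-function $L_{\boldsymbol\rho}$ of the universal deformation $\boldsymbol\rho$ of $\overline\rho$ over $\mathcal{O}$ satisfies $$L_{\boldsymbol\rho}\doteq\tau_n(x,y,z_{f_n}(x,y))$$ in $\mathcal{R}=\mathcal{O}[[x-A,y-B]]$. Furthermore, the zeros of $L_{\boldsymbol\rho}$ have multiplicity two in the sense that $L_{\boldsymbol\rho}\in(x-A,y-B)^2$ and $L_{\boldsymbol\rho}\notin(x-A,y-B)^3$ hold in $\overline{\mathrm{Frac}\,\mathcal{O}}[[x-A,y-B]]$.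
   Context: Link and polynomials. $W_{2n-1}$ is the odd-twisted Whitehead link, a two-component link in $S^3$ ($W_1$ is the Whitehead link), with group $\pi=\langle m,\mu\mid m\omega=\omega m\rangle$, $\omega=(\mu m\mu^{-1}m^{-1})^n\,m\,(m^{-1}\mu^{-1}m\mu)^n$, where $m,\mu$ are meridians. Put $x=\mathrm{Tr}\,m$, $y=\mathrm{Tr}\,\mu$, $z=\mathrm{Tr}\,m\mu$, $v=x^2+y^2+z^2-xyz-2$. Let $S_k(v)\in\mathbb{Z}[v]$ ($k\in\mathbb{Z}$) be given by $S_0=1$, $S_1=v$, $S_{k+2}=vS_{k+1}-S_k$, and let $P_k(v)=(S_{k+1}(v)-S_k(v)-1)/(v-2)\in\mathbb{Z}[v]$. Put $$f_n=xy\,S_{n-1}(v)-(xy-z)S_{n-2}(v)-z\,S_n(v),\qquad \tau_n=(2-x-y+z)S_{n-1}(v)+(4-2x-2y+xy)P_{n-2}(v),$$ viewed in $\mathbb{Z}[x,y,z]$. Here $f_n$ is the polynomial defining the geometric component (the one containing the class of holonomy representations) of the $\mathrm{SL}_2\mathbb{C}$-character variety, $\tau_n$ is the Reidemeister torsion function, and $\overline{f_n}=f_n\bmod p$. The representation $\overline\rho$ corresponds to the point $(\mathrm{Tr}\,\overline\rho(m),\mathrm{Tr}\,\overline\rho(\mu),\mathrm{Tr}\,\overline\rho(m\mu))$. The implicit function satisfies $f_n(x,y,z_{f_n}(x,y))=0$, and $z_{f_n}(A,B)$ reduces to $\overline C$. Acyclicity. For a representation $\rho:\pi\to\mathrm{SL}_2(R)$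 over a domain $R$, $H_*(\pi,\rho)$ is the homology of $R^2\otimes_{\mathbb{Z}[\pi]}C_*$, with $C_*$ a free resolution of $\mathbb{Z}$ by left $\mathbb{Z}[\pi]$-modules and $R^2$ a right module via $g\mapsto\rho(g^{-1})$; $\rho$ is non-acyclic if some $H_i(\pi,\rho)\neq0$. Universal deformation. The universal deformation $\boldsymbol\rho$ of $\overline\rho$ over $\mathcal{O}$ is a lift of $\overline\rho$ to a representation over a complete local $\mathcal{O}$-algebra $\mathcal{R}_{\overline\rho}$ such that any lift of $\overline\rho$ to any complete local $\mathcal{O}$-algebra uniquely factors through $\boldsymbol\rho$ up to strict equivalence (conjugation fixing the residual representation $\overline\rho$). In the present setting $\mathcal{R}_{\overline\rho}=\mathcal{R}=\mathcal{O}[[x-A,y-B]]$. $L$-function. $L_{\boldsymbol\rho}\in\mathcal{R}$ is the order of the $\mathcal{R}$-module $H_1(\pi,\boldsymbol\rho)$ (a generator of the smallest principal ideal containing its $0$th Fitting ideal), defined up to units; $\doteq$ denotes equality up to multiplication by units of $\mathcal{R}$.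
   Formalization: The multiplicity-two claim is proved only for lifts (A,B) in O^2 that are zeros of L (constant term of L equal to 0); for an arbitrary lift it is false, since L need not vanish at (A,B). *)

(* Defs.v *)
From HB Require Import structures.
From mathcomp Require Import all_boot all_order all_algebra.
From mathcomp Require Import finmap boolp.
From mathcomp Require Import monalg.
From mathcomp Require Import mpoly.
From mathcomp Require Import zify.

Set Implicit Arguments.
Unset Strict Implicit.
Unset Printing Implicit Defensive.

Import GRing.Theory.
Local Open Scope ring_scope.

(** * Formal power series *)

Record fps (R : Type) := Fps { fps_coef : nat -> R }.

HB.instance Definition _ (R : Type) := [isNew for @fps_coef R].
HB.instance Definition _ (R : choiceType) := [Choice of fps R by <:].

Section FpsRing.
Variable R : comNzRingType.
Implicit Types f g h : fps R.

Lemma fpsP f g : fps_coef f =1 fps_coef g -> f = g.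
Proof. by case: f g => [f] [g] /= /funext ->. Qed.

Definition fps0 : fps R := Fps (fun=> 0).
Definition fps_opp f : fps R := Fps (fun i => - fps_coef f i).
Definition fps_add f g : fps R := Fps (fun i => fps_coef f i + fps_coef g i).

Fact fps_addA : associative fps_add.
Proof. by move=> f g h; apply: fpsP => i /=; rewrite addrA. Qed.
Fact fps_addC : commutative fps_add.
Proof. by move=> f g; apply: fpsP => i /=; rewrite addrC. Qed.
Fact fps_add0 : left_id fps0 fps_add.
Proof. by move=> f; apply: fpsP => i /=; rewrite add0r. Qed.
Fact fps_addN : left_inverse fps0 fps_opp fps_add.
Proof. by move=> f; apply: fpsP => i /=; rewrite addNr. Qed.

HB.instance Definition _ :=
  GRing.isZmodule.Build (fps R) fps_addA fps_addC fps_add0 fps_addN.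

Definition fpsC (a : R) : fps R := Fps (fun i => a *+ (i == 0)%N).
Definition fpsX : fps R := Fps (fun i => (i == 1)%N%:R).
Definition fps_mul f g : fps R :=
  Fps (fun i => \sum_(j < i.+1) fps_coef f j * fps_coef g (i - j)%N).

Let trunc n f : {poly R} := \poly_(i < n) fps_coef f i.

Let fps_mulE n f g i : (i < n)%N ->
  fps_coef (fps_mul f g) i = (trunc n f * trunc n g)`_i.
Proof.
move=> ltin; rewrite coefM /=; apply: eq_bigr => j _; rewrite !coef_poly.
have leji : (j <= i)%N by rewrite -ltnS.
by rewrite (leq_ltn_trans leji ltin) (leq_ltn_trans (leq_subr _ _) ltin).
Qed.

Let coef_mul_eq (p p' q q' : {poly R}) n :
  (forall i, (i < n)%N -> p`_i = p'`_i) ->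
  (forall i, (i < n)%N -> q`_i = q'`_i) ->
  forall i, (i < n)%N -> (p * q)`_i = (p' * q')`_i.
Proof.
move=> pp qq i ltin; rewrite !coefM; apply: eq_bigr => j _.
have leji : (j <= i)%N by rewrite -ltnS.
by rewrite pp ?qq // ?(leq_ltn_trans leji) // (leq_ltn_trans (leq_subr _ _)).
Qed.

Let coef_trunc n f i : (i < n)%N -> (trunc n f)`_i = fps_coef f i.
Proof. by rewrite coef_poly => ->. Qed.

Let trunc_mul n f g i : (i < n)%N ->
  (trunc n (fps_mul f g))`_i = (trunc n f * trunc n g)`_i.
Proof. by move=> lt; rewrite coef_trunc // (fps_mulE _ _ lt). Qed.

Fact fps_mulA : associative fps_mul.
Proof.
move=> f g h; apply: fpsP => i; have lti := ltnSn i.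
rewrite !(fps_mulE _ _ lti) (coef_mul_eq (p' := trunc i.+1 f)
  (q' := trunc i.+1 g * trunc i.+1 h) (n := i.+1)) ?mulrA //; last first.
  by move=> j; apply: trunc_mul.
by apply/esym/(coef_mul_eq (n := i.+1)) => // j; apply: trunc_mul.
Qed.

Fact fps_mulC : commutative fps_mul.
Proof.
by move=> f g; apply: fpsP => i; rewrite !(fps_mulE _ _ (ltnSn i)) mulrC.
Qed.

Fact fps_mul1 : left_id (fpsC 1) fps_mul.
Proof.
move=> f; apply: fpsP => i /=.
rewrite big_ord_recl /= mul1r subn0 big1 ?addr0 // => j _.
by rewrite mulr0n mul0r.
Qed.

Fact fps_mulD : left_distributive fps_mul fps_add.
Proof.
move=> f g h; apply: fpsP => i /=; rewrite -big_split /=.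
by apply: eq_bigr => j _; rewrite mulrDl.
Qed.

Fact fps_1neq0 : fpsC 1 != 0.
Proof.
by apply/eqP => /(congr1 (fun f => fps_coef f 0)) /eqP; rewrite oner_eq0.
Qed.

HB.instance Definition _ := GRing.Zmodule_isComNzRing.Build (fps R)
  fps_mulA fps_mulC fps_mul1 fps_mulD fps_1neq0.

Definition fps_unit : {pred fps R} := [pred f | `[< exists g, g * f = 1 >]].
Definition fps_inv f : fps R :=
  if pselect (exists g, g * f = 1) is left ex then projT1 (cid ex) else f.

Fact fps_mulV : {in fps_unit, left_inverse 1 fps_inv *%R}.
Proof.
move=> f /asboolP ex; rewrite /fps_inv; case: pselect => // ex'.
exact: projT2 (cid ex').
Qed.
Fact fps_unitP f g : g * f = 1 -> fps_unit f.
Proof. by move=> gf; apply/asboolP; exists g. Qed.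
Fact fps_inv_out : {in [predC fps_unit], fps_inv =1 id}.
Proof.
move=> f; rewrite !inE => /asboolP nex; rewrite /fps_inv.
by case: pselect.
Qed.

HB.instance Definition _ := GRing.ComNzRing_hasMulInverse.Build (fps R)
  fps_mulV fps_unitP fps_inv_out.

Fact fpsC_nmod_morphism : nmod_morphism fpsC.
Proof.
split; first by apply: fpsP => i /=; rewrite mul0rn.
by move=> a b; apply: fpsP => i /=; rewrite mulrnDl.
Qed.
Fact fpsC_monoid_morphism : monoid_morphism fpsC.
Proof.
split=> // a b; apply: fpsP => i /=.
rewrite big_ord_recl /= subn0 big1 ?addr0 => [|j _]; last first.
  by rewrite mulr0n mul0r.
by case: i => [|i]; rewrite ?mulr1n // !mulr0n mulr0.
Qed.
HB.instance Definition _ :=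
  GRing.isNmodMorphism.Build R (fps R) fpsC fpsC_nmod_morphism.
HB.instance Definition _ :=
  GRing.isMonoidMorphism.Build R (fps R) fpsC fpsC_monoid_morphism.

Definition fps_const f : R := fps_coef f 0.

Fact fps_const_nmod_morphism : nmod_morphism fps_const.
Proof. by []. Qed.
Fact fps_const_monoid_morphism : monoid_morphism fps_const.
Proof. by split=> // f g; rewrite /fps_const /= big_ord1. Qed.
HB.instance Definition _ :=
  GRing.isNmodMorphism.Build (fps R) R fps_const fps_const_nmod_morphism.
HB.instance Definition _ :=
  GRing.isMonoidMorphism.Build (fps R) R fps_const fps_const_monoid_morphism.

End FpsRing.

Definition fps_map (R S : Type) (phi : R -> S) (f : fps R) : fps S :=
  Fps (fun i => phi (fps_coef f i)).

(* R[[X, Y]] as (R[[X]])[[Y]]. *)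
Notation fps2 R := (fps (fps R)).
Definition fps2C (R : comNzRingType) : {rmorphism R -> fps2 R} :=
  @fpsC (fps R) \o @fpsC R.
Definition fps2_const (R : comNzRingType) : {rmorphism fps2 R -> R} :=
  @fps_const R \o @fps_const (fps R).
Definition fps2X (R : comNzRingType) : fps2 R := fpsC (fpsX R).
Definition fps2Y (R : comNzRingType) : fps2 R := fpsX (fps R).
Definition fps2_map (R S : Type) (phi : R -> S) : fps2 R -> fps2 S :=
  fps_map (fps_map phi).

(** * Ideals, local rings, completeness *)

Section Ideals.
Variable R : comNzRingType.
Implicit Types (I : R -> Prop) (a b : R).

Definition is_ideal I :=
  [/\ I 0, forall a b, I a -> I b -> I (a + b) & forall c a, I a -> I (c * a)].

Definition dvdr a b := exists c, b = c * a.

Definition ideal2 a b : R -> Prop := fun c => exists u v, c = u * a + v * b.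

(* I ^ k: the ideal generated by the products of k elements of I. *)
Definition ideal_exp I (k : nat) : R -> Prop := fun b =>
  exists q (c : 'I_q -> R) (a : 'I_q -> 'I_k -> R),
    (forall i j, I (a i j)) /\ b = \sum_i c i * \prod_j a i j.

(* R is separated and complete for the I-adic topology, that is, R is the
   inverse limit of the R / I ^ k. *)
Definition adic_complete I :=
  (forall a, (forall k, ideal_exp I k a) -> a = 0) /\
  (forall u : nat -> R, (forall k, ideal_exp I k (u k.+1 - u k)) ->
     exists l, forall k, ideal_exp I k (l - u k)).

End Ideals.

Definition eq_up_to_unit (R : comUnitRingType) (a b : R) :=
  exists2 u : R, u \is a GRing.unit & a = u * b.

(* r is the reduction of a local ring R modulo its maximal ideal (the kernel
   of r, which then is the set of all nonunits). *)
Definition local_residue (R : comUnitRingType) (F : fieldType) (r : R -> F) :=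
  (forall c, exists a, r a = c) /\
  (forall a, (a \is a GRing.unit) = (r a != 0)).

(* A discrete valuation ring is a local principal ideal domain that is not a
   field. *)
Definition complete_dvr (O : idomainType) (F : fieldType)
    (res : {rmorphism O -> F}) :=
  [/\ local_residue res,
      forall I : O -> Prop, is_ideal I ->
        exists a, forall b, I b <-> dvdr a b,
      exists2 a : O, a != 0 & a \isn't a GRing.unit
    & adic_complete (fun a => res a = 0)].

(** * Groups given by a presentation *)

Section Presentation.
Variable I : choiceType.

(* (i, true) stands for the inverse of the generator i. *)
Definition letter := (I * bool)%type.
Definition word := seq letter.
Definition letter_inv (l : letter) : letter := (l.1, ~~ l.2).
Definition word_inv (w : word) : word := rev (map letter_inv w).
Definition word_expz (w : word) (n : int) : word :=
  if n is Posz k then flatten (nseq k w)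
  else flatten (nseq `|n|%N (word_inv w)).

Variable rels : seq (word * word).

Inductive pres_eq : word -> word -> Prop :=
| PresRefl w : pres_eq w w
| PresSym u w : pres_eq u w -> pres_eq w u
| PresTrans v u w : pres_eq u v -> pres_eq v w -> pres_eq u w
| PresCat u u' w w' :
    pres_eq u u' -> pres_eq w w' -> pres_eq (u ++ w) (u' ++ w')
| PresFree l : pres_eq [:: l; letter_inv l] [::]
| PresRel r : r \in rels -> pres_eq r.1 r.2.

Definition pres_eqb : rel word := fun u w => `[< pres_eq u w >].

Fact pres_eqb_refl : reflexive pres_eqb.
Proof. by move=> w; apply/asboolP/PresRefl. Qed.
Fact pres_eqb_sym u w : pres_eqb u w = pres_eqb w u.
Proof. by apply/asboolP/asboolP; apply: PresSym. Qed.
Fact pres_eqb_trans : transitive pres_eqb.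
Proof.
by move=> v u w /asboolP uv /asboolP vw; apply/asboolP/(PresTrans uv vw).
Qed.

Canonical pres_equiv := EquivRel pres_eqb
  pres_eqb_refl pres_eqb_sym pres_eqb_trans.

Local Open Scope quotient_scope.

Definition pres_group := {eq_quot pres_equiv}.
HB.instance Definition _ := Choice.on pres_group.

Definition word_elt (w : word) : pres_group := \pi_pres_group w.
Definition pres_gen (i : I) : pres_group := word_elt [:: (i, false)].

Lemma word_eltP u w : word_elt u = word_elt w <-> pres_eq u w.
Proof.
split=> [e|uw]; last by apply/eqquotP/asboolP.
by move/eqquotP/asboolP: e.
Qed.

Definition pres_one : pres_group := word_elt [::].
Definition pres_mul (x y : pres_group) : pres_group :=
  word_elt (repr x ++ repr y).
Definition pres_inv (x : pres_group) : pres_group := word_elt (word_inv (repr x)).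

Lemma word_elt_repr x : word_elt (repr x) = x.
Proof. exact: reprK. Qed.

Lemma pres_eq_repr w : pres_eq (repr (word_elt w)) w.
Proof. by apply/word_eltP; rewrite word_elt_repr. Qed.

Lemma pres_mulE u w : pres_mul (word_elt u) (word_elt w) = word_elt (u ++ w).
Proof. by apply/word_eltP/PresCat; apply: pres_eq_repr. Qed.

Lemma letter_invK : involutive letter_inv.
Proof. by case=> i b; rewrite /letter_inv /= negbK. Qed.

Lemma word_invK : involutive word_inv.
Proof.
move=> w; rewrite /word_inv map_rev revK -map_comp map_id_in // => l _.
exact: letter_invK.
Qed.

Lemma pres_eq_invr w : pres_eq (w ++ word_inv w) [::].
Proof.
elim: w => [|l w IH]; first exact: PresRefl.
rewrite /word_inv map_cons rev_cons -cats1 -/(word_inv w).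
have -> : (l :: w) ++ word_inv w ++ [:: letter_inv l] =
          [:: l] ++ (w ++ word_inv w) ++ [:: letter_inv l].
  by rewrite -!catA.
apply: PresTrans (PresFree l); rewrite -[X in pres_eq _ X]/([:: l] ++ [::] ++ [:: letter_inv l]).
by do 2?[apply: PresCat; try exact: PresRefl].
Qed.

Fact pres_mulA : associative pres_mul.
Proof.
move=> x y z.
by rewrite -[x]word_elt_repr -[y]word_elt_repr -[z]word_elt_repr !pres_mulE catA.
Qed.
Fact pres_mul1g : left_id pres_one pres_mul.
Proof. by move=> x; rewrite -[x]word_elt_repr pres_mulE. Qed.
Fact pres_mulg1 : right_id pres_one pres_mul.
Proof. by move=> x; rewrite -[x]word_elt_repr pres_mulE cats0. Qed.
Fact pres_mulgV : right_inverse pres_one pres_inv pres_mul.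
Proof.
move=> x; rewrite -{1}[x]word_elt_repr pres_mulE.
exact/word_eltP/pres_eq_invr.
Qed.
Fact pres_mulVg : left_inverse pres_one pres_inv pres_mul.
Proof.
move=> x; rewrite -{2}[x]word_elt_repr pres_mulE.
by apply/word_eltP; rewrite -{2}[repr x]word_invK; apply: pres_eq_invr.
Qed.

HB.instance Definition _ := isGroup.Build pres_group
  pres_mulA pres_mul1g pres_mulg1 pres_mulVg pres_mulgV.

End Presentation.

(** * The group of the twisted Whitehead link W_(2n-1) *)

Section Whitehead.
Variable n : int.
Let m : letter bool := (false, false).
Let mu : letter bool := (true, false).
Let m' := letter_inv m.
Let mu' := letter_inv mu.

Definition whitehead_omega : word bool :=
  word_expz [:: mu; m; mu'; m'] n ++ [:: m] ++ word_expz [:: m'; mu'; m; mu] n.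

Definition whitehead_group : groupType :=
  pres_group [:: (m :: whitehead_omega, rcons whitehead_omega m)].

Definition wh_m : whitehead_group := pres_gen _ false.
Definition wh_mu : whitehead_group := pres_gen _ true.

End Whitehead.

(** * Representations in SL_2 *)

Section Representations.
Variable G : groupType.

Definition is_SL2_rep (R : comNzRingType) (rho : G -> 'M[R]_2) :=
  [/\ forall g, \det (rho g) = 1,
      rho 1%g = 1%:M
    & forall g h, rho (g * h)%g = rho g *m rho h].

(* rho g acts on column vectors: a subspace is stable under rho g on the left
   when the space of its transposes, the row space of U, is stable under
   (rho g)^T on the right. *)
Definition absolutely_irreducible (F : fieldType) (rho : G -> 'M[F]_2) :=
  forall (E : fieldType) (iota : {rmorphism F -> E}) (U : 'M[E]_2),
    (forall g, stablemx U (map_mx iota (rho g))^T) ->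
    \rank U = 0%N \/ \rank U = 2%N.

End Representations.

(** * Homology with coefficients in a representation *)

Section Homology.
Variables (R : comNzRingType) (G : groupType).

(* Degree k part of R^2 (x)_Z[G] C_*, for C_* the inhomogeneous bar resolution,
   C_k = (+)_([g_0 | ... | g_(k-1)]) Z[G]: finite formal sums of symbols
   v (x) [g_0 | ... | g_(k-1)] with v in R^2. *)
Definition chain (k : nat) := {malg 'cV[R]_2[k.-tuple G]}.
HB.instance Definition _ k := GRing.Zmodule.on (chain k).

Section Scale.
Variable k : nat.
Implicit Types (a b : R) (c d : chain k).

Definition chain_scale a c : chain k :=
  \sum_(g <- monalg.msupp c) << a *: monalg.mcoeff g c *g g >>.

Lemma chain_scaleE a c g :
  monalg.mcoeff g (chain_scale a c) = a *: monalg.mcoeff g c.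
Proof.
rewrite /chain_scale raddf_sum /=.
under eq_bigr => h _ do rewrite monalg.mcoeffU.
rewrite [in RHS](monalgE c) raddf_sum /= scaler_sumr.
by apply: eq_bigr => h _; rewrite monalg.mcoeffU scalerMnr.
Qed.

Fact chain_scaleA a b c : chain_scale a (chain_scale b c) = chain_scale (a * b) c.
Proof. by apply/malgP => g; rewrite !chain_scaleE scalerA. Qed.
Fact chain_scale1 : left_id 1 chain_scale.
Proof. by move=> c; apply/malgP => g; rewrite chain_scaleE scale1r. Qed.
Fact chain_scaleDr : right_distributive chain_scale +%R.
Proof.
move=> a c d; apply/malgP => g.
by rewrite monalg.mcoeffD !chain_scaleE monalg.mcoeffD scalerDr.
Qed.
Fact chain_scaleDl c : {morph chain_scale^~ c : a b / a + b}.
Proof.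
move=> a b; apply/malgP => g.
by rewrite monalg.mcoeffD !chain_scaleE scalerDl.
Qed.

HB.instance Definition _ := GRing.Zmodule_isLmodule.Build R (chain k)
  chain_scaleA chain_scale1 chain_scaleDr chain_scaleDl.

End Scale.

(* For 0 < i < k + 1, multiplies the entries i - 1 and i; for i = 0 and
   i = k + 1, drops the first and the last entry. *)
Definition bar_face k (i : 'I_k.+2) (g : k.+1.-tuple G) : k.-tuple G :=
  [tuple (let a := tnth g (widen_ord (leqnSn k) j) in
          let b := tnth g (lift ord0 j) in
          if (j.+1 < i)%N then a
          else if j.+1 == i :> nat then (a * b)%g else b) | j < k].

Variable rho : G -> 'M[R]_2.

(* v (x) [g_0 | ... | g_k] |-> v g_0 (x) [g_1 | ... | g_k]
     + \sum_(0 < i < k + 1) (-1)^i v (x) [... | g_(i-1) g_i | ...]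
     + (-1)^(k+1) v (x) [g_0 | ... | g_(k-1)],
   for the right action v g = rho (g^-1) v. *)
Definition bar_d k (c : chain k.+1) : chain k :=
  \sum_(g <- monalg.msupp c) \sum_(i < k.+2)
    let v := monalg.mcoeff g c in
    let vg := if i == ord0 then rho (tnth g ord0)^-1%g *m v else v in
    << (-1) ^+ i *: vg *g bar_face i g >>.

(* H_k(G, rho) is the quotient of the cycles by the boundaries. *)
Definition cycle k : chain k -> Prop :=
  match k with 0 => fun=> True | k'.+1 => fun c => bar_d c = 0 end.
Definition boundary k (c : chain k) := exists b : chain k.+1, c = bar_d b.

Definition non_acyclic := exists k (c : chain k), cycle c /\ ~ boundary c.

End Homology.

(** * Fitting ideal and order of a module *)

(* The module is the quotient Z / B, for submodules B and Z of M. *)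
Section Order.
Variables (R : comNzRingType) (M : lmodType R) (Z B : M -> Prop).

Definition generates k (e : 'I_k -> M) :=
  (forall i, Z (e i)) /\
  (forall z, Z z -> exists c : 'I_k -> R, B (z - \sum_i c i *: e i)).

Definition relation k (e : 'I_k -> M) (c : 'rV[R]_k) := B (\sum_i c 0 i *: e i).

(* The ideal generated by the k x k minors of the relations between k
   generators; it does not depend on the choice of the generators. *)
Definition fitting0 (a : R) :=
  exists k (e : 'I_k -> M), generates e /\
  exists q (c : 'I_q -> R) (D : 'I_q -> 'M[R]_k),
    (forall j i, relation e (row i (D j))) /\ a = \sum_j c j * \det (D j).

(* (L) is the smallest principal ideal that contains the Fitting ideal. *)
Definition is_order (L : R) :=
  [/\ exists k (e : 'I_k -> M), generates e,
      forall a, fitting0 a -> dvdr L a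
    & forall b, (forall a, fitting0 a -> dvdr b a) -> dvdr b L].

End Order.

Definition is_L_function (R : comNzRingType) (G : groupType)
    (rho : G -> 'M[R]_2) (L : R) :=
  is_order (@cycle R G rho 1) (@boundary R G rho 1) L.

(** * Universal deformations *)

Section Deformations.
Variables (O : comUnitRingType) (F : fieldType) (res : {rmorphism O -> F}).
Variables (G : groupType) (rhobar : G -> 'M[F]_2).

(* A complete local O-algebra R with residue field F: structure morphism i and
   reduction r. *)
Definition complete_local_algebra (R : comUnitRingType)
    (i : {rmorphism O -> R}) (r : {rmorphism R -> F}) :=
  [/\ local_residue r, adic_complete (fun a => r a = 0)
    & forall a, r (i a) = res a].

Definition is_lift (R : comUnitRingType) (r : {rmorphism R -> F})
    (rho : G -> 'M[R]_2) :=
  is_SL2_rep rho /\ forall g, map_mx r (rho g) = rhobar g.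

(* Conjugation by a matrix whose reduction fixes rhobar. *)
Definition strictly_equivalent (R : comUnitRingType) (r : {rmorphism R -> F})
    (rho sigma : G -> 'M[R]_2) :=
  exists2 P : 'M[R]_2, P \in unitmx &
    (forall g, map_mx r P *m rhobar g *m invmx (map_mx r P) = rhobar g) /\
    (forall g, sigma g = P *m rho g *m invmx P).

Definition universal_deformation (R : comUnitRingType)
    (i : {rmorphism O -> R}) (r : {rmorphism R -> F}) (rho : G -> 'M[R]_2) :=
  [/\ complete_local_algebra i r, is_lift r rho &
   forall (S : comUnitRingType) (iS : {rmorphism O -> S})
     (rS : {rmorphism S -> F}) (sigma : G -> 'M[S]_2),
     complete_local_algebra iS rS -> is_lift rS sigma ->
     let factors (phi : {rmorphism R -> S}) :=
       [/\ forall a, phi (i a) = iS a, forall b, rS (phi b) = r b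
         & strictly_equivalent rS (fun g => map_mx phi (rho g)) sigma] in
     exists2 phi : {rmorphism R -> S}, factors phi &
       forall psi : {rmorphism R -> S}, factors psi -> psi =1 phi].

End Deformations.

(** * The polynomials f_n and tau_n *)

Fixpoint chebS_nat (k : nat) : {poly int} :=
  match k with
  | 0 => 1
  | k'.+1 =>
    match k' with 0 => 'X | k''.+1 => 'X * chebS_nat k' - chebS_nat k'' end
  end.

(* S_(-1) = 0 and S_(-k-2) = - S_k; Negz k is - (k + 1). *)
Definition chebS (k : int) : {poly int} :=
  match k with
  | Posz j => chebS_nat j
  | Negz 0 => 0
  | Negz j.+1 => - chebS_nat j
  end.

Lemma chebS_rec (k : int) : chebS (k + 2) = 'X * chebS (k + 1) - chebS k.
Proof.
case: k => [k|[|[|k]]].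
- have -> : Posz k + 2 = Posz k.+2 by lia.
  by have -> : Posz k + 1 = Posz k.+1 by lia.
- by rewrite /= mulr1 subr0.
- by rewrite /= mulr0 opprK add0r.
have -> : Negz k.+2 + 1 = Negz k.+1 by lia.
case: k => [|k]; first by rewrite /= mulrN1 opprK addNr.
have -> : Negz k.+3 + 2 = Negz k.+1 by lia.
rewrite /chebS -[chebS_nat k.+2]/('X * chebS_nat k.+1 - chebS_nat k).
by rewrite mulrN opprK addrA addNr add0r.
Qed.

(* The division is exact (chebPE). *)
Definition chebP (k : int) : {poly int} :=
  (chebS (k + 1) - chebS k - 1) %/ ('X - 2%:P).

Lemma chebS_at2 (k : int) : (chebS k).[2] = k + 1.
Proof.
have nat_at2 j : (chebS_nat j).[2] = j.+1%:Z /\ (chebS_nat j.+1).[2] = j.+2%:Z.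
  elim: j => [|j [IH1 IH2]]; first by rewrite /= !hornerE.
  split; first exact: IH2.
  rewrite [chebS_nat j.+2]/('X * chebS_nat j.+1 - chebS_nat j).
  by rewrite hornerD hornerN hornerM hornerX IH1 IH2; lia.
case: k => [j|[|j]]; first by rewrite /= (nat_at2 j).1; lia.
  by rewrite /= horner0.
by rewrite /= hornerN (nat_at2 j).1; lia.
Qed.

Lemma chebPE (k : int) : chebP k * ('X - 2%:P) = chebS (k + 1) - chebS k - 1.
Proof.
rewrite /chebP Pdiv.IdomainUnit.divpK // ?lead_coefXsubC //.
by rewrite Pdiv.Idomain.dvdp_XsubCl /root !hornerE !chebS_at2; apply/eqP; lia.
Qed.

Definition ix : 'I_3 := @Ordinal 3 0 isT.
Definition iy : 'I_3 := @Ordinal 3 1 isT.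
Definition iz : 'I_3 := @Ordinal 3 2 isT.

Section Polynomials.
Variable n : int.

Local Notation x := ('X_ix : mpoly 3 int).
Local Notation y := ('X_iy : mpoly 3 int).
Local Notation z := ('X_iz : mpoly 3 int).

Definition poly_v : mpoly 3 int := x ^+ 2 + y ^+ 2 + z ^+ 2 - x * y * z - 2.

Definition at_v (q : {poly int}) : mpoly 3 int := (map_poly intr q).[poly_v].
Local Notation S k := (at_v (chebS k)).
Local Notation P k := (at_v (chebP k)).

Definition poly_f : mpoly 3 int :=
  x * y * S (n - 1) - (x * y - z) * S (n - 2) - z * S n.

Definition poly_tau : mpoly 3 int :=
  (2 - x - y + z) * S (n - 1) + (4 - 2 * x - 2 * y + x * y) * P (n - 2).

End Polynomials.

(* The value at (a, b, c) of the image of q in R[x, y, z]. *)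
Definition evalZ (R : comNzRingType) (q : mpoly 3 int) (a b c : R) : R :=
  (map_mpoly intr q).@[tnth [tuple a; b; c]].

Definition smooth_zero (R : comNzRingType) (q : mpoly 3 int) (a b c : R) :=
  evalZ q a b c = 0 /\ exists i : 'I_3, evalZ q^`M(i) a b c != 0.

(* z = z(x, y) is a power series in X = x - A and Y = y - B with
   q(x, y, z(x, y)) = 0 and z(A, B) reducing to c. *)
Definition is_implicit_function (O : comNzRingType) (F : fieldType)
    (res : O -> F) (q : mpoly 3 int) (A B : O) (c : F) (z : fps2 O) :=
  evalZ q (fps2C O A + fps2X O) (fps2C O B + fps2Y O) z = 0 /\
  res (fps2_const O z) = c.

(* Main.v *)
Require Import Defs.
From HB Require Import structures.
From mathcomp Require Import all_boot all_order all_algebra.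
From mathcomp Require Import finmap boolp fieldext.
From mathcomp Require Import monalg mpoly.
From mathcomp Require Import zify ring.

Set Implicit Arguments.
Unset Strict Implicit.
Unset Printing Implicit Defensive.

Import GRing.Theory.
Local Open Scope ring_scope.

(** Write m, mu for the images of the two meridians under a representation
into SL_2, x, y, z for the traces of m, mu, m mu, and w, w' for the two
commutators in the relator; both have trace v. Put s = S_(n-1)(v) and
t = S_(n-2)(v), so that s^2 - v s t + t^2 = 1 and w^n = s w - t.

_The surface._ In the coordinates 1, m, mu, m mu every word is a polynomial
in x, y, z, s, t. The relator becomes s f_n (m mu - mu m) = 0
([commute_Womega]), and m mu - mu m has determinant 2 - v, which is a unit for
an absolutely irreducible residual representation
([irreducible_trace_commutator]). Hence the deformations are cut out by the
product s f_n. If s vanished at the residual point, where f_n vanishes too,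
then s f_n would vanish there to second order and one could move z alone over
the dual numbers, which a universal deformation with parameters x and y does
not allow ([geometric_only]). So s is a unit and z = Tr rho(m mu) solves
f_n(x, y, z) = 0; by Taylor expansion it is the only solution with its residue.

_The L-function._ H_1 is computed by the Fox complex R^2 -> R^4 -> R^2 of the
presentation ([fox_chain_boundary], [fox_chain_cycle]). The residue of the
second map has rank 2, since a row vector fixed by m and mu would be killed by
m mu - mu m. Over the local ring R the kernel of that map is therefore free of
rank 2, H_1 is the cokernel of a square matrix, and its order is the
determinant of that matrix ([order_of_square_presentation]). Comparing 2 x 2
minors, this determinant times 2 - x is, up to a unit, the determinant of the
Fox derivative of the relator along mu, and a computation in quaternion
coordinates shows that the latter is 2 (2 - x) tau_n when f_n = 0
([det_foxG], [det_fox_relation]). As 2 is a unit, L = tau_n up to a unit.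

_The multiplicity._ Put a = v - 2, B = (2 - x)(2 - y) and E = a + B. When
f_n = 0 one has s^2 E^2 = tau_n (a tau_n + 2 B) ([tau_square]). At a zero of
tau_n also E = 0, so B = - a is a unit and tau_n is a unit times E^2. It
remains to see that E has a nonzero linear part. Otherwise the following holds
to first order: x + y is a function of v, with s^2 a (x + y) = h - 4 and
(x + y) h = v + 2, where h = T_n(v) + 2 and T_n(v) is the trace of w^n
([curve_sum], [curve_sum_h]). Since v = 2 - B to first order, comparing the
two partial derivatives gives x = y; with b = 2 - x and v = 2 - b^2 the
equations then force 4 b n s = -1 although b, hence s, is a rational number
with odd denominator ([branch_contradiction]). *)

(** * Chebyshev values and evaluation of integer polynomials *)

Section Cheb.
Variable R : comNzRingType.
Implicit Types v : R.

Definition chebv (k : int) v : R := (map_poly intr (chebS k)).[v].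

Lemma chebv_rec (k : int) v : chebv (k + 2) v = v * chebv (k + 1) v - chebv k v.
Proof.
by rewrite /chebv chebS_rec rmorphB rmorphM /= map_polyX hornerD hornerN hornerM hornerX.
Qed.

Lemma chebv0 v : chebv 0 v = 1.
Proof. by rewrite /chebv /= rmorph1 hornerC. Qed.

Lemma chebvN1 v : chebv (-1) v = 0.
Proof. by rewrite /chebv /= rmorph0 horner0. Qed.

(** The recursion of the S_k runs in both directions, so statements about all
integers are proved by stepping up and down from 0. *)
Lemma int_step_ind (P : int -> Prop) :
  P 0 -> (forall k, P k -> P (k + 1)) -> (forall k, P (k + 1) -> P k) ->
  forall k, P k.
Proof.
move=> P0 up down; elim=> [//|k Pk|k Pk].
  have -> : (k.+1%:Z = k%:Z + 1) by lia.
  exact: up.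
apply: down.
by have -> : - (k.+1%:Z) + 1 = - k%:Z by lia.
Qed.

(** This is the determinant of s w - t for a matrix w of trace v and
determinant 1. *)
Lemma chebv_norm (k : int) v :
  chebv k v ^+ 2 - v * chebv k v * chebv (k - 1) v + chebv (k - 1) v ^+ 2 = 1.
Proof.
elim/int_step_ind: k => [|k IH|k IH].
- by rewrite sub0r chebv0 chebvN1; ring.
- have := chebv_rec (k - 1) v.
  have -> : k - 1 + 2 = k + 1 by lia.
  have -> : k - 1 + 1 = k by lia.
  have -> : k + 1 - 1 = k by lia.
  by move=> ->; rewrite -IH; ring.
- have := chebv_rec (k - 1) v; move: IH.
  have -> : k - 1 + 2 = k + 1 by lia.
  have -> : k - 1 + 1 = k by lia.
  have -> : k + 1 - 1 = k by lia.
  move=> <- ->; ring.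
Qed.

Lemma chebP_mul (k : int) v :
  (map_poly intr (chebP k)).[v] * (v - 2) = chebv (k + 1) v - chebv k v - 1.
Proof.
have := congr1 (fun q => (map_poly (intr : int -> R) q).[v]) (chebPE k).
rewrite !rmorphM !rmorphB /= rmorph1 map_polyX map_polyC /= !hornerE.
by move=> ->.
Qed.

End Cheb.

Lemma rmorph_chebv (R S : comNzRingType) (h : {rmorphism R -> S}) k v :
  h (chebv k v) = chebv k (h v).
Proof.
rewrite /chebv -horner_map /= -map_poly_comp.
congr (_.[_]); apply: eq_map_poly => a /=; exact: rmorph_int.
Qed.

Section EvalZ.
Variables (R : comNzRingType) (a b c : R).
Local Notation ev q := (evalZ q a b c).

Lemma evalZD p q : ev (p + q) = ev p + ev q.
Proof. by rewrite /evalZ !rmorphD. Qed.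
Lemma evalZB p q : ev (p - q) = ev p - ev q.
Proof. by rewrite /evalZ !rmorphB. Qed.
Lemma evalZM p q : ev (p * q) = ev p * ev q.
Proof. by rewrite /evalZ !rmorphM. Qed.
Lemma evalZX p k : ev (p ^+ k) = ev p ^+ k.
Proof. by rewrite /evalZ !rmorphXn. Qed.
Lemma evalZn k : ev k%:R = k%:R.
Proof. by rewrite /evalZ !rmorph_nat. Qed.
Lemma evalZC k : ev k%:MP = k%:~R.
Proof. by rewrite /evalZ map_mpolyC mevalC. Qed.
Lemma evalZx : ev 'X_ix = a.
Proof. by rewrite /evalZ map_mpolyX mevalXU. Qed.
Lemma evalZy : ev 'X_iy = b.
Proof. by rewrite /evalZ map_mpolyX mevalXU. Qed.
Lemma evalZz : ev 'X_iz = c.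
Proof. by rewrite /evalZ map_mpolyX mevalXU. Qed.
End EvalZ.


Section Values.
Variables (R : comNzRingType) (x y z : R).
Definition comm_trace : R := x ^+ 2 + y ^+ 2 + z ^+ 2 - x * y * z - 2.
Local Notation v := comm_trace.

Lemma evalZ_v : evalZ poly_v x y z = v.
Proof.
rewrite /poly_v !(evalZn, evalZB, evalZD, evalZM, evalZX, evalZx, evalZy, evalZz).
by [].
Qed.

Lemma evalZ_at_v q : evalZ (at_v q) x y z = (map_poly intr q).[v].
Proof.
elim/poly_ind: q => [|q c IH].
  by rewrite /at_v !rmorph0 !horner0 /evalZ !rmorph0.
rewrite /at_v !(rmorphD, rmorphM) /= !map_polyX !map_polyC /= !hornerE.
rewrite evalZD evalZM -/(at_v q) IH evalZ_v; congr (_ + _).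
by rewrite /evalZ !rmorph_int.
Qed.

Lemma evalZ_f n : let s := chebv (n - 1) v in let t := chebv (n - 2) v in
  evalZ (poly_f n) x y z = s * (x * y - z * v) + t * (2 * z - x * y).
Proof.
move=> s t; rewrite /poly_f !(evalZn, evalZB, evalZD, evalZM, evalZX, evalZx, evalZy, evalZz).
rewrite !evalZ_at_v -!/(chebv _ _).
have := chebv_rec (n - 2) v.
have -> : n - 2 + 2 = n by lia.
have -> : n - 2 + 1 = n - 1 by lia.
by move=> ->; rewrite -/s -/t; ring.
Qed.

Lemma evalZ_tau n : let s := chebv (n - 1) v in let t := chebv (n - 2) v in
  evalZ (poly_tau n) x y z * (v - 2) =
  (2 - x - y + z) * s * (v - 2) + (2 - x) * (2 - y) * (s - t - 1).
Proof.
move=> s t; rewrite /poly_tau !(evalZn, evalZB, evalZD, evalZM, evalZX, evalZx, evalZy, evalZz).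
rewrite !evalZ_at_v -!/(chebv _ _).
have := chebP_mul (n - 2) v.
have -> : n - 2 + 1 = n - 1 by lia.
move=> PE; rewrite mulrDl -[X in _ + X]mulrA PE.
by rewrite -/s -/t; ring.
Qed.

End Values.

Lemma rmorph_comm_trace (R S : comNzRingType) (h : {rmorphism R -> S}) x y z :
  h (comm_trace x y z) = comm_trace (h x) (h y) (h z).
Proof. by rewrite /comm_trace rmorphB rmorph_nat !(rmorphB, rmorphD, rmorphM, rmorphXn). Qed.

Lemma rmorph_evalZ (R S : comNzRingType) (h : {rmorphism R -> S}) q x y z :
  h (evalZ q x y z) = evalZ q (h x) (h y) (h z).
Proof.
elim/mpolyind: q => [|c m q _ _ IH]; first by rewrite /evalZ !rmorph0.
rewrite !evalZD rmorphD IH; congr (_ + _).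
rewrite /evalZ -!mul_mpolyC !rmorphM /= !map_mpolyC !mevalC !rmorph_int.
congr (_ * _); rewrite !map_mpolyX !mevalX rmorph_prod; apply: eq_bigr => i _.
rewrite rmorphXn; congr (_ ^+ _).
by case: i => [[|[|[|]]]].
Qed.

(** First order Taylor expansion in the third variable, with the remainder in
Hadamard form; this is what uniqueness in Hensel's lemma needs. *)
Lemma evalZ_taylor (R : comNzRingType) q (x y z h : R) :
  exists r, evalZ q x y (z + h) =
    evalZ q x y z + h * evalZ q^`M(iz) x y z + h ^+ 2 * r.
Proof.
pose P q := exists r, evalZ q x y (z + h) =
  evalZ q x y z + h * evalZ q^`M(iz) x y z + h ^+ 2 * r.
have PD p1 p2 : P p1 -> P p2 -> P (p1 + p2).
  case=> [r1 e1] [r2 e2]; exists (r1 + r2).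
  rewrite mderivD !evalZD e1 e2.
  move: (evalZ p1 _ _ _) (evalZ p1^`M(_) _ _ _) => a a'.
  move: (evalZ p2 _ _ _) (evalZ p2^`M(_) _ _ _) => b b'.
  by ring.
have PM p1 p2 : P p1 -> P p2 -> P (p1 * p2).
  case=> [r1 e1] [r2 e2]; rewrite /P mderivM !(evalZM, evalZD) e1 e2.
  move: (evalZ p1 _ _ _) (evalZ p1^`M(_) _ _ _) => a a'.
  move: (evalZ p2 _ _ _) (evalZ p2^`M(_) _ _ _) => b b'.
  exists (a * r2 + a' * b' + r1 * b + h * (a' * r2 + r1 * b') + h ^+ 2 * r1 * r2).
  by ring.
have PX i : P 'X_i.
  rewrite /P mderivX mnm1E.
  case: i => [[|[|[|]]] lti] //=.
  - have -> : Ordinal lti = ix by apply: val_inj.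
    by exists 0; rewrite !evalZx mulr0n scale0r /evalZ !rmorph0; ring.
  - have -> : Ordinal lti = iy by apply: val_inj.
    by exists 0; rewrite !evalZy mulr0n scale0r /evalZ !rmorph0; ring.
  - have -> : Ordinal lti = iz by apply: val_inj.
    exists 0; rewrite !evalZz mulr1n scale1r.
    have -> : (U_(Ordinal lti) - U_(iz))%MM = 0%MM :> (multinom 3).
      by apply/mnmP => j; rewrite mnmBE mnm0E subnn.
    by rewrite mpolyX0 /evalZ !rmorph1; ring.
have PC c : P c%:MP.
  by exists 0; rewrite mderivC !evalZC /evalZ !rmorph0; ring.
suff: P q by [].
elim/mpolyind: q => [|c m q _ _ IH]; first by rewrite -mpolyC0.
apply: (PD) => //; rewrite -mul_mpolyC mpolyXE_id; apply: (PM); first exact: (PC).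
apply: (big_ind P) => [||i _]; first by rewrite -mpolyC1; exact: (PC).
  by move=> p1 p2; exact: (PM).
elim: (m i) => [|k IHk]; first by rewrite expr0 -mpolyC1; exact: (PC).
by rewrite exprS; apply: (PM).
Qed.

(** * Two by two matrices and quaternion coordinates *)

Section Mx2.
Variable R : comNzRingType.
Implicit Types A B : 'M[R]_2.

Lemma mx2P A B : A 0 0 = B 0 0 -> A 0 1 = B 0 1 -> A 1 0 = B 1 0 ->
  A 1 1 = B 1 1 -> A = B.
Proof.
move=> e00 e01 e10 e11; apply/matrixP => i j.
have ord2 (k : 'I_2) : k = 0 \/ k = 1.
  by case: k => [[|[|]]] // ltk; [left|right]; apply: val_inj.
by case: (ord2 i) => ->; case: (ord2 j) => ->.
Qed.

Lemma sum2 (F : 'I_2 -> R) : \sum_i F i = F 0 + F 1.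
Proof.
rewrite big_ord_recl big_ord1; congr (_ + F _); exact: val_inj.
Qed.

Lemma det2E A : \det A = A 0 0 * A 1 1 - A 0 1 * A 1 0.
Proof.
rewrite (expand_det_row _ 0) sum2 /cofactor !det_mx11 !mxE /=.
rewrite !expr0 !expr1 !mul1r !mulN1r mulrN.
by congr (_ * A _ _ - _ * A _ _); apply: val_inj.
Qed.

Lemma tr2E A : \tr A = A 0 0 + A 1 1.
Proof. by rewrite /mxtrace sum2. Qed.

Lemma mul2E A B i j : (A *m B) i j = A i 0 * B 0 j + A i 1 * B 1 j.
Proof. by rewrite mxE sum2. Qed.

(** On 2 x 2 matrices the adjugate is linear. This closed form makes that
visible; on SL_2 it is the inverse. *)
Definition adj2 A : 'M[R]_2 := (\tr A)%:M - A.

Lemma adj2E A : adj2 A = \adj A.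
Proof.
apply: mx2P; rewrite !mxE /cofactor !det_mx11 !mxE /= tr2E ?(expr0, expr1, mul1r, mulN1r, mulr0n, mulr1n, sub0r).
- by rewrite addrC addKr; congr (A _ _); apply: val_inj.
- by congr (- A _ _); apply: val_inj.
- by congr (- A _ _); apply: val_inj.
- by rewrite addrK sqrrN expr1n mul1r; congr (A _ _); apply: val_inj.
Qed.

Lemma mulmx_adj2 A : A *m adj2 A = (\det A)%:M.
Proof. by rewrite adj2E mul_mx_adj. Qed.
Lemma adj2_mulmx A : adj2 A *m A = (\det A)%:M.
Proof. by rewrite adj2E mul_adj_mx. Qed.
Lemma adj2K A : adj2 (adj2 A) = A.
Proof.
rewrite {1}/adj2 /adj2 mxtraceD mxtrace_scalar raddfN /= mulr2n addrK.
by rewrite opprB addrC subrK.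
Qed.
Lemma adj2M A B : adj2 (A *m B) = adj2 B *m adj2 A.
Proof.
by apply: mx2P; rewrite !(mul2E, mxE, tr2E) /= ?(mulr0n, mulr1n); ring.
Qed.
Lemma det_adj2 A : \det (adj2 A) = \det A.
Proof. by rewrite !det2E !mxE /= tr2E ?(mulr0n, mulr1n); ring. Qed.
Lemma adj2D A B : adj2 (A + B) = adj2 A + adj2 B.
Proof. by rewrite /adj2 mxtraceD raddfD /= opprD addrACA. Qed.
Lemma adj2N A : adj2 (- A) = - adj2 A.
Proof. by rewrite /adj2 !raddfN opprB /= opprK addrC. Qed.
Lemma adj2_scalar (a : R) : adj2 a%:M = a%:M.
Proof. by rewrite /adj2 mxtrace_scalar mulr2n raddfD /= addrK. Qed.
Lemma adj2_0 : adj2 0 = 0.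
Proof. by rewrite /adj2 raddf0 raddf0 subr0. Qed.

End Mx2.

Lemma map_adj2 (R S : comNzRingType) (h : {rmorphism R -> S}) (A : 'M[R]_2) :
  map_mx h (adj2 A) = adj2 (map_mx h A).
Proof. by rewrite /adj2 raddfB /= map_scalar_mx trace_map_mx. Qed.

Section Quat.
Variables (R : comNzRingType) (m u : 'M[R]_2).
Hypotheses (dm : \det m = 1) (du : \det u = 1).
Local Notation x := (\tr m).
Local Notation y := (\tr u).
Local Notation z := (\tr (m *m u)).

Definition quat (a b c d : R) : 'M[R]_2 :=
  a%:M + b *: m + c *: u + d *: (m *m u).

Lemma quat_add a b c d a' b' c' d' :
  quat a b c d + quat a' b' c' d' = quat (a + a') (b + b') (c + c') (d + d').
Proof.
rewrite /quat !scalerDl raddfD /= addrACA; congr (_ + _).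
by rewrite addrACA; congr (_ + _); rewrite addrACA.
Qed.

Lemma quat_scale k a b c d : k *: quat a b c d = quat (k * a) (k * b) (k * c) (k * d).
Proof. by rewrite /quat !scalerDr !scalerA scale_scalar_mx. Qed.

Lemma quat_m : m = quat 0 1 0 0.
Proof. by rewrite /quat !scale0r scale1r raddf0 add0r !addr0. Qed.
Lemma quat_u : u = quat 0 0 1 0.
Proof. by rewrite /quat !scale0r scale1r raddf0 !add0r !addr0. Qed.
Lemma quat_scalar a : a%:M = quat a 0 0 0.
Proof. by rewrite /quat !scale0r !addr0. Qed.
Lemma quat_adj_m : adj2 m = quat x (-1) 0 0.
Proof. by rewrite /quat !scale0r scaleN1r !addr0. Qed.
Lemma quat_adj_u : adj2 u = quat y 0 (-1) 0.
Proof. by rewrite /quat !scale0r scaleN1r !addr0. Qed.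

Let entries := (mul2E, mxE, mulr0n, mulr1n).

(** Only m mu, and not mu m, belongs to the basis: the products are reduced by
the polarized Cayley-Hamilton identity
mu m = y m + x mu + (z - x y) - m mu. The identity is first proved with the
determinants kept as variables, where it holds entry by entry. *)
Lemma quat_mul a0 a1 a2 a3 b0 b1 b2 b3 :
  quat a0 a1 a2 a3 *m quat b0 b1 b2 b3 = quat
    (a0 * b0 - a1 * b1 - a2 * b2 - a3 * b3
      + (z - x * y) * (a2 * b1) - x * (a2 * b3) - y * (a3 * b1))
    (a0 * b1 + a1 * b0 + x * (a1 * b1) + y * (a2 * b1) + a2 * b3
      + z * (a3 * b1) - a3 * b2)
    (a0 * b2 + a2 * b0 - a1 * b3 + x * (a2 * b1) + y * (a2 * b2) + z * (a2 * b3)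
      + a3 * b1)
    (a0 * b3 + a3 * b0 + a1 * b2 + x * (a1 * b3) - a2 * b1
      + y * (a3 * b2) + z * (a3 * b3)).
Proof.
transitivity (quat
    (a0 * b0 - \det m * (a1 * b1) - \det u * (a2 * b2)
      - \det m * \det u * (a3 * b3) + (z - x * y) * (a2 * b1)
      - \det u * x * (a2 * b3) - \det m * y * (a3 * b1))
    (a0 * b1 + a1 * b0 + x * (a1 * b1) + y * (a2 * b1) + \det u * (a2 * b3)
      + z * (a3 * b1) - \det u * (a3 * b2))
    (a0 * b2 + a2 * b0 - \det m * (a1 * b3) + x * (a2 * b1) + y * (a2 * b2)
      + z * (a2 * b3) + \det m * (a3 * b1))
    (a0 * b3 + a3 * b0 + a1 * b2 + x * (a1 * b3) - a2 * b1
      + y * (a3 * b2) + z * (a3 * b3))); last first.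
  by rewrite dm du; congr quat; ring.
apply: mx2P; rewrite !entries !det2E !tr2E !entries /=.
all: move: (m 0 0) (m 0 1) (m 1 0) (m 1 1) (u 0 0) (u 0 1) (u 1 0) (u 1 1).
all: by move=> *; ring.
Qed.

Lemma quat_det a b c d :
  \det (quat a b c d) = a ^+ 2 + b ^+ 2 + c ^+ 2 + d ^+ 2 + x * (a * b)
    + y * (a * c) + z * (a * d) + (x * y - z) * (b * c) + y * (b * d)
    + x * (c * d).
Proof.
transitivity (a ^+ 2 + \det m * b ^+ 2 + \det u * c ^+ 2
    + \det m * \det u * d ^+ 2 + x * (a * b)
    + y * (a * c) + z * (a * d) + (x * y - z) * (b * c) + \det m * y * (b * d)
    + \det u * x * (c * d)); last by rewrite dm du; ring.
rewrite !det2E !entries !tr2E !entries /=.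
move: (m 0 0) (m 0 1) (m 1 0) (m 1 1) (u 0 0) (u 0 1) (u 1 0) (u 1 1).
by move=> *; ring.
Qed.

Lemma quat_tr a b c d : \tr (quat a b c d) = 2 * a + x * b + y * c + z * d.
Proof.
by rewrite /quat !mxtraceD !mxtraceZ mxtrace_scalar; ring.
Qed.

Lemma quat_adj a b c d :
  adj2 (quat a b c d) = quat (a + x * b + y * c + z * d) (- b) (- c) (- d).
Proof.
rewrite /adj2 quat_tr -[- quat _ _ _ _]scaleN1r quat_scale quat_scalar quat_add.
by move: x y z => X Y Z; congr quat; ring.
Qed.

End Quat.

(** * The commutators and the relator in quaternion coordinates *)

Section Commutators.
Variables (R : comNzRingType) (m u : 'M[R]_2).
Hypotheses (dm : \det m = 1) (du : \det u = 1).
Local Notation x := (\tr m).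
Local Notation y := (\tr u).
Local Notation z := (\tr (m *m u)).
Local Notation v := (comm_trace x y z).
Local Notation Q := (quat m u).

Definition wcomm : 'M[R]_2 := u *m m *m adj2 u *m adj2 m.
Definition wcomm' : 'M[R]_2 := adj2 m *m adj2 u *m m *m u.

Lemma wcommE : wcomm =
  Q (x ^+ 2 - x * y * z + z ^+ 2 - 1) (y * z - x) y (- z).
Proof.
transitivity (Q 0 0 1 0 *m Q 0 1 0 0 *m Q y 0 (-1) 0 *m Q x (-1) 0 0).
  congr (_ *m _ *m _ *m _); [exact: quat_u|exact: quat_m|exact: quat_adj_u|exact: quat_adj_m].
rewrite !(quat_mul dm du); move: x y z => X Y Z; congr quat; ring.
Qed.

Lemma wcomm'E : wcomm' = Q (x ^+ 2 - 1) (- x) (y - x * z) z.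
Proof.
transitivity (Q x (-1) 0 0 *m Q y 0 (-1) 0 *m Q 0 1 0 0 *m Q 0 0 1 0).
  congr (_ *m _ *m _ *m _); [exact: quat_adj_m|exact: quat_adj_u|exact: quat_m|exact: quat_u].
rewrite !(quat_mul dm du); move: x y z => X Y Z; congr quat; ring.
Qed.

Lemma det_wcomm : \det wcomm = 1.
Proof. by rewrite /wcomm !det_mulmx !det_adj2 dm du !mulr1. Qed.
Lemma tr_wcomm : \tr wcomm = v.
Proof. by rewrite wcommE quat_tr /comm_trace; move: x y z => X Y Z; ring. Qed.
Lemma tr_wcomm' : \tr wcomm' = v.
Proof. by rewrite wcomm'E quat_tr /comm_trace; move: x y z => X Y Z; ring. Qed.

(** For v = 2 the two matrices have a common eigenvector over some extension;
away from it m mu - mu m is invertible. *)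
Lemma det_commutator : \det (m *m u - u *m m) = 2 - v.
Proof.
have -> : m *m u - u *m m = Q 0 0 0 1 - Q 0 0 1 0 *m Q 0 1 0 0.
  by rewrite -quat_m -quat_u /quat raddf0 !scale0r scale1r !add0r.
rewrite (quat_mul dm du) -[- quat _ _ _ _ _ _]scaleN1r quat_scale quat_add (quat_det dm du).
by rewrite /comm_trace; move: x y z => X Y Z; ring.
Qed.

Section Powers.
Variables s t : R.
(** The value of w^n when s = S_(n-1)(v) and t = S_(n-2)(v). *)
Definition Wpow := s *: wcomm - t%:M.
Definition Wpow' := s *: wcomm' - t%:M.
Definition Womega := Wpow *m m *m Wpow'.
Definition fval := s * (x * y - z * v) + t * (2 * z - x * y).

Lemma WpowE : Wpow =
  Q (s * (x ^+ 2 - x * y * z + z ^+ 2 - 1) - t) (s * (y * z - x)) (s * y) (- (s * z)).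
Proof.
rewrite /Wpow wcommE quat_scale (quat_scalar m u) -[- quat _ _ _ _ _ _]scaleN1r.
by rewrite quat_scale quat_add; move: x y z => X Y Z; congr quat; ring.
Qed.

Lemma Wpow'E : Wpow' =
  Q (s * (x ^+ 2 - 1) - t) (- (s * x)) (s * (y - x * z)) (s * z).
Proof.
rewrite /Wpow' wcomm'E quat_scale (quat_scalar m u) -[- quat _ _ _ _ _ _]scaleN1r.
by rewrite quat_scale quat_add; move: x y z => X Y Z; congr quat; ring.
Qed.

(** The word omega is a palindrome, so its coordinates are symmetric under the
anti-automorphism that fixes m and mu: there is no m mu term, and only the
coefficient s f_n of mu contributes to the commutator with m. *)
Lemma commute_Womega : m *m Womega - Womega *m m = (s * fval) *: (m *m u - u *m m).
Proof.
pose k0 := s * s * (x ^+ 3 - x ^+ 2 * y * z + x * z ^+ 2 - 2 * x + y * z)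
  - s * t * (2 * x - x * y ^+ 2 + y * z).
pose k1 := s * s * (1 - x ^+ 2 + x * y * z - z ^+ 2) - s * t * (y ^+ 2 - 2) + t * t.
have eO : Womega = Q k0 k1 (s * fval) 0.
  rewrite /Womega WpowE Wpow'E [X in _ *m X *m _](quat_m m u) !(quat_mul dm du).
  rewrite /k0 /k1 /fval /comm_trace.
  by move: x y z => X Y Z; congr quat; ring.
have -> : m *m u - u *m m = Q 0 0 0 1 - Q 0 0 1 0 *m Q 0 1 0 0.
  by rewrite -quat_m -quat_u /quat raddf0 !scale0r scale1r !add0r.
transitivity (Q 0 1 0 0 *m Q k0 k1 (s * fval) 0 - Q k0 k1 (s * fval) 0 *m Q 0 1 0 0).
  by rewrite -!quat_m eO.
rewrite !(quat_mul dm du) -![- quat _ _ _ _ _ _]scaleN1r !quat_scale !quat_add quat_scale.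
by clear eO; move: k0 k1 fval x y z => K0 K1 f X Y Z; congr quat; ring.
Qed.

(** The derivatives of w^n and w'^n along mu are (w^n - 1) (w - 1)^-1 times
those of w and w', and (w^-1 - 1) (w - 1) = 2 - v. Clearing this denominator
gives [foxX] and [foxY], and [foxG] is 2 - v times the derivative of omega. *)
Definition foxX : 'M[R]_2 := (adj2 wcomm - 1%:M) *m (1%:M - u *m m *m adj2 u).
Definition foxY : 'M[R]_2 :=
  (adj2 wcomm' - 1%:M) *m (adj2 m *m adj2 u *m (m - 1%:M)).

Lemma foxXE : foxX = Q (x - x * y ^+ 2 + y ^+ 2 + y * z - 2) (x + y ^+ 2 - y * z - 2)
   (x * y - y - z) (z - y).
Proof.
transitivity ((Q v 0 0 0 - wcomm - Q 1 0 0 0) *m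
  (Q 1 0 0 0 - Q 0 0 1 0 *m Q 0 1 0 0 *m Q y 0 (-1) 0)).
  by rewrite -!quat_scalar -quat_m -quat_u -quat_adj_u -tr_wcomm.
rewrite wcommE !(quat_mul dm du) -![- quat _ _ _ _ _ _]scaleN1r.
rewrite !quat_scale !quat_add !(quat_mul dm du).
by rewrite /comm_trace; move: x y z => X Y Z; congr quat; ring.
Qed.

Lemma foxYE : foxY = Q (x * y + x * z - x ^+ 2 * y + y - z) (x * y - y - z)
  (x ^+ 2 - x - 2) (2 - x).
Proof.
transitivity ((Q v 0 0 0 - wcomm' - Q 1 0 0 0) *m
  (Q x (-1) 0 0 *m Q y 0 (-1) 0 *m (Q 0 1 0 0 - Q 1 0 0 0))).
  by rewrite -!quat_scalar -quat_m -quat_adj_u -quat_adj_m -tr_wcomm'.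
rewrite wcomm'E !(quat_mul dm du) -![- quat _ _ _ _ _ _]scaleN1r.
rewrite !quat_scale !quat_add !(quat_mul dm du).
by rewrite /comm_trace; move: x y z => X Y Z; congr quat; ring.
Qed.

Definition foxG := (Wpow - 1%:M) *m foxX + Wpow *m m *m ((Wpow' - 1%:M) *m foxY).

(** [foxG] is w^n [foxZ] - [foxX], where w^n has determinant 1 and the
coordinates of [foxZ] are linear in s and t; this keeps the degrees in the
determinant small. *)
Definition foxZ := foxX + m *m ((Wpow' - 1%:M) *m foxY).

Lemma foxZE : foxZ = Q
    (- x * y ^+ 2 + x + y ^+ 2 + y * z - 2
      + s * (- x ^+ 3 * y + x ^+ 2 * y ^+ 2 * z + x ^+ 2 * y + x ^+ 2 * z
        - x * y ^+ 3 - x * y ^+ 2 * z - 2 * x * y * z ^+ 2 + 3 * x * y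
        + y ^+ 3 + y ^+ 2 * z + y * z ^+ 2 - 3 * y + z ^+ 3 - 3 * z)
      - (t + 1) * (- x * y + y + z))
    (x + y ^+ 2 - y * z - 2
      + s * (y - z)
      - (t + 1) * (y - z))
    (x * y - y - z
      + s * (x ^+ 3 - x ^+ 2 * y * z - x ^+ 2
        + x * y ^+ 2 + x * y * z + x * z ^+ 2 - 3 * x - y ^+ 2 - z ^+ 2 + 2)
      - (t + 1) * (x - 2))
    (- y + z
      + s * (- x ^+ 2 + x * y * z + x - y ^+ 2 - z ^+ 2 + 2)
      - (t + 1) * (x - 2)).
Proof.
transitivity (foxX + Q 0 1 0 0 *m ((s *: wcomm' - Q t 0 0 0 - Q 1 0 0 0) *m foxY)).
  by rewrite -!quat_scalar -quat_m.
rewrite wcomm'E foxXE foxYE -![- quat _ _ _ _ _ _]scaleN1r !quat_scale !quat_add.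
rewrite !(quat_mul dm du) quat_add.
by move: x y z => X Y Z; congr quat; ring.
Qed.

End Powers.
End Commutators.

(** * The determinant of the Fox derivative *)

Section FoxDeterminant.
Variables (R : comNzRingType) (m u : 'M[R]_2).
Hypotheses (dm : \det m = 1) (du : \det u = 1).
Local Notation x := (\tr m).
Local Notation y := (\tr u).
Local Notation z := (\tr (m *m u)).
Local Notation v := (comm_trace x y z).
Local Notation Q := (quat m u).
Variables s t : R.
Hypothesis st : s ^+ 2 - v * s * t + t ^+ 2 = 1.

Lemma det_sub (A B : 'M[R]_2) : \det (A - B) = \det A + \det B - \tr (A *m adj2 B).
Proof.
rewrite !(det2E, tr2E, mul2E, mxE) ?(mulr0n, mulr1n); ring.
Qed.

Lemma det_Wpow : \det (Wpow m u s t) = 1.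
Proof.
rewrite -st /Wpow det_sub -scalemxAl mxtraceZ detZ det_wcomm // det_scalar.
rewrite adj2_scalar mul_mx_scalar mxtraceZ tr_wcomm //.
by ring.
Qed.

(** After removal of the factor (v - 2)^2 this reads
det (d omega / d mu) = 2 tau_n + s f_n. *)
Lemma det_foxG : \det (foxG m u s t) = (v - 2) *
  (2 * ((2 - x - y + z) * s * (v - 2) + (2 - x) * (2 - y) * (s - t - 1))
   + s * (v - 2) * fval m u s t).
Proof.
have -> : foxG m u s t = Wpow m u s t *m foxZ m u s t - foxX m u.
  by rewrite /foxG /foxZ mulmxDr mulmxBl mul1mx -[_ *m m *m _]mulmxA addrAC.
rewrite det_sub det_mulmx det_Wpow mul1r.
rewrite WpowE // foxZE // foxXE // quat_adj !(quat_mul dm du) quat_tr.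
rewrite !(quat_det dm du) /fval.
set L := (X in X = _).
(* The last summand is the multiple of the relation between s and t by which
   the two sides differ as polynomials in x, y, z, s, t. *)
suff -> : L = (v - 2) *
  (2 * ((2 - x - y + z) * s * (v - 2) + (2 - x) * (2 - y) * (s - t - 1))
   + s * (v - 2) * (s * (x * y - z * v) + t * (2 * z - x * y)))
  + (v - 2) * (2 - x) * (y - 1) * (s ^+ 2 - v * s * t + t ^+ 2 - 1).
  by rewrite st subrr mulr0 addr0.
rewrite /L /comm_trace; move: x y z => X Y Z.
ring.
Qed.
End FoxDeterminant.

(** * Chains, words and Fox derivatives *)

Section LinearExtension.
Variables (K : choiceType) (V W : zmodType) (F : K -> {additive V -> W}).
Implicit Types c d : {malg V[K]}.

(** The bar differential and the Fox map are both given on the basis symbols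
v (x) [g]; this is their common extension by additivity. *)
Definition lext c : W := \sum_(g <- monalg.msupp c) F g (monalg.mcoeff g c).

Lemma lextEw c (D : {fset K}) : (monalg.msupp c `<=` D)%fset ->
  lext c = \sum_(g <- D) F g (monalg.mcoeff g c).
Proof.
move=> cD; apply: big_fset_incl => // g _ /mcoeff_outdom ->; exact: raddf0.
Qed.

Lemma lextD c d : lext (c + d) = lext c + lext d.
Proof.
pose D := (monalg.msupp c `|` monalg.msupp d)%fset.
rewrite (lextEw (monalg.msuppD_le c d)) (@lextEw c D) ?(@lextEw d D) ?fsubsetUl ?fsubsetUr //.
by rewrite -big_split /=; apply: eq_bigr => g _; rewrite monalg.mcoeffD raddfD.
Qed.

Lemma lextN c : lext (- c) = - lext c.
Proof.
rewrite /lext monalg.msuppN -sumrN; apply: eq_bigr => g _.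
by rewrite monalg.mcoeffN raddfN.
Qed.

Lemma lextU v g : lext << v *g g >> = F g v.
Proof.
rewrite (lextEw monalg.msuppU_le) big_seq_fset1 monalg.mcoeffU eqxx.
by rewrite mulr1n.
Qed.

End LinearExtension.

Section Words.
Variables (R : comNzRingType) (g : bool -> 'M[R]_2).
Implicit Types (l : letter bool) (w : word bool).

Definition lmat l : 'M[R]_2 := if l.2 then adj2 (g l.1) else g l.1.
Definition weval w : 'M[R]_2 := foldr (fun l A => lmat l *m A) 1%:M w.
Fixpoint foxd (i : bool) w : 'M[R]_2 :=
  if w is l :: w' then
    (if l.1 == i then (if l.2 then - lmat l else 1%:M) else 0)
    + lmat l *m foxd i w'
  else 0.

Lemma weval_cat w1 w2 : weval (w1 ++ w2) = weval w1 *m weval w2.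
Proof. by elim: w1 => [|l w1 IH] /=; rewrite ?mul1mx // IH mulmxA. Qed.

Lemma foxd_cat i w1 w2 : foxd i (w1 ++ w2) = foxd i w1 + weval w1 *m foxd i w2.
Proof.
elim: w1 => [|l w1 IH] /=; first by rewrite add0r mul1mx.
by rewrite IH mulmxDr addrA mulmxA.
Qed.

Hypothesis dg : forall i, \det (g i) = 1.

Lemma det_lmat l : \det (lmat l) = 1.
Proof. by rewrite /lmat; case: ifP => _; rewrite ?det_adj2. Qed.

Lemma det_weval w : \det (weval w) = 1.
Proof. by elim: w => [|l w IH] /=; rewrite ?det1 // det_mulmx det_lmat mul1r. Qed.

Lemma lmat_inv l : lmat (letter_inv l) = adj2 (lmat l).
Proof. by case: l => i []; rewrite /lmat /= ?adj2K. Qed.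

Lemma weval_inv w : weval (word_inv w) = adj2 (weval w).
Proof.
rewrite /word_inv; elim: w => [|l w IH] /=; first by rewrite adj2_scalar.
by rewrite rev_cons -cats1 weval_cat IH /= mulmx1 lmat_inv adj2M.
Qed.

(** The fundamental formula of Fox calculus; it says that the Fox map from bar
chains to the complex of the presentation commutes with the differentials. *)
Lemma fox_fundamental w :
  foxd false w *m (g false - 1%:M) + foxd true w *m (g true - 1%:M)
  = weval w - 1%:M.
Proof.
elim: w => [|[i b] w IH] /=; first by rewrite !mul0mx addr0 subrr.
rewrite !mulmxDl -!mulmxA addrACA -mulmxDr IH.
set X := (X in X + _ = _).
suff -> : X = lmat (i, b) - 1%:M.
  by rewrite [LHS]addrC mulmxBr mulmx1 addrA subrK.
by rewrite {}/X; case: i; case: b; rewrite /lmat /= mul0mx ?add0r ?addr0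
  ?mul1mx // mulNmx mulmxBr adj2_mulmx dg mulmx1 opprB.
Qed.

End Words.

(** * Fox calculus for the relator of the twisted Whitehead link *)

Section WordPowers.
Variables (R : comNzRingType) (g : bool -> 'M[R]_2).
Hypothesis dg : forall i, \det (g i) = 1.
Variable c : word bool.
Local Notation C := (weval g c).
Local Notation v := (\tr C).

Let adjCC : adj2 C *m C = 1%:M.
Proof. by rewrite adj2_mulmx det_weval. Qed.
Let CadjC : C *m adj2 C = 1%:M.
Proof. by rewrite mulmx_adj2 det_weval. Qed.

Lemma foxd_word_inv i (w : word bool) :
  foxd g i (word_inv w) = - adj2 (weval g w) *m foxd g i w.
Proof.
elim: w => [|[j b] w IH]; first by rewrite /= mulmx0.
rewrite /word_inv map_cons rev_cons -cats1 -/(word_inv w) foxd_cat IH.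
rewrite weval_inv // /= mulmx0 addr0 adj2M mulmxDr -[in RHS]mulNmx.
have -> : - adj2 (weval g w) *m adj2 (lmat g (j, b)) *m (lmat g (j, b) *m foxd g i w)
   = - adj2 (weval g w) *m foxd g i w.
  by rewrite mulmxA -[_ *m lmat g _]mulmxA adj2_mulmx det_lmat // mulmx1.
rewrite addrC; congr (_ + _); case: eqP => _; last by rewrite !mulmx0.
rewrite -mulmxA mulNmx -mulmxN; congr (_ *m _).
case: b => /=; last by rewrite mulmx1 lmat_inv.
by rewrite mulmxN opprK adj2_mulmx det_lmat.
Qed.

Lemma word_expzS (n : int) :
  word_expz c (n + 1) = c ++ word_expz c n \/
  word_expz c n = word_inv c ++ word_expz c (n + 1).
Proof.
case: n => n; first by left; have -> : Posz n + 1 = Posz n.+1 by lia.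
right; case: n => [|n]; first by [].
by have -> : Negz n.+1 + 1 = Negz n by lia.
Qed.

Lemma weval_expzS (n : int) :
  weval g (word_expz c (n + 1)) = C *m weval g (word_expz c n).
Proof.
case: (word_expzS n) => ->; rewrite weval_cat //.
by rewrite weval_inv // mulmxA CadjC mul1mx.
Qed.

Lemma foxd_expzS i (n : int) :
  foxd g i (word_expz c (n + 1)) = foxd g i c + C *m foxd g i (word_expz c n).
Proof.
case: (word_expzS n) => ->; rewrite foxd_cat //.
rewrite weval_inv // foxd_word_inv mulmxDr !mulmxA mulmxN CadjC.
by rewrite mulNmx !mul1mx addNKr.
Qed.

Let mulC_inj (A B : 'M[R]_2) : C *m A = C *m B -> A = B.
Proof. by move=> /(congr1 (mulmx (adj2 C))); rewrite !mulmxA adjCC !mul1mx. Qed.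

Lemma weval_expz (n : int) :
  weval g (word_expz c n) = chebv (n - 1) v *: C - (chebv (n - 2) v)%:M.
Proof.
have CC : C *m C = v *: C - 1%:M.
  have := adjCC; rewrite /adj2 mulmxBl mul_scalar_mx => <-.
  by rewrite opprB addrC subrK.
have step (k : int) : chebv k v *: C - (chebv (k - 1) v)%:M =
    C *m (chebv (k - 1) v *: C - (chebv (k - 2) v)%:M).
  have := chebv_rec (k - 2) v.
  have -> : k - 2 + 2 = k by lia.
  have -> : k - 2 + 1 = k - 1 by lia.
  move=> ->; rewrite mulmxBr -scalemxAr CC mul_mx_scalar scalerBr scalemx1 scalerA.
  by rewrite scalerBl [v * _]mulrC addrAC.
have e1 (k : int) : k + 1 - 1 = k by lia.
have e2 (k : int) : k + 1 - 2 = k - 1 by lia.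
elim/int_step_ind: n => [|k IH|k].
- have -> : 0 - 1 = - 1 :> int by [].
  have := chebv_rec (- 2) v; have -> : - 2 + 2 = 0 :> int by [].
  have -> : - 2 + 1 = - 1 :> int by [].
  rewrite chebv0 chebvN1 mulr0 sub0r => e.
  have -> : 0 - 2 = - 2 :> int by [].
  by rewrite scale0r sub0r -raddfN /= -e.
- by rewrite e1 e2 weval_expzS IH step.
- by rewrite e1 e2 weval_expzS step => /mulC_inj.
Qed.

Lemma foxd_expz i (n : int) :
  (C - 1%:M) *m foxd g i (word_expz c n) =
  (weval g (word_expz c n) - 1%:M) *m foxd g i c.
Proof.
have comm (X : 'M[R]_2) : (C - 1%:M) *m (C *m X) = C *m ((C - 1%:M) *m X).
  by rewrite !mulmxA mulmxBl mulmxBr mul1mx mulmx1.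
have step (k : int) : (weval g (word_expz c (k + 1)) - 1%:M) *m foxd g i c =
   (C - 1%:M) *m foxd g i c + C *m ((weval g (word_expz c k) - 1%:M) *m foxd g i c).
  rewrite weval_expzS mulmxA -mulmxDl mulmxBr mulmx1; congr (_ *m _).
  by rewrite [RHS]addrC addrA subrK.
elim/int_step_ind: n => [|k IH|k].
- by rewrite /= mulmx0 subrr mul0mx.
- by rewrite foxd_expzS step mulmxDr comm IH.
- by rewrite foxd_expzS step mulmxDr comm => /addrI /mulC_inj.
Qed.

(** A form of (w^n - 1) (w - 1)^-1 dw that covers negative n and needs no
invertibility of w - 1. *)
Lemma foxd_expz_scaled i (n : int) :
  (2 - v) *: foxd g i (word_expz c n) =
  (weval g (word_expz c n) - 1%:M) *m ((adj2 C - 1%:M) *m foxd g i c).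
Proof.
have e : (adj2 C - 1%:M) *m (C - 1%:M) = (2 - v)%:M.
  rewrite mulmxBr mulmx1 mulmxBl adjCC mul1mx /adj2.
  have -> : (2 - v)%:M = 1%:M + 1%:M - v%:M :> 'M[R]_2 by rewrite -!raddfD -raddfB.
  by rewrite opprB opprB addrACA addKr.
have comm : comm_mx (adj2 C - 1%:M) (weval g (word_expz c n) - 1%:M).
  apply/comm_mx_sym/comm_mxB; last exact: comm_mx1.
  apply/comm_mx_sym/comm_mxB; last exact: comm_mx1.
  rewrite /comm_mx weval_expz (mulmxBr (adj2 C)) (mulmxBl (_ *: C)).
  by rewrite -scalemxAr -scalemxAl adjCC CadjC mul_mx_scalar mul_scalar_mx.
rewrite -mul_scalar_mx -e -mulmxA foxd_expz [LHS]mulmxA [RHS]mulmxA.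
by congr (_ *m _); exact: comm.
Qed.

End WordPowers.

Section WhiteheadWords.
Variables (n : int) (R : comNzRingType) (g : bool -> 'M[R]_2).
Hypothesis dg : forall i, \det (g i) = 1.
Local Notation m := (g false).
Local Notation u := (g true).
Local Notation v := (comm_trace (\tr m) (\tr u) (\tr (m *m u))).
Local Notation s := (chebv (n - 1) v).
Local Notation t := (chebv (n - 2) v).
Let lm : letter bool := (false, false).
Let lu : letter bool := (true, false).
Let c := [:: lu; lm; letter_inv lu; letter_inv lm].
Let c' := [:: letter_inv lm; letter_inv lu; lm; lu].

Let wc : weval g c = wcomm m u.
Proof. by rewrite /= mulmx1 /wcomm !mulmxA. Qed.
Let wc' : weval g c' = wcomm' m u.
Proof. by rewrite /= mulmx1 /wcomm' !mulmxA. Qed.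

Let trc : \tr (weval g c) = v. Proof. by rewrite wc tr_wcomm. Qed.
Let trc' : \tr (weval g c') = v. Proof. by rewrite wc' tr_wcomm'. Qed.

Let Wn : weval g (word_expz c n) = Wpow m u s t.
Proof. by rewrite weval_expz // trc wc. Qed.
Let Wn' : weval g (word_expz c' n) = Wpow' m u s t.
Proof. by rewrite weval_expz // trc' wc'. Qed.

Lemma weval_omega : weval g (whitehead_omega n) = Womega m u s t.
Proof.
rewrite /whitehead_omega !weval_cat Wn Wn' /Womega mulmxA.
by congr (_ *m _ *m _); rewrite /= mulmx1.
Qed.

Lemma cheb_relation : s ^+ 2 - v * s * t + t ^+ 2 = 1.
Proof. by have := chebv_norm (n - 1) v; have -> : n - 1 - 1 = n - 2 by lia. Qed.

Lemma whitehead_relation :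
  weval g (lm :: whitehead_omega n) - weval g (rcons (whitehead_omega n) lm) =
  (s * fval m u s t) *: (m *m u - u *m m).
Proof.
by rewrite -cats1 weval_cat /= mulmx1 weval_omega -commute_Womega.
Qed.

Let fox_c : foxd g true c = 1%:M - u *m m *m adj2 u.
Proof.
rewrite /= /lmat /= !(mulmx0, addr0, add0r); congr (_ + _).
by rewrite !mulmxN mulmxA.
Qed.

Let fox_c' : foxd g true c' = adj2 m *m adj2 u *m (m - 1%:M).
Proof.
rewrite /= /lmat /= !(mulmx0, addr0, add0r, mulmx1) -mulmxA; congr (_ *m _).
by rewrite addrC (mulmxBr (adj2 u)) mulmx1.
Qed.

Lemma foxd_omega : (2 - v) *: foxd g true (whitehead_omega n) = foxG m u s t.
Proof.
rewrite /whitehead_omega !foxd_cat Wn scalerDr -{1}trc foxd_expz_scaled // Wn wc fox_c.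
rewrite /foxG; congr (_ + _).
have -> : foxd g true [:: lm] = 0 by rewrite /= mulmx0 addr0.
rewrite add0r 2!scalemxAr -trc' foxd_expz_scaled // Wn' wc' fox_c'.
by rewrite /= mulmx1 [LHS]mulmxA tr_wcomm'.
Qed.

Lemma foxd_relation :
  foxd g true (lm :: whitehead_omega n) - foxd g true (rcons (whitehead_omega n) lm)
  = (m - 1%:M) *m foxd g true (whitehead_omega n).
Proof.
rewrite -cats1 foxd_cat /= mulmx0 addr0 mulmx0 addr0 add0r.
by rewrite mulmxBl mul1mx.
Qed.

Lemma det_sub1 : \det (m - 1%:M) = 2 - \tr m.
Proof.
rewrite det_sub det1 dg adj2_scalar mulmx1; ring.
Qed.

(** Along mu the relator m omega = omega m has derivative
(m - 1) (d omega / d mu). *)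
Lemma det_fox_relation : GRing.lreg (v - 2) -> fval m u s t = 0 ->
  \det (foxd g true (lm :: whitehead_omega n)
         - foxd g true (rcons (whitehead_omega n) lm)) =
  2 * (2 - \tr m) * evalZ (poly_tau n) (\tr m) (\tr u) (\tr (m *m u)).
Proof.
move=> uv f0; rewrite foxd_relation det_mulmx det_sub1.
set G := foxd g true _; set tau := evalZ _ _ _ _.
suff : (v - 2) ^+ 2 * \det G = (v - 2) ^+ 2 * (2 * tau).
  by move=> /(lregX (n := 2) uv) ->; ring.
have := det_foxG (dg false) (dg true) cheb_relation; rewrite -foxd_omega -/G f0.
rewrite detZ mulr0 addr0 -evalZ_tau -/tau => e.
transitivity ((2 - v) ^+ 2 * \det G); first by ring.
by rewrite e; ring.
Qed.

End WhiteheadWords.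

(** * The bar complex in low degrees *)

Section BarLowDegree.
Variables (R : comNzRingType) (G : groupType) (rho : G -> 'M[R]_2).

Section Term.
Variables (k : nat) (g : k.+1.-tuple G).
Definition bar_term (v : 'cV[R]_2) : chain R G k :=
  \sum_(i < k.+2)
    let vg := if i == ord0 then rho (tnth g ord0)^-1%g *m v else v in
    << (-1) ^+ i *: vg *g bar_face i g >>.
Fact bar_term_additive : nmod_morphism bar_term.
Proof.
split.
  by rewrite /bar_term big1 // => i _; case: ifP => _; rewrite ?mulmx0 scaler0 monalgU0.
move=> v w; rewrite /bar_term -big_split /=; apply: eq_bigr => i _.
by rewrite -monalgUD -scalerDr; case: ifP => _; rewrite ?mulmxDr.
Qed.
HB.instance Definition _ := GRing.isNmodMorphism.Build _ _ bar_term bar_term_additive.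
End Term.

Lemma bar_dE k (c : chain R G k.+1) : bar_d rho c = lext (@bar_term k) c.
Proof. by []. Qed.

Lemma bar_dD k (c d : chain R G k.+1) : bar_d rho (c + d) = bar_d rho c + bar_d rho d.
Proof. exact: (lextD (@bar_term k) c d). Qed.
Lemma bar_dN k (c : chain R G k.+1) : bar_d rho (- c) = - bar_d rho c.
Proof. exact: (lextN (@bar_term k) c). Qed.

Lemma bar_d0U g v : bar_d rho (<< v *g [tuple g] >> : chain R G 1) =
  << rho g^-1%g *m v - v *g [tuple] >>.
Proof.
have e i : @bar_face G 0 i [tuple g] = [tuple] by apply: eq_from_tnth => -[].
rewrite bar_dE lextU /= /bar_term big_ord_recl big_ord1 /= !e.
by rewrite expr0 scale1r expr1 scaleN1r monalgUD.
Qed.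

Lemma bar_d1U g h v : bar_d rho (<< v *g [tuple g; h] >> : chain R G 2) =
  << rho g^-1%g *m v *g [tuple h] >> - << v *g [tuple (g * h)%g] >>
  + << v *g [tuple g] >>.
Proof.
rewrite bar_dE lextU /= /bar_term !big_ord_recl big_ord0 /= addr0.
have e (i : 'I_3) a : (if (1 < i)%N then g else if 1 == i :> nat then (g * h)%g else h) = a ->
    @bar_face G 1 i [tuple g; h] = [tuple a].
  by move=> <-; apply: eq_from_tnth => j; rewrite [j]ord1 tnth_mktuple.
rewrite (e _ h) // (e _ (g * h)%g) // (e _ g) //.
by rewrite expr0 scale1r expr1 scaleN1r monalgUN sqrrN expr1n scale1r addrA.
Qed.

Definition boundary1 := @boundary R G rho 1.

Lemma boundaryD c d : boundary1 c -> boundary1 d -> boundary1 (c + d).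
Proof. by case=> a -> [b ->]; exists (a + b); rewrite bar_dD. Qed.
Lemma boundaryN c : boundary1 c -> boundary1 (- c).
Proof. by case=> a ->; exists (- a); rewrite bar_dN. Qed.
Lemma boundary_0 : boundary1 0.
Proof. by exists 0; rewrite -[in RHS](subrr 0) bar_dD bar_dN subrr. Qed.

Lemma boundary_mul g h v :
  boundary1 (<< v *g [tuple (g * h)%g] >>
    - (<< v *g [tuple g] >> + << rho g^-1%g *m v *g [tuple h] >>)).
Proof.
have rearrange (V : zmodType) (a b c : V) : b - (c + a) = - (a - b + c).
  by rewrite !opprD opprK [- c - a]addrC addrA [b - a]addrC.
by exists (- << v *g [tuple g; h] >>); rewrite bar_dN bar_d1U; apply: rearrange.
Qed.

End BarLowDegree.

(** * Representations of a presented group *)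

Section RepOfPresentation.
Variables (rels : seq (word bool * word bool)) (R : comNzRingType).
Local Notation G := (pres_group rels).

Section Values.
Variable rho : G -> 'M[R]_2.
Hypothesis rhoP : is_SL2_rep (G := G) rho.
Let g i := rho (pres_gen rels i).

Lemma rep_inv a : rho a^-1%g = adj2 (rho a).
Proof.
case: rhoP => d1 r1 rM.
have := congr1 (mulmx (adj2 (rho a))) (rM a a^-1%g).
by rewrite mulgV r1 mulmxA adj2_mulmx d1 mul1mx mulmx1.
Qed.

Lemma rep_word w : rho (word_elt rels w) = weval g w.
Proof.
case: (rhoP) => d1 r1 rM; elim: w => [|[i b] w IH] /=; first exact: r1.
have -> : word_elt rels ((i, b) :: w) = (word_elt rels [:: (i, b)] * word_elt rels w)%g.
  exact/esym/pres_mulE.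
rewrite rM IH; congr (_ *m _); case: b => //.
rewrite /lmat /= /g -rep_inv; congr rho; symmetry; apply: mulg1_eq.
rewrite [LHS]pres_mulE; apply/word_eltP.
exact: (@PresFree _ rels (i, false)).
Qed.
End Values.

Section Extension.
Variable g : bool -> 'M[R]_2.
Hypotheses (dg : forall i, \det (g i) = 1)
  (rg : forall r, r \in rels -> weval g r.1 = weval g r.2).

(** A pair of matrices of determinant 1 that satisfies the relators has the same
value on equivalent words, hence defines a representation. *)
Lemma weval_pres_eq w1 w2 : pres_eq rels w1 w2 -> weval g w1 = weval g w2.
Proof.
elim=> {w1 w2} [//|w1 w2 _ -> //|w1 w2 w3 _ -> _ -> //|w1 w1' w2 w2' _ e1 _ e2|l|r /rg //].
  by rewrite !weval_cat e1 e2.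
by rewrite /= mulmx1 lmat_inv mulmx_adj2 det_lmat.
Qed.

Definition rep_of (a : G) := weval g (repr a).

Lemma rep_of_word w : rep_of (word_elt rels w) = weval g w.
Proof. exact/weval_pres_eq/pres_eq_repr. Qed.

Lemma rep_ofP : is_SL2_rep (G := G) rep_of.
Proof.
split=> [a||a b]; first exact: det_weval.
  exact: rep_of_word.
by rewrite rep_of_word weval_cat.
Qed.

Lemma rep_of_gen i : rep_of (pres_gen rels i) = g i.
Proof. by rewrite rep_of_word /= mulmx1. Qed.
End Extension.

End RepOfPresentation.

(** * First homology from the Fox complex *)

Section FoxHomology.

Variables (r : word bool * word bool) (R : comNzRingType).
Local Notation rels := [:: r].
Local Notation G := (pres_group rels).
Variable rho : G -> 'M[R]_2.
Hypothesis rhoP : is_SL2_rep (G := G) rho.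
Definition gval i := rho (pres_gen rels i).
Local Notation g := gval.

Lemma det_gval i : \det (g i) = 1.
Proof. by case: rhoP => d1 _ _; apply: d1. Qed.

(** The image of v (x) [w] in the complex of the presentation. The right action
is v g = rho(g^-1) v, so the usual Fox derivative enters through its
adjugate: on SL_2 this reverses products and inverts group elements. *)
Definition foxcol (w : word bool) (v : 'cV[R]_2) : 'cV[R]_(2 + 2) :=
  col_mx (adj2 (foxd g false w) *m v) (adj2 (foxd g true w) *m v).
Definition fox_d1 : 'M[R]_(2, 2 + 2) :=
  row_mx (adj2 (g false) - 1%:M) (adj2 (g true) - 1%:M).
Definition fox_d2 : 'M[R]_(2 + 2, 2) :=
  col_mx (adj2 (foxd g false r.1 - foxd g false r.2))
         (adj2 (foxd g true r.1 - foxd g true r.2)).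

Lemma foxcol_cat w1 w2 v :
  foxcol (w1 ++ w2) v = foxcol w1 v + foxcol w2 (adj2 (weval g w1) *m v).
Proof.
have e (A W B : 'M[R]_2) :
    adj2 (A + W *m B) *m v = adj2 A *m v + adj2 B *m (adj2 W *m v).
  by rewrite adj2D adj2M (mulmxDl (adj2 A)) mulmxA.
by rewrite /foxcol add_col_mx !foxd_cat !e.
Qed.

Lemma foxcol_nmod w : nmod_morphism (foxcol w).
Proof.
split=> [|v1 v2]; rewrite /foxcol; first by rewrite !mulmx0 col_mx0.
by rewrite !mulmxDr add_col_mx.
Qed.
HB.instance Definition _ w := GRing.isNmodMorphism.Build _ _ (foxcol w) (foxcol_nmod w).

Lemma foxcolZ w a v : foxcol w (a *: v) = a *: foxcol w v.
Proof. by rewrite /foxcol -!scalemxAr scale_col_mx. Qed.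

Lemma fox_d1_col w v : fox_d1 *m foxcol w v = adj2 (weval g w) *m v - v.
Proof.
rewrite /fox_d1 /foxcol mul_row_col !mulmxA -mulmxDl.
have e1 (A : 'M[R]_2) : adj2 A - 1%:M = adj2 (A - 1%:M).
  by rewrite adj2D adj2N adj2_scalar.
rewrite !e1 -!adj2M -adj2D fox_fundamental; last exact: det_gval.
by rewrite -e1 mulmxBl mul1mx.
Qed.

Lemma weval_rel : weval g r.1 = weval g r.2.
Proof.
rewrite -!(rep_word rhoP); congr rho; apply/word_eltP/PresRel; exact: mem_head.
Qed.

Lemma weval_eq w1 w2 : pres_eq rels w1 w2 -> weval g w1 = weval g w2.
Proof. by move=> e; rewrite -!(rep_word rhoP); congr rho; apply/word_eltP. Qed.

(** On words the Fox map is defined on the nose; on group elements it is defined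
only up to boundaries of the presentation complex. *)
Lemma foxcol_pres_eq w1 w2 : pres_eq rels w1 w2 ->
  forall v, exists q, foxcol w1 v = foxcol w2 v + fox_d2 *m q.
Proof.
elim=> {w1 w2}.
- by move=> w v; exists 0; rewrite mulmx0 addr0.
- by move=> w1 w2 _ IH v; case: (IH v) => q ->; exists (- q); rewrite mulmxN addrK.
- move=> w2 w1 w3 _ IH1 _ IH2 v; case: (IH1 v) => q1 ->; case: (IH2 v) => q2 ->.
  by exists (q2 + q1); rewrite mulmxDr addrA.
- move=> u u' w w' eu IH1 _ IH2 v; rewrite !foxcol_cat (weval_eq eu).
  case: (IH1 v) => q1 ->; case: (IH2 (adj2 (weval g u') *m v)) => q2 ->.
  by exists (q1 + q2); rewrite mulmxDr addrACA.
- move=> [i b] v; exists 0; rewrite mulmx0 addr0 /foxcol.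
  suff e j : foxd g j [:: (i, b); letter_inv (i, b)] = 0.
    by rewrite !e /= adj2_0 !mul0mx.
  rewrite /= mulmx0 addr0; case: eqP => _; last by rewrite mulmx0 addr0.
  case: b => /=; rewrite ?mulmx1 ?addNr //.
  by rewrite /lmat /= mulmxN mulmx_adj2 det_gval subrr.
- move=> r'; rewrite inE => /eqP -> v; exists v.
  have e (A B : 'M[R]_2) : adj2 A *m v = adj2 B *m v + adj2 (A - B) *m v.
    by rewrite -mulmxDl -adj2D addrC subrK.
  by rewrite /fox_d2 mul_col_mx /foxcol add_col_mx -!e.
Qed.

Definition fox_chain (c : chain R G 1) : 'cV[R]_(2 + 2) :=
  lext (fun t : 1.-tuple G => foxcol (repr (tnth t ord0))) c.

Definition elt_chain (a : G) (v : 'cV[R]_2) : chain R G 1 := << v *g [tuple a] >>.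

Lemma elt_chainD a v w : elt_chain a (v + w) = elt_chain a v + elt_chain a w.
Proof. exact: monalgUD. Qed.
Lemma elt_chainN a v : elt_chain a (- v) = - elt_chain a v.
Proof. exact: monalgUN. Qed.

Definition chain_of (a : 'cV[R]_(2 + 2)) : chain R G 1 :=
  elt_chain (pres_gen rels false) (usubmx a) + elt_chain (pres_gen rels true) (dsubmx a).

Lemma fox_chainU a v : fox_chain (elt_chain a v) = foxcol (repr a) v.
Proof. exact: lextU. Qed.

Lemma fox_chainD c d : fox_chain (c + d) = fox_chain c + fox_chain d.
Proof. exact: lextD. Qed.
Lemma fox_chainN c : fox_chain (- c) = - fox_chain c.
Proof. exact: lextN. Qed.

Lemma chain_ofD a b : chain_of (a + b) = chain_of a + chain_of b.
Proof.
rewrite /chain_of.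
have -> : usubmx (a + b) = usubmx a + usubmx b by apply/matrixP => i j; rewrite !mxE.
have -> : dsubmx (a + b) = dsubmx a + dsubmx b by apply/matrixP => i j; rewrite !mxE.
rewrite (elt_chainD (pres_gen rels false)).
rewrite (elt_chainD (pres_gen rels true)).
exact: addrACA.
Qed.

Lemma chain_ofN a : chain_of (- a) = - chain_of a.
Proof.
rewrite /chain_of.
have -> : usubmx (- a) = - usubmx a by apply/matrixP => i j; rewrite !mxE.
have -> : dsubmx (- a) = - dsubmx a by apply/matrixP => i j; rewrite !mxE.
by rewrite (elt_chainN (pres_gen rels false)) (elt_chainN (pres_gen rels true)) opprD.
Qed.

Lemma foxcol_gen i v : exists q,
  foxcol (repr (pres_gen rels i)) v = foxcol [:: (i, false)] v + fox_d2 *m q.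
Proof. by apply: foxcol_pres_eq; apply: pres_eq_repr. Qed.

Lemma fox_chain_of a : exists q, fox_chain (chain_of a) = a + fox_d2 *m q.
Proof.
have [q1 e1] := foxcol_gen false (usubmx a).
have [q2 e2] := foxcol_gen true (dsubmx a).
exists (q1 + q2).
transitivity (foxcol [:: (false, false)] (usubmx a) + fox_d2 *m q1
  + (foxcol [:: (true, false)] (dsubmx a) + fox_d2 *m q2)).
  by rewrite -e1 -e2 /chain_of fox_chainD; congr (_ + _); exact: fox_chainU.
rewrite mulmxDr addrACA; congr (_ + _).
rewrite /foxcol add_col_mx /= !mulmx0 !addr0 adj2_0 !mul0mx adj2_scalar !mul1mx.
by rewrite addr0 add0r vsubmxK.
Qed.

End FoxHomology.


Section Homologous.
Variables (r : word bool * word bool) (R : comNzRingType).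
Local Notation rels := [:: r].
Local Notation G := (pres_group rels).
Variable rho : G -> 'M[R]_2.
Hypothesis rhoP : is_SL2_rep (G := G) rho.
Local Notation g := (gval rho).
Local Notation ech := (@elt_chain r R).

(** The Fox map and [chain_of] are inverse to each other up to boundaries, which
identifies H_1 of the bar complex with that of the presentation complex. *)
Definition homologous (c d : chain R G 1) := boundary1 rho (c - d).

Lemma homologous_refl c : homologous c c.
Proof. by rewrite /homologous subrr; apply: boundary_0. Qed.
Lemma homologous_sym c d : homologous c d -> homologous d c.
Proof. by move=> h; rewrite /homologous -opprB; apply: boundaryN. Qed.
Lemma homologous_trans d c e : homologous c d -> homologous d e -> homologous c e.
Proof.
move=> h1 h2; have := boundaryD h1 h2; rewrite /homologous.
have -> // : c - d + (d - e) = c - e; exact: subrKA.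
Qed.
Lemma homologousD c d c' d' : homologous c d -> homologous c' d' ->
  homologous (c + c') (d + d').
Proof.
move=> h1 h2; have := boundaryD h1 h2; rewrite /homologous.
have e (V : zmodType) (a b a' b' : V) : a - b + (a' - b') = a + a' - (b + b').
  by rewrite opprD addrACA.
by rewrite e.
Qed.
Lemma homologousN c d : homologous c d -> homologous (- c) (- d).
Proof.
move=> h; have := boundaryN h; rewrite /homologous.
have e (V : zmodType) (a b : V) : - (a - b) = - a - - b by rewrite opprD.
by rewrite e.
Qed.
Lemma homologous0 c : homologous c 0 <-> boundary1 rho c.
Proof. by rewrite /homologous subr0. Qed.

Lemma homologous_mul a b v :
  homologous (ech (a * b)%g v) (ech a v + ech b (rho a^-1%g *m v)).
Proof. exact: boundary_mul. Qed.

Lemma homologous_one v : homologous (ech 1%g v) 0.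
Proof.
have r1 : rho 1^-1%g = 1%:M by rewrite invg1; case: rhoP.
have := homologous_mul 1 1 v; rewrite mulg1 r1 mul1mx.
move=> /boundaryN; rewrite homologous0.
have e (V : zmodType) (a : V) : - (a - (a + a)) = a by rewrite opprD opprK addKr.
by rewrite e.
Qed.

Lemma homologous_inv a v :
  homologous (ech a^-1%g v) (- ech a (rho a *m v)).
Proof.
have := homologous_mul a a^-1 (rho a *m v).
rewrite mulgV => /homologous_sym h.
have {h} := homologous_trans h (homologous_one _).
move=> /homologous0; rewrite mulmxA.
have -> : rho a^-1%g *m rho a = 1%:M.
  by case: (rhoP) => _ <- <-; rewrite mulVg.
have e (V : zmodType) (b c : V) : b + c = c - - b by rewrite opprK addrC.
rewrite mul1mx => h; exact: (@eq_ind _ _ (boundary1 rho) h _ (e _ _ _)).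
Qed.

Lemma chain_of_letter l v :
  homologous (ech (word_elt rels [:: l]) v) (chain_of r (foxcol rho [:: l] v)).
Proof.
case: l => i b.
have -> : chain_of r (foxcol rho [:: (i, b)] v) =
    ech (pres_gen rels i) (adj2 (if b then - lmat g (i, b) else 1%:M) *m v).
  rewrite /chain_of /foxcol col_mxKu col_mxKd /= !mulmx0 !addr0.
  have e j : ech j 0 = 0 by apply: monalgU0.
  by case: i => /=; rewrite adj2_0 mul0mx e ?add0r ?addr0.
case: b; last by rewrite adj2_scalar mul1mx; apply: homologous_refl.
rewrite /lmat /= adj2N adj2K mulNmx elt_chainN.
have -> : word_elt rels [:: (i, true)] = (pres_gen rels i)^-1%g.
  symmetry; apply: mulg1_eq.
  rewrite [LHS]pres_mulE; apply/word_eltP.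
  exact: (@PresFree _ rels (i, false)).
exact: homologous_inv.
Qed.

(** A bar symbol splits, up to boundaries, along the letters of a word; this is
the Fox derivative. *)
Lemma chain_of_word w v :
  homologous (ech (word_elt rels w) v) (chain_of r (foxcol rho w v)).
Proof.
elim: w v => [|l w IH] v.
  have -> : foxcol rho [::] v = 0.
    by rewrite /foxcol /= adj2_0 !mul0mx col_mx0.
  have -> : chain_of r (0 : 'cV[R]_(2 + 2)) = 0.
    by rewrite -[X in chain_of _ X](subrr 0) chain_ofD chain_ofN subrr.
  exact: homologous_one.
have -> : word_elt rels (l :: w) = (word_elt rels [:: l] * word_elt rels w)%g.
  exact/esym/pres_mulE.
apply: homologous_trans (homologous_mul _ _ _) _.
rewrite -[l :: w]/([:: l] ++ w) foxcol_cat chain_ofD.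
apply: homologousD; first exact: chain_of_letter.
rewrite (rep_inv rhoP) (rep_word rhoP); exact: IH.
Qed.

Lemma sum_elt_chain (c : chain R G 1) (P : chain R G 1 -> Prop) :
  P 0 -> (forall c d, P c -> P d -> P (c + d)) -> (forall a v, P (ech a v)) -> P c.
Proof.
move=> P0 PD PU; rewrite (monalgE c).
apply: (big_ind P) => // t _.
have -> : t = [tuple tnth t ord0] by apply: eq_from_tnth => i; rewrite [i]ord1.
exact: PU.
Qed.

Lemma chain_of_fox_chain c : homologous c (chain_of r (fox_chain rho c)).
Proof.
elim/sum_elt_chain: c => [|c d hc hd|a v].
- have -> : fox_chain rho 0 = 0.
    by rewrite -[X in fox_chain _ X](subrr 0) fox_chainD fox_chainN subrr.
  have -> : chain_of r (0 : 'cV[R]_(2 + 2)) = 0.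
    by rewrite -[X in chain_of _ X](subrr 0) chain_ofD chain_ofN subrr.
  exact: homologous_refl.
- rewrite fox_chainD chain_ofD; exact: homologousD.
- rewrite fox_chainU -{1}[a]word_elt_repr; exact: chain_of_word.
Qed.

Lemma foxcol_mul (a b : G) v : exists q, foxcol rho (repr ((a * b)%g : G)) v =
  foxcol rho (repr a) v + foxcol rho (repr b) (rho a^-1%g *m v) + fox_d2 rho *m q.
Proof.
have e : pres_eq rels (repr ((a * b)%g : G)) (repr a ++ repr b) by exact: pres_eq_repr.
have [q ->] := foxcol_pres_eq rhoP e v; exists q; congr (_ + _).
by rewrite foxcol_cat (rep_inv rhoP) -{4}[a]word_elt_repr (rep_word rhoP).
Qed.

Lemma fox_d2E q : fox_d2 rho *m q = foxcol rho r.1 q - foxcol rho r.2 q.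
Proof.
have e (A B : 'M[R]_2) : adj2 (A - B) *m q = adj2 A *m q - adj2 B *m q.
  by rewrite adj2D adj2N mulmxBl.
by rewrite /fox_d2 mul_col_mx /foxcol opp_col_mx add_col_mx !e.
Qed.

Lemma fox_chain_boundary c :
  boundary1 rho c <-> exists q, fox_chain rho c = fox_d2 rho *m q.
Proof.
split=> [[b ->]|[q eq]].
  pose P (b : chain R G 2) := exists q, fox_chain rho (bar_d rho b) = fox_d2 rho *m q.
  have PU a h v : P << v *g [tuple a; h] >>.
    rewrite /P bar_d1U; have [q e] := foxcol_mul a h v; exists (- q).
    rewrite !fox_chainD fox_chainN.
    have eU k w : fox_chain rho << w *g [tuple k] >> = foxcol rho (repr k) w.
      exact: fox_chainU.
    transitivity (foxcol rho (repr h) (rho a^-1%g *m v)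
        - foxcol rho (repr ((a * h)%g : G)) v + foxcol rho (repr a) v).
      by congr (_ - _ + _); exact: eU.
    have z (V : zmodType) (x y d : V) : y - (x + y + d) + x = - d.
      by rewrite [x + y]addrC -[y + x + d]addrA opprD addNKr opprD addrAC addNr add0r.
    by rewrite e z mulmxN.
  suff: P b by [].
  rewrite (monalgE b); apply: (big_ind P) => [|c1 c2 [q1 e1] [q2 e2]|t _].
  - exists 0; rewrite mulmx0 -[X in bar_d _ X](subrr 0) bar_dD bar_dN subrr.
    by rewrite -[X in fox_chain _ X](subrr 0) fox_chainD fox_chainN subrr.
  - exists (q1 + q2); transitivity (fox_chain rho (bar_d rho c1) + fox_chain rho (bar_d rho c2)).
      by rewrite bar_dD; exact: fox_chainD.
    exact: etrans (congr2 +%R e1 e2) (esym (mulmxDr _ _ _)).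
  have -> : t = [tuple tnth t ord0; tnth t (lift ord0 ord0)].
    apply: eq_from_tnth => i; case: (unliftP ord0 i) => [j|] -> //.
    by rewrite [j]ord1.
  exact: PU.
apply/homologous0; apply: homologous_trans (chain_of_fox_chain c) _.
rewrite eq fox_d2E chain_ofD chain_ofN.
have h w := homologous_sym (chain_of_word w q).
apply: homologous_trans (homologousD (h _) (homologousN (h _))) _.
have -> : word_elt rels r.1 = word_elt rels r.2.
  apply/word_eltP/PresRel; exact: mem_head.
rewrite subrr; exact: homologous_refl.
Qed.

Lemma bar_d0_fox_chain c :
  bar_d rho c = << fox_d1 rho *m fox_chain rho c *g [tuple] >> :> chain R G 0.
Proof.
elim/sum_elt_chain: c => [|c d hc hd|a v].
- have -> : fox_chain rho 0 = 0.
    by rewrite -[X in fox_chain _ X](subrr 0) fox_chainD fox_chainN subrr.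
  rewrite mulmx0 -[X in bar_d _ X](subrr 0) bar_dD bar_dN subrr.
  by symmetry; apply: monalgU0.
- rewrite bar_dD hc hd -monalgUD -mulmxDr.
  by congr (<< _ *m _ *g _ >>); symmetry; exact: fox_chainD.
rewrite fox_chainU (fox_d1_col rhoP) -(rep_word rhoP) word_elt_repr -(rep_inv rhoP).
exact: bar_d0U.
Qed.

Lemma fox_chain_cycle c : @Defs.cycle R G rho 1 c <-> fox_d1 rho *m fox_chain rho c = 0.
Proof.
rewrite /Defs.cycle bar_d0_fox_chain; split=> [/eqP|->]; last exact: monalgU0.
by rewrite monalgU_eq0 => /eqP.
Qed.

Lemma fox_chainZ a c : fox_chain rho (a *: c) = a *: fox_chain rho c.
Proof.
rewrite /fox_chain (@lextEw _ _ _ _ (a *: c) (monalg.msupp c)); last first.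
  apply/fsubsetP => t; rewrite -!monalg.mcoeff_neq0 chain_scaleE.
  by apply: contraNneq => ->; rewrite scaler0.
rewrite /lext scaler_sumr; apply: eq_bigr => t _.
rewrite chain_scaleE; exact: foxcolZ.
Qed.

End Homologous.

(** * The order of a module with a square presentation *)

Section SquarePresentation.
Variables (R : comNzRingType) (M : lmodType R) (Z B : M -> Prop).
Variables (k : nat) (A : 'M[R]_k) (phi : M -> 'cV[R]_k) (b : 'I_k -> M).
Hypotheses (Z0 : Z 0) (ZD : forall x y, Z x -> Z y -> Z (x + y))
  (ZZ : forall a x, Z x -> Z (a *: x)).
Hypotheses (phiD : forall x y, phi (x + y) = phi x + phi y)
  (phiZ : forall a x, phi (a *: x) = a *: phi x).
Hypothesis (ZB : forall z, Z z -> (B z <-> exists q, phi z = A *m q)).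
Hypotheses (Zb : forall i, Z (b i))
  (phib : forall i, exists q, phi (b i) = delta_mx i 0 + A *m q).

Let phi0 : phi 0 = 0.
Proof. by rewrite -(scale0r 0) phiZ scale0r. Qed.

Let phiB x y : phi (x - y) = phi x - phi y.
Proof. by rewrite phiD -scaleN1r phiZ scaleN1r. Qed.

Let ZB' x y : Z x -> Z y -> Z (x - y).
Proof. by move=> Zx Zy; apply: ZD => //; rewrite -scaleN1r; apply: ZZ. Qed.

Let col_of p (e : 'I_p -> M) : 'M[R]_(k, p) := \matrix_(i, j) phi (e j) i 0.

Let phi_sum p (e : 'I_p -> M) (c : 'I_p -> R) :
  phi (\sum_i c i *: e i) = col_of e *m \col_i c i.
Proof.
have -> : phi (\sum_i c i *: e i) = \sum_i c i *: phi (e i).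
  rewrite (big_morph phi phiD phi0); apply: eq_bigr => i _; exact: phiZ.
apply/matrixP => i j; rewrite summxE mxE; apply: eq_bigr => l _.
by rewrite !mxE [j]ord1 mulrC.
Qed.

Let Z_sum p (e : 'I_p -> M) (c : 'I_p -> R) : (forall i, Z (e i)) ->
  Z (\sum_i c i *: e i).
Proof. by move=> Ze; apply: (big_ind Z) => // i _; apply/ZZ/Ze. Qed.

Let col_of_b : exists Q, col_of b = 1%:M + A *m Q.
Proof.
have [q qP] := choice phib.
exists (\matrix_(i, j) q j i 0); apply/matrixP => i j.
rewrite !mxE qP !mxE; congr (_ + _); first by rewrite andbT.
by apply: eq_bigr => l _; rewrite !mxE.
Qed.

Let generates_b : generates Z B b.
Proof.
split=> // z Zz; exists (fun i => phi z i 0).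
apply/ZB; first exact/ZB'/Z_sum.
have [Q QE] := col_of_b; exists (- (Q *m phi z)).
rewrite phiB phi_sum QE.
have -> : \col_i phi z i 0 = phi z by apply/matrixP => i j; rewrite !mxE [j]ord1.
by rewrite mulmxDl mul1mx opprD addNKr mulmxN mulmxA.
Qed.

Let relationE p (e : 'I_p -> M) (c : 'rV[R]_p) : (forall i, Z (e i)) ->
  relation B e c <-> exists q, col_of e *m c^T = A *m q.
Proof.
move=> Ze; rewrite /relation ZB; last exact: Z_sum.
rewrite phi_sum; suff -> : \col_i c 0 i = c^T by [].
by apply/matrixP => i j; rewrite !mxE [j]ord1.
Qed.

(** Independence of the Fitting ideal from the generators. Let the columns of E
be the coordinates of e. Then D^T and the coefficients G of the b's in the e's
fit in a block matrix of relations between e and b together, of determinant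
det D up to sign, and every such relation is a combination of the columns of
the square block matrix with blocks 1, 0, - E, A, of determinant det A. *)
Let det_relations p (e : 'I_p -> M) (D : 'M[R]_p) : generates Z B e ->
  (forall i, relation B e (row i D)) -> dvdr (\det A) (\det D).
Proof.
move=> [Ze gen] relD.
have [Q QE] : exists Q, col_of e *m D^T = A *m Q.
  have /choice[q qP] i := (relationE _ Ze).1 (relD i).
  exists (\matrix_(i, j) q j i 0); apply/matrixP => i j.
  have := congr1 (fun X : 'cV_k => X i 0) (qP j); rewrite !mxE => qE.
  rewrite (_ : \sum_l A i l * _ = \sum_l A i l * q j l 0).
    by rewrite -qE; apply: eq_bigr => l _; rewrite !mxE.
  by apply: eq_bigr => l _; rewrite !mxE.
have [G [Q' GE]] : exists G Q', col_of e *m G = 1%:M + A *m Q'.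
  have /choice[c cP] i := gen _ (Zb i).
  have [Qb QbE] := col_of_b.
  have cP' i : exists q, phi (b i) = col_of e *m (\col_l c i l) + A *m q.
    have /ZB[|q] := cP i; first exact/ZB'/Z_sum.
    by rewrite phiB phi_sum => /eqP; rewrite subr_eq addrC => /eqP; exists q.
  have /choice[q qP] := cP'.
  pose G := \matrix_(l, i) c i l; pose Mq := \matrix_(l, i) q i l 0.
  exists G, (Qb - Mq); rewrite mulmxBr addrA -QbE.
  suff -> : col_of b = col_of e *m G + A *m Mq by rewrite addrK.
  apply/matrixP => i j; rewrite mxE qP !mxE.
  by congr (_ + _); apply: eq_bigr => l _; rewrite !mxE.
have := det_ublock D^T G (- 1%:M).
have -> : block_mx D^T G 0 (- 1%:M) =
    block_mx 1%:M 0 (- col_of e) A *m block_mx D^T G Q Q'.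
  rewrite mulmx_block !mul1mx !mul0mx !addr0 !mulNmx QE addNr GE.
  by rewrite opprD subrK.
rewrite det_mulmx det_lblock det1 mul1r det_tr => e1.
exists ((-1) ^+ k * \det (block_mx D^T G Q Q')).
have -> : \det D = (-1) ^+ k * (\det D * \det (- 1%:M : 'M[R]_k)).
  rewrite -scaleN1r detZ det1 mulr1 mulrCA -expr2 -exprM muln2 -signr_odd.
  by rewrite odd_double mulr1.
by rewrite -e1; rewrite mulrA [_ * \det A]mulrC mulrAC; ring.
Qed.

Lemma order_of_square_presentation : is_order Z B (\det A).
Proof.
split.
- by exists k, b.
- move=> a [p [e [gen [q [c [D [rel ->]]]]]]].
  have /choice[d dP] j : dvdr (\det A) (\det (D j)).
    by apply: (@det_relations _ e) => // i; apply: rel.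
  exists (\sum_j c j * d j); rewrite mulr_suml; apply: eq_bigr => j _.
  by rewrite dP mulrA.
- move=> a; apply; exists k, b; split=> //.
  exists 1, (fun=> 1), (fun=> A^T); split; last by rewrite big_ord1 mul1r det_tr.
  move=> _ i; apply/relationE => //; have [Q ->] := col_of_b.
  exists (delta_mx i 0 + Q *m (A *m delta_mx i 0)).
  by rewrite tr_row trmxK colE mulmxDr mulmxDl mul1mx -!mulmxA.
Qed.

End SquarePresentation.

(** * The L-function is twice the torsion polynomial *)

(** Gaussian elimination writes A as an invertible matrix times the first two
rows of an invertible one; the other rows of the latter complete A. *)
Lemma complete_rows (F : fieldType) (A : 'M[F]_(2, 2 + 2)) : row_free A ->
  exists e : 'M[F]_(2, 2 + 2), col_mx A e \in unitmx.
Proof.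
move=> fA; exists (dsubmx (row_ebase A)).
have -> : col_mx A (dsubmx (row_ebase A)) =
    block_mx (col_ebase A) 0 0 1%:M *m row_ebase A.
  rewrite -[X in _ *m X]vsubmxK mul_block_col !mul0mx addr0 add0r mul1mx.
  congr col_mx; rewrite -[LHS](mulmx_ebase A) (eqP fA) pid_mx_row.
  by rewrite -[X in _ *m X]vsubmxK -mulmxA mul_row_col mul1mx mul0mx addr0.
rewrite unitmx_mul row_ebase_unit andbT unitmxE det_ublock det1 mulr1 -unitmxE.
exact: col_ebase_unit.
Qed.

Section LocalPresentation.
Variables (R : comUnitRingType) (F : fieldType) (res : {rmorphism R -> F}).
Hypothesis resP : local_residue res.

Lemma complete_rows_local (A : 'M[R]_(2, 2 + 2)) : row_free (map_mx res A) ->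
  exists e : 'M[R]_(2, 2 + 2), col_mx A e \in unitmx.
Proof.
case: resP => surj units /complete_rows[ebar ue].
have [lift liftP] := choice surj.
exists (map_mx lift ebar); rewrite unitmxE units -det_map_mx map_col_mx.
have -> : map_mx res (map_mx lift ebar) = ebar.
  by apply/matrixP => i j; rewrite !mxE liftP.
by rewrite -unitfE -unitmxE.
Qed.

Variables (n : int) (rho : whitehead_group n -> 'M[R]_2).
Hypothesis rhoP : is_SL2_rep rho.
Let r := ((false, false) :: whitehead_omega n, rcons (whitehead_omega n) (false, false)).
Let g : bool -> 'M[R]_2 := @gval r R rho.
Local Notation m := (g false).
Local Notation u := (g true).
Local Notation v := (comm_trace (\tr m) (\tr u) (\tr (m *m u))).
Hypothesis v2 : res v != 2.
Hypothesis f0 : fval m u (chebv (n - 1) v) (chebv (n - 2) v) = 0.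
Hypothesis x2 : GRing.lreg (2 - \tr m).

Let d1 := @fox_d1 r R rho.
Let d2 := @fox_d2 r R rho.
Let dg i : \det (g i) = 1. Proof. exact: det_gval. Qed.

(** A row vector killed by the differential is fixed by m and mu, hence killed by
m mu - mu m, whose determinant 2 - v does not vanish in the residue field. *)
Lemma row_free_fox_d1 : row_free (map_mx res d1).
Proof.
rewrite -kermx_eq0; apply/rowV0P => w /sub_kermxP.
rewrite /d1 /fox_d1 map_row_mx mul_mx_row -[0]row_mx0 => /eq_row_mx[].
have fixw i : w *m map_mx res (adj2 (g i) - 1%:M) = 0 -> w *m map_mx res (g i) = w.
  rewrite map_mxB map_scalar_mx rmorph1 mulmxBr mulmx1 => /eqP; rewrite subr_eq0 => /eqP e.
  by rewrite -{1}e -mulmxA -map_mxM adj2_mulmx dg map_scalar_mx rmorph1 mulmx1.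
move=> /fixw wm /fixw wu; apply/eqP; apply/negPn/negP => w0.
have : w *m (map_mx res (m *m u - u *m m)) = 0.
  by rewrite map_mxB !map_mxM mulmxBr !mulmxA wm wu wm subrr.
move=> ww; have /det0P : exists2 w : 'rV_2, w != 0 & w *m map_mx res (m *m u - u *m m) = 0.
  by exists w.
rewrite det_map_mx det_commutator // rmorphB rmorph_nat subr_eq0 eq_sym.
by rewrite (negbTE v2).
Qed.

Lemma fox_d1d2 (q : 'cV[R]_2) : d1 *m (d2 *m q) = 0.
Proof.
rewrite /d1 /d2 fox_d2E mulmxBr !(fox_d1_col rhoP).
by rewrite (weval_rel rhoP) subrr.
Qed.

(** Complete d1 by rows e to an invertible matrix U. Then e identifies the
kernel of d1 with R^2 and H_1 with the cokernel of e d2. Multiplying U by the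
matrix whose columns are the first two basis vectors and d2 gives
det U det D2 = det D1 det (e d2), where D1 and D2 are the blocks of d1 and d2
that belong to m and mu. *)
Lemma L_function_tau : exists T w,
  [/\ is_L_function rho T, w \is a GRing.unit &
      T = w * (2 * evalZ (poly_tau n) (\tr m) (\tr u) (\tr (m *m u)))].
Proof.
have [e ue] := complete_rows_local row_free_fox_d1.
pose U := col_mx d1 e.
have Uinj (a b : 'cV[R]_(2 + 2)) : U *m a = U *m b -> a = b.
  by move=> /(congr1 (mulmx (invmx U))); rewrite !mulKmx.
exists (\det (e *m d2)), (\det U); split.
- pose phi (c : chain R (whitehead_group n) 1) := e *m @fox_chain r R rho c.
  pose lft i := invmx U *m col_mx 0 (delta_mx i 0 : 'cV[R]_2).
  apply: (@order_of_square_presentation _ _ _ _ _ _ phi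
    (fun i => @chain_of r R (lft i))).
  + by apply/(fox_chain_cycle rhoP); rewrite -(scale0r 0) fox_chainZ scale0r mulmx0.
  + move=> c d /(fox_chain_cycle rhoP) hc /(fox_chain_cycle rhoP) hd.
    by apply/(fox_chain_cycle rhoP); rewrite fox_chainD mulmxDr hc hd addr0.
  + move=> a c /(fox_chain_cycle rhoP) hc; apply/(fox_chain_cycle rhoP).
    by rewrite fox_chainZ -scalemxAr hc scaler0.
  + by move=> c d; rewrite /phi fox_chainD mulmxDr.
  + by move=> a c; rewrite /phi fox_chainZ -scalemxAr.
  + move=> z /(fox_chain_cycle rhoP) hz.
    apply: (iff_trans (fox_chain_boundary rhoP z)); split=> -[q qE]; exists q.
      by rewrite /phi qE mulmxA.
    apply: Uinj; rewrite /U [LHS]mul_col_mx [RHS]mul_col_mx; congr col_mx.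
      by transitivity (0 : 'cV[R]_2); [exact: hz|symmetry; exact: fox_d1d2].
    by move: qE; rewrite -mulmxA.
  + move=> i; apply/(fox_chain_cycle rhoP).
    have [q ->] := fox_chain_of rhoP (lft i); rewrite mulmxDr.
    transitivity (d1 *m lft i + d1 *m (d2 *m q)) => //; rewrite fox_d1d2 addr0.
    have : U *m lft i = col_mx 0 (delta_mx i 0) by rewrite mulKVmx.
    by rewrite mul_col_mx => /eq_col_mx[].
  + move=> i; have [q qE] := fox_chain_of rhoP (lft i); exists q.
    rewrite /phi qE mulmxDr; congr (_ + _); last exact: mulmxA.
    have : U *m lft i = col_mx 0 (delta_mx i 0) by rewrite mulKVmx.
    by rewrite mul_col_mx => /eq_col_mx[].
- by rewrite -unitmxE.
apply: x2.
have areg : GRing.lreg (v - 2).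
  apply: mulrI; case: resP => _ ->.
  by rewrite rmorphB rmorph_nat subr_eq0.
have D2 : \det (dsubmx d2) =
    2 * (2 - \tr m) * evalZ (poly_tau n) (\tr m) (\tr u) (\tr (m *m u)).
  by rewrite /d2 /fox_d2 col_mxKd det_adj2; apply: det_fox_relation.
have D1 : \det (lsubmx d1) = 2 - \tr m.
  rewrite /d1 /fox_d1 row_mxKl -(det_sub1 dg) -[in RHS]det_adj2.
  by rewrite adj2D adj2N adj2_scalar.
have block : U *m block_mx 1%:M (usubmx d2) 0 (dsubmx d2) =
    block_mx (lsubmx d1) 0 (lsubmx e) (e *m d2).
  rewrite block_mxEh vsubmxK mul_mx_row mul_col_mx [U *m d2]mul_col_mx.
  have d12 : d1 *m d2 = 0.
    apply/matrixP => i j; have /matrixP/(_ i 0) := fox_d1d2 (delta_mx j 0).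
    by rewrite mulmxA -colE !mxE => ->.
  rewrite d12 block_mxEh; congr (row_mx (col_mx _ _) _).
  - by rewrite -[d1 in LHS]hsubmxK mul_row_col mulmx1 mulmx0 addr0.
  - by rewrite -[e in LHS]hsubmxK mul_row_col mulmx1 mulmx0 addr0.
have := congr1 determinant block.
rewrite det_mulmx det_ublock det_lblock det1 mul1r D1 D2 => <-.
ring.
Qed.

End LocalPresentation.

(** * Power series in two variables *)

Section FpsCoef.
Variable R : comNzRingType.
Implicit Types f h : fps R.

Lemma fps_coefCM a f i : fps_coef (fpsC a * f) i = a * fps_coef f i.
Proof.
rewrite /= big_ord_recl /= subn0 mulr1n big1 ?addr0 // => j _.
by rewrite mulr0n mul0r.
Qed.

Lemma fps_coefXM f i : fps_coef (fpsX R * f) i = if i is k.+1 then fps_coef f k else 0.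
Proof.
case: i => [|i]; first by rewrite /= big_ord1 /= mul0r.
rewrite /= !big_ord_recl /= mul0r add0r mul1r /bump /= add1n subSS subn0.
by rewrite big1 ?addr0 // => j _; rewrite mul0r.
Qed.

Lemma fps_divX f : fps_coef f 0 = 0 -> exists h, f = fpsX R * h.
Proof.
move=> f0; exists (Fps (fun i => fps_coef f i.+1)); apply: fpsP => -[|i].
  by rewrite fps_coefXM.
by rewrite fps_coefXM.
Qed.

Lemma lreg_fpsC (a : R) : GRing.lreg a -> GRing.lreg (fpsC a).
Proof.
move=> ra f h /(congr1 (@fps_coef R)) e; apply: fpsP => i.
by apply: ra; rewrite -!fps_coefCM e.
Qed.

Lemma fps_coef2_cube (c : fps R) (a : 'I_3 -> fps R) : (forall j, fps_coef (a j) 0 = 0) ->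
  fps_coef (c * \prod_j a j) 2 = 0.
Proof.
move=> a0; have /choice[h hP] j := fps_divX (a0 j).
rewrite (eq_bigr _ (fun j _ => hP j)) big_split prodr_const card_ord mulrCA.
move: (c * _) => d.
have -> : fpsX R ^+ 3 * d = fpsX R * (fpsX R * (fpsX R * d)) by ring.
by rewrite !fps_coefXM.
Qed.

Lemma fps_coef2_square (c f : fps R) : fps_coef f 0 = 0 ->
  fps_coef (c * f ^+ 2) 2 = fps_coef c 0 * fps_coef f 1 ^+ 2.
Proof.
move=> /fps_divX[h ->].
have -> : c * (fpsX R * h) ^+ 2 = fpsX R * (fpsX R * (c * h ^+ 2)) by ring.
rewrite !fps_coefXM -[fps_coef h 0]/(fps_const h) -[LHS]/(fps_const _).
by rewrite rmorphM rmorphXn.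
Qed.

End FpsCoef.

(** Needed to cancel 2 - x, which may fail to be a unit; it is c - X with
c = 2 - A. *)
Lemma lreg_fps_linear (O : idomainType) (c : O) : GRing.lreg (fpsC c - fpsX O).
Proof.
move=> f h /eqP; rewrite -subr_eq0 -mulrBr => /eqP e.
apply/eqP; rewrite -subr_eq0; move: (f - h) e => {f h} f e; apply/eqP.
have coef i : c * fps_coef f i - fps_coef (fpsX O * f) i = 0.
  by have := congr1 (fun k => fps_coef k i) e; rewrite mulrBl -fps_coefCM.
have e0 : c * fps_coef f 0 = 0 by have := coef 0; rewrite fps_coefXM subr0.
have eS i : c * fps_coef f i.+1 = fps_coef f i.
  by have := coef i.+1; rewrite fps_coefXM => /eqP; rewrite subr_eq0 => /eqP.
apply: fpsP => i /=.
have [c0|c0] := eqVneq c 0; first by rewrite -eS c0 mul0r.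
elim: i => [|i IH]; first by move/eqP: e0; rewrite mulf_eq0 (negbTE c0) => /eqP.
by move/eqP: (eS i); rewrite IH mulf_eq0 (negbTE c0) => /eqP.
Qed.

Section FpsMap.
Variables (R S : comNzRingType) (phi : {rmorphism R -> S}).
Fact fps_map_nmod : nmod_morphism (fps_map phi).
Proof.
split; first by apply: fpsP => i; rewrite /= rmorph0.
by move=> f h; apply: fpsP => i; rewrite /= rmorphD.
Qed.
Fact fps_map_monoid : monoid_morphism (fps_map phi).
Proof.
split; first by apply: fpsP => i; rewrite /= rmorphMn rmorph1.
move=> f h; apply: fpsP => i; rewrite /= rmorph_sum; apply: eq_bigr => j _.
by rewrite rmorphM.
Qed.
HB.instance Definition _ := GRing.isNmodMorphism.Build (fps R) (fps S) (fps_map phi) fps_map_nmod.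
HB.instance Definition _ := GRing.isMonoidMorphism.Build (fps R) (fps S) (fps_map phi) fps_map_monoid.
End FpsMap.

Section TwoVariables.
Variable K : comNzRingType.
Local Notation IK := (ideal2 (fps2X K) (fps2Y K)).
Implicit Types f h : fps2 K.

Lemma in_ideal2 f : fps2_const K f = 0 -> IK f.
Proof.
move=> f0; have [h hE] : exists h : fps K, fps_coef f 0 = fpsX K * h by apply: fps_divX.
pose f1 : fps2 K := Fps (fun i => fps_coef f i.+1).
exists (fpsC h), f1.
have -> : fpsC h * fps2X K + f1 * fps2Y K = fpsC (fpsX K * h) + fpsX (fps K) * f1.
  by rewrite [f1 * _]mulrC rmorphM [fpsC (fpsX K) * _]mulrC.
apply: fpsP => i.
transitivity (fps_coef (fpsC (fpsX K * h)) i + fps_coef (fpsX (fps K) * f1) i) => //.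
rewrite fps_coefXM -hE; case: i => [|i].
  by rewrite -[fps_coef (fpsC _) 0]/(fps_coef f 0 *+ 1) mulr1n addr0.
by rewrite -[fps_coef (fpsC _) _]/(fps_coef f 0 *+ 0) mulr0n add0r.
Qed.

Lemma square_in_ideal_exp (c f : fps2 K) : fps2_const K f = 0 -> ideal_exp IK 2 (c * f ^+ 2).
Proof.
move=> f0; exists 1, (fun=> c), (fun _ _ => f); split.
  by move=> _ _; apply: in_ideal2.
by rewrite big_ord1 big_const_ord /= mulr1.
Qed.

(** Restricted to a coordinate axis, the ideal (X, Y) consists of multiples of
the variable, so the cube of the ideal has no quadratic terms there. *)
Lemma cube_coef (j : {rmorphism fps2 K -> fps K}) b :
  (forall f, fps_coef (j f) 0 = fps2_const K f) ->
  ideal_exp IK 3 b -> fps_coef (j b) 2 = 0.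
Proof.
move=> j0 [q [c [a [Ia ->]]]]; rewrite rmorph_sum.
have -> : fps_coef (\sum_i j (c i * \prod_k a i k)) 2
    = \sum_i fps_coef (j (c i * \prod_k a i k)) 2.
  by apply: (big_morph (fun f : fps K => fps_coef f 2)).
apply: big1 => i _; rewrite rmorphM rmorph_prod; apply: fps_coef2_cube => k.
rewrite j0; have [u [w ->]] := Ia i k.
have cX : fps2_const K (fps2X K) = 0 by [].
have cY : fps2_const K (fps2Y K) = 0 by [].
by rewrite rmorphD !rmorphM cX cY !mulr0 addr0.
Qed.

End TwoVariables.

(** The quadratic part of c f^2 is the constant term of c times the square of
the linear part of f, and it can be read off on the two axes. *)
Lemma square_not_in_cube (K : idomainType) (c f : fps2 K) :
  fps2_const K c != 0 -> fps2_const K f = 0 ->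
  ideal_exp (ideal2 (fps2X K) (fps2Y K)) 3 (c * f ^+ 2) ->
  fps_coef (fps_coef f 0) 1 = 0 /\ fps_coef (fps_coef f 1) 0 = 0.
Proof.
move=> c0 f0 cube.
have main (j : {rmorphism fps2 K -> fps K}) :
    (forall h, fps_coef (j h) 0 = fps2_const K h) -> fps_coef (j f) 1 = 0.
  move=> j0; have := cube_coef j0 cube; rewrite rmorphM rmorphXn fps_coef2_square ?j0 //.
  by move/eqP; rewrite mulf_eq0 (negbTE c0) sqrf_eq0 => /eqP.
split; first exact: (main (@fps_const (fps K))).
exact: (main (fps_map (@fps_const K))).
Qed.

(** * Dual numbers and first order jets *)

Record dual (R : Type) := Dual { dual0 : R; dual1 : R }.

Section DualRing.
Variable R : comNzRingType.
Implicit Types a b c : dual R.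

Definition dual_pair a := (dual0 a, dual1 a).
Definition pair_dual (p : R * R) := Dual p.1 p.2.
Lemma dual_pairK : cancel dual_pair pair_dual. Proof. by case. Qed.
HB.instance Definition _ := Choice.copy (dual R) (can_type dual_pairK).

Lemma dualP a b : dual0 a = dual0 b -> dual1 a = dual1 b -> a = b.
Proof. by case: a b => [a0 a1] [b0 b1] /= -> ->. Qed.

Definition dual_zero : dual R := Dual 0 0.
Definition dual_opp a := Dual (- dual0 a) (- dual1 a).
Definition dual_add a b := Dual (dual0 a + dual0 b) (dual1 a + dual1 b).
Fact dual_addA : associative dual_add.
Proof. by move=> a b c; apply: dualP; apply: addrA. Qed.
Fact dual_addC : commutative dual_add.
Proof. by move=> a b; apply: dualP; apply: addrC. Qed.
Fact dual_add0 : left_id dual_zero dual_add.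
Proof. by move=> a; apply: dualP; apply: add0r. Qed.
Fact dual_addN : left_inverse dual_zero dual_opp dual_add.
Proof. by move=> a; apply: dualP; apply: addNr. Qed.
HB.instance Definition _ :=
  GRing.isZmodule.Build (dual R) dual_addA dual_addC dual_add0 dual_addN.

Definition dual_one : dual R := Dual 1 0.
Definition dual_mul a b :=
  Dual (dual0 a * dual0 b) (dual0 a * dual1 b + dual1 a * dual0 b).
Fact dual_mulA : associative dual_mul.
Proof. by move=> a b c; apply: dualP => /=; ring. Qed.
Fact dual_mulC : commutative dual_mul.
Proof. by move=> a b; apply: dualP => /=; ring. Qed.
Fact dual_mul1 : left_id dual_one dual_mul.
Proof. by move=> a; apply: dualP => /=; ring. Qed.
Fact dual_mulD : left_distributive dual_mul dual_add.
Proof. by move=> a b c; apply: dualP => /=; ring. Qed.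
Fact dual_1neq0 : dual_one != 0.
Proof. by apply/eqP => /(congr1 (@dual0 R)) /eqP; rewrite oner_eq0. Qed.
HB.instance Definition _ := GRing.Zmodule_isComNzRing.Build (dual R)
  dual_mulA dual_mulC dual_mul1 dual_mulD dual_1neq0.

Fact dual0_nmod : nmod_morphism (@dual0 R). Proof. by []. Qed.
Fact dual0_monoid : monoid_morphism (@dual0 R). Proof. by []. Qed.
HB.instance Definition _ := GRing.isNmodMorphism.Build (dual R) R (@dual0 R) dual0_nmod.
HB.instance Definition _ := GRing.isMonoidMorphism.Build (dual R) R (@dual0 R) dual0_monoid.

Fact dual1_nmod : nmod_morphism (@dual1 R). Proof. by []. Qed.
HB.instance Definition _ := GRing.isNmodMorphism.Build (dual R) R (@dual1 R) dual1_nmod.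

Lemma dual0M a b : dual0 (a * b) = dual0 a * dual0 b. Proof. by []. Qed.
Lemma dual1M a b : dual1 (a * b) = dual0 a * dual1 b + dual1 a * dual0 b.
Proof. by []. Qed.
Lemma dual1_nat k : dual1 (k%:R : dual R) = 0.
Proof. by rewrite raddfMn /= mul0rn. Qed.
Lemma dual1_int k : dual1 (k%:~R : dual R) = 0.
Proof.
case: k => k; first exact: dual1_nat.
by rewrite NegzE mulrNz raddfN -pmulrn; apply/eqP; rewrite oppr_eq0; apply/eqP/dual1_nat.
Qed.

Definition dualC (a : R) : dual R := Dual a 0.
Fact dualC_nmod : nmod_morphism dualC.
Proof. by split=> // a b; apply: dualP => //=; rewrite addr0. Qed.
Fact dualC_monoid : monoid_morphism dualC.
Proof. by split=> // a b; apply: dualP => //=; rewrite mulr0 mul0r addr0. Qed.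
HB.instance Definition _ := GRing.isNmodMorphism.Build R (dual R) dualC dualC_nmod.
HB.instance Definition _ := GRing.isMonoidMorphism.Build R (dual R) dualC dualC_monoid.

Definition dual_eps : dual R := Dual 0 1.

End DualRing.

Section DualUnit.
Variable R : comUnitRingType.
Definition dual_unit : {pred dual R} := [pred a | dual0 a \is a GRing.unit].
Definition dual_inv (a : dual R) : dual R :=
  if dual0 a \is a GRing.unit
  then Dual (dual0 a)^-1 (- (dual0 a)^-1 * dual1 a * (dual0 a)^-1) else a.
Fact dual_mulV : {in dual_unit, left_inverse 1 dual_inv *%R}.
Proof.
move=> a; rewrite inE /dual_inv => ua; rewrite ua; apply: dualP => /=.
  exact: mulVr.
by rewrite mulrVK // mulNr subrr.
Qed.
Fact dual_unitP (a b : dual R) : b * a = 1 -> dual_unit a.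
Proof.
move=> /(congr1 (@dual0 R)) /= e; apply/unitrP; exists (dual0 b).
by rewrite mulrC; split=> //; rewrite mulrC.
Qed.
Fact dual_inv_out : {in [predC dual_unit], dual_inv =1 id}.
Proof. by move=> a; rewrite !inE /dual_inv => /negbTE ->. Qed.
HB.instance Definition _ := GRing.ComNzRing_hasMulInverse.Build (dual R)
  dual_mulV dual_unitP dual_inv_out.
End DualUnit.

Section Jets.
Variable R : comNzRingType.
Implicit Types f : fps2 R.

(** Restriction to the first order neighbourhood of the origin along one axis.
Being a ring morphism to the dual numbers, it turns partial derivatives into
polynomial identities. *)
Definition jetX f : dual R := Dual (fps_coef (fps_coef f 0) 0) (fps_coef (fps_coef f 0) 1).
Definition jetY f : dual R := Dual (fps_coef (fps_coef f 0) 0) (fps_coef (fps_coef f 1) 0).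

Fact jetX_nmod : nmod_morphism jetX. Proof. by []. Qed.
Fact jetX_monoid : monoid_morphism jetX.
Proof.
split=> // f h; apply: dualP => /=; rewrite big_ord1 /= ?big_ord1 //.
by rewrite !big_ord_recl big_ord0 addr0.
Qed.
HB.instance Definition _ := GRing.isNmodMorphism.Build (fps2 R) (dual R) jetX jetX_nmod.
HB.instance Definition _ := GRing.isMonoidMorphism.Build (fps2 R) (dual R) jetX jetX_monoid.

Fact jetY_nmod : nmod_morphism jetY. Proof. by []. Qed.
Fact jetY_monoid : monoid_morphism jetY.
Proof.
split=> // f h; apply: dualP => /=; rewrite ?big_ord1 //= ?big_ord1 //.
by rewrite !big_ord_recl big_ord0 addr0 /= !big_ord1.
Qed.
HB.instance Definition _ := GRing.isNmodMorphism.Build (fps2 R) (dual R) jetY jetY_nmod.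
HB.instance Definition _ := GRing.isMonoidMorphism.Build (fps2 R) (dual R) jetY jetY_monoid.
End Jets.

(** * The torsion polynomial is a square on the surface *)

Section DoubleZero.
Variables (R : comNzRingType) (x y z s t : R).
Local Notation v := (comm_trace x y z).
Local Notation B := ((2 - x) * (2 - y)).
Hypothesis st : s ^+ 2 - v * s * t + t ^+ 2 = 1.
Hypothesis f0 : s * (x * y - z * v) + t * (2 * z - x * y) = 0.
Local Notation W := ((2 - x - y + z) * s * (v - 2) + B * (s - t - 1)).

(** As polynomials the two sides differ by multiples of f_n and of the relation
between s and t. *)
Lemma tau_square :
  W * (W + 2 * B) = (v - 2) * (s ^+ 2 * (v - 2 + B) ^+ 2).
Proof.
have -> : W * (W + 2 * B) = (v - 2) * (s ^+ 2 * (v - 2 + B) ^+ 2)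
  - s * (v - 2) * B * (s * (x * y - z * v) + t * (2 * z - x * y))
  + B ^+ 2 * (s ^+ 2 - v * s * t + t ^+ 2 - 1) by rewrite /comm_trace; ring.
by rewrite st f0 subrr !mulr0 subr0 addr0.
Qed.

Hypotheses (E0 : v - 2 + B = 0) (W0 : W = 0).
Hypotheses (areg : forall c, (v - 2) * c = 0 -> c = 0)
  (sreg : forall c, s * c = 0 -> c = 0).
Local Notation h := (v * s - 2 * t + 2).

(** On the zero curve of tau_n one has a = - B, whence
(2 - x - y + z) s = s - t - 1; substituting this and f_n = 0 eliminates z. *)
Lemma curve_sum : s ^+ 2 * (v - 2) * (x + y) = h - 4.
Proof.
have T0 : (2 - x - y + z) * s - (s - t - 1) = 0.
  apply: areg.
  transitivity (W - (v - 2 + B) * (s - t - 1)); first by ring.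
  by rewrite W0 E0 mul0r subrr.
transitivity (h - 4 - 2 * (s ^+ 2 - v * s * t + t ^+ 2 - 1)
  + s * (s - t) * (v - 2 + B)
  - (2 * (s - t) + s * (v - 2)) * ((2 - x - y + z) * s - (s - t - 1))
  - s * (s * (x * y - z * v) + t * (2 * z - x * y))).
  by rewrite /comm_trace; ring.
by rewrite st E0 T0 f0 subrr !mulr0 !subr0 addr0.
Qed.

(** The trace T of w^n satisfies T^2 - 4 = (v^2 - 4) s^2, and h = T + 2. *)
Lemma h_quadratic : h * (h - 4) = (v ^+ 2 - 4) * s ^+ 2.
Proof.
transitivity ((v ^+ 2 - 4) * s ^+ 2 + 4 * (s ^+ 2 - v * s * t + t ^+ 2 - 1)).
  by ring.
by rewrite st subrr mulr0 addr0.
Qed.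

Lemma curve_sum_h : (x + y) * h = v + 2.
Proof.
apply/eqP; rewrite -subr_eq0; apply/eqP/sreg/sreg/areg.
transitivity (s ^+ 2 * (v - 2) * (x + y) * h - (v ^+ 2 - 4) * s ^+ 2); first by ring.
by rewrite curve_sum mulrC h_quadratic subrr.
Qed.
End DoubleZero.

Section DualChebyshev.
Variable R : comNzRingType.
Implicit Types a : dual R.

Lemma dual_horner (p : {poly int}) a :
  (map_poly intr p).[a] =
  Dual (map_poly intr p).[dual0 a] ((map_poly intr p)^`().[dual0 a] * dual1 a).
Proof.
apply: dualP => /=.
  by rewrite -horner_map /= -map_poly_comp; congr (_.[_]);
    apply: eq_map_poly => k /=; rewrite rmorph_int.
elim/poly_ind: p => [|p c IH].
  by rewrite !rmorph0 deriv0 !horner0 mul0r.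
rewrite !rmorphD !rmorphM /= !map_polyX !map_polyC /= !hornerE raddfD /=.
rewrite dual1_int addr0 IH derivMXaddC !hornerE.
have -> : dual0 (map_poly intr p).[a] = (map_poly intr p).[dual0 a].
  by rewrite -horner_map /= -map_poly_comp; congr (_.[_]);
    apply: eq_map_poly => k /=; rewrite rmorph_int.
by ring.
Qed.

Lemma dual0_chebv k a : dual0 (chebv k a) = chebv k (dual0 a).
Proof. by rewrite /chebv dual_horner. Qed.

Definition chebv' k (b : R) : R := (map_poly intr (chebS k))^`().[b].

Lemma dual1_chebv k a : dual1 (chebv k a) = chebv' k (dual0 a) * dual1 a.
Proof. by rewrite /chebv dual_horner. Qed.

(** The Chebyshev identity T_n' = n S_(n-1), for the trace T_n(v) of w^n. *)
Lemma dual1_trace_power (n : int) a :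
  dual1 (a * chebv (n - 1) a - 2 * chebv (n - 2) a) =
  n%:~R * chebv (n - 1) (dual0 a) * dual1 a.
Proof.
pose T k := a * chebv (k - 1) a - 2 * chebv (k - 2) a.
pose P k := dual1 (T k) = k%:~R * chebv (k - 1) (dual0 a) * dual1 a.
have TE k : T k = chebv k a - chebv (k - 2) a.
  have := chebv_rec (k - 2) a; rewrite /T.
  have -> : k - 2 + 2 = k by lia.
  have -> : k - 2 + 1 = k - 1 by lia.
  by move=> ->; ring.
have Trec k : T (k + 2) = a * T (k + 1) - T k.
  rewrite !TE.
  have -> : k + 2 - 2 = k by lia.
  have -> : k + 1 - 2 = k - 1 by lia.
  rewrite (chebv_rec k a).
  have := chebv_rec (k - 2) a.
  have -> : k - 2 + 2 = k by lia.
  have -> : k - 2 + 1 = k - 1 by lia.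
  by move=> ->; ring.
have T0E k : dual0 (T (k + 1)) = chebv (k + 1) (dual0 a) - chebv (k - 1) (dual0 a).
  rewrite TE raddfB /= !dual0_chebv; congr (_ - chebv _ _); lia.
have rec0 k : chebv (k + 1) (dual0 a) = dual0 a * chebv k (dual0 a) - chebv (k - 1) (dual0 a).
  have := chebv_rec (k - 1) (dual0 a).
  have -> : k - 1 + 2 = k + 1 by lia.
  by have -> : k - 1 + 1 = k by lia.
have step k : dual1 (T (k + 2)) = dual0 a * dual1 (T (k + 1))
    + dual1 a * dual0 (T (k + 1)) - dual1 (T k).
  by rewrite Trec raddfB.
suff: P n /\ P (n + 1) by case.
have e1 (k : int) : k + 1 + 1 = k + 2 by lia.
have e2 (k : int) : k + 2 - 1 = k + 1 by lia.
have e3 (k : int) : k + 1 - 1 = k by lia.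
elim/int_step_ind: n => [|k [Pk Pk1]|k []].
- split; rewrite /P /T.
    have -> : 0 - 1 = - 1 :> int by [].
    have -> : 0 - 2 = - 2 :> int by [].
    rewrite !chebvN1 !mulr0 mul0r sub0r.
    have := chebv_rec (-2) a; have -> : - 2 + 2 = 0 :> int by [].
    have -> : - 2 + 1 = - 1 :> int by [].
    rewrite chebv0 chebvN1 mulr0 sub0r => e.
    by rewrite -[chebv _ _]opprK -e mulrN mulr1 opprK dual1_nat.
  have -> : 0 + 1 - 1 = 0 :> int by [].
  have -> : 0 + 1 - 2 = - 1 :> int by [].
  rewrite !chebv0 chebvN1 mulr0 subr0 mulr1.
  by rewrite mul1r mul1r.
- split=> //; rewrite /P e1 e2 (step k) Pk Pk1 T0E e3 rec0 !rmorphD /=.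
  by move: (k%:~R) => K; ring.
- rewrite /P e1 e2 (step k) => Pk1 Pk2; split; last exact: Pk1.
  move: Pk2; rewrite Pk1 T0E e3 rec0.
  have e (b c d : R) : b - c = d -> c = b - d by move=> <-; ring.
  move=> /e ->; rewrite !rmorphD /=.
  by move: (k%:~R) => K; ring.
Qed.

End DualChebyshev.

(** * The square root has a simple zero *)

Section OddDenominator.
Variables (O : idomainType) (char0 : forall k : int, k%:~R = 0 :> O -> k = 0).
Implicit Types a b : O.

(** The elements that come from the rational numbers with odd denominator. They
form a subring, which does not contain - 1/4. *)
Definition odd_denom a := exists d e k : int, d = 2 * k + 1 /\ d%:~R * a = e%:~R.

Lemma odd_denom_int (k : int) : odd_denom k%:~R.
Proof. by exists 1, k, 0; rewrite mul1r. Qed.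

Lemma odd_denomD a b : odd_denom a -> odd_denom b -> odd_denom (a + b).
Proof.
move=> [d [e [k [dE ae]]]] [d' [e' [k' [dE' be]]]].
exists (d * d'), (d' * e + d * e'), (2 * k * k' + k + k'); split.
  by rewrite dE dE'; ring.
by rewrite rmorphD !rmorphM /= -ae -be; ring.
Qed.

Lemma odd_denomM a b : odd_denom a -> odd_denom b -> odd_denom (a * b).
Proof.
move=> [d [e [k [dE ae]]]] [d' [e' [k' [dE' be]]]].
exists (d * d'), (e * e'), (2 * k * k' + k + k'); split.
  by rewrite dE dE'; ring.
by rewrite !rmorphM /= -ae -be; ring.
Qed.

Lemma odd_denom_horner (p : {poly int}) a : odd_denom a ->
  odd_denom (map_poly intr p).[a].
Proof.
move=> oa; elim/poly_ind: p => [|p c IH].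
  by rewrite rmorph0 horner0 -[0]/(0%:~R); apply: odd_denom_int.
rewrite rmorphD rmorphM /= map_polyX map_polyC /= !hornerE.
by apply: odd_denomD (odd_denom_int _); apply: odd_denomM.
Qed.

Lemma odd_denom_not_quarter a : odd_denom a -> 4 * a <> -1.
Proof.
move=> [d [e [k [dE ae]]]] a4.
suff /char0 : (4 * e + d)%:~R = 0 :> O by lia.
by rewrite rmorphD rmorphM /= -ae mulrCA (_ : 4%:~R = 4) // a4; ring.
Qed.

(** Here b1 = 2 - x, b2 = 2 - y, S = x + y, and the equations are the two
partial derivatives of [curve_sum], then [curve_sum_h], its derivative along
one axis, and [h_quadratic]. The first two give b1 = b2 = b. If b = 2, then
v = -2 and h = 2, against h (h - 4) = 0. Otherwise 2 h = 2 + b, hence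
4 n s b = -1, and the last equation multiplied by 16 n^2 becomes
(b + 2) (4 n^2 (b - 6) - (b - 2)) = 0. So b has odd denominator, and so has
s = S_(n-1)(2 - b^2), a contradiction. *)
Lemma branch_contradiction (n : int) (b1 b2 s h k : O) :
  let v := 2 - b1 * b2 in let S := 4 - b1 - b2 in
  s = chebv (n - 1) v -> s != 0 -> v != 2 ->
  s ^+ 2 * (v - 2) = (n%:~R * s - k * S) * b1 ->
  s ^+ 2 * (v - 2) = (n%:~R * s - k * S) * b2 ->
  S * h = v + 2 -> S * (n%:~R * s * b2) + h = b2 ->
  h * (h - 4) = (v ^+ 2 - 4) * s ^+ 2 -> False.
Proof.
move=> v S sE s0 v2 e1 e2 e3 e4 e5.
have nz k0 : (k0 : int) != 0 -> k0%:~R != 0 :> O.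
  by move=> k0n; apply/eqP => /char0 /eqP; rewrite (negbTE k0n).
have two : 2 != 0 :> O by exact: (nz 2).
have four : 4 != 0 :> O by exact: (nz 4).
have K0 : s ^+ 2 * (v - 2) != 0 by rewrite mulf_neq0 ?expf_neq0 // subr_eq0.
have b12 : b1 = b2.
  apply/eqP; rewrite -subr_eq0.
  have : (n%:~R * s - k * S) * (b1 - b2) == 0 by rewrite mulrBr -e1 -e2 subrr.
  by rewrite mulf_eq0 => /orP[/eqP c0|//]; move: K0; rewrite e1 c0 mul0r eqxx.
clear e1 e2 K0; subst b2; rename b1 into b.
have cancel2 c d : c != 0 -> c * d = 0 -> d = 0 :> O.
  by move=> c0 /eqP; rewrite mulf_eq0 (negbTE c0) => /eqP.
have [b2|b2] := eqVneq b 2.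
  have S0 : S = 0 by rewrite /S b2; ring.
  have h2 : h = 2 by rewrite -b2 -e4 S0 mul0r add0r.
  move: e5; rewrite h2 /v b2 => e5.
  have : 2 * 2 = 0 :> O.
    transitivity (- (2 * (2 - 4)) : O); first by ring.
    by rewrite e5; ring.
  by move=> /(cancel2 _ _ two) /eqP; rewrite (negbTE two).
have b2' : 2 - b != 0 by rewrite subr_eq0 eq_sym.
have hb : 2 * h = 2 + b.
  apply/eqP; rewrite -subr_eq0; apply/eqP/(cancel2 _ _ b2').
  transitivity (S * h - (v + 2)); last by rewrite e3 subrr.
  by rewrite /S /v; ring.
have q : 4 * (n%:~R * s * b) = -1.
  apply/eqP; rewrite -subr_eq0 opprK; apply/eqP/(cancel2 _ _ b2').
  transitivity (2 * (S * (n%:~R * s * b) + h - b) - (2 * h - (2 + b))).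
    by rewrite /S; ring.
  by rewrite e4 hb !subrr mulr0 subrr.
have quad : (b + 2) * ((4 * n%:~R ^+ 2 - 1) * b - (24 * n%:~R ^+ 2 - 2)) = 0.
  transitivity (n%:~R ^+ 2 * 4 * ((2 * h) * (2 * h - 8)) - (b ^+ 2 - 4)); last first.
    transitivity (n%:~R ^+ 2 * 4 * (4 * (h * (h - 4))) - (b ^+ 2 - 4)); first by ring.
    transitivity ((b ^+ 2 - 4) * ((4 * (n%:~R * s * b)) ^+ 2 - 1)).
      by rewrite e5 /v; ring.
    by rewrite q; ring.
  by rewrite hb; ring.
have ob : odd_denom b.
  move/eqP: quad; rewrite mulf_eq0 => /orP[/eqP b0|/eqP b0].
    have -> : b = (-2)%:~R by rewrite -[b](addrK 2) b0 sub0r rmorphN.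
    exact: odd_denom_int.
  exists (4 * n ^+ 2 - 1), (24 * n ^+ 2 - 2), (2 * n ^+ 2 - 1); split; first by ring.
  move/eqP: b0; rewrite subr_eq0 => /eqP b0.
  have -> : (4 * n ^+ 2 - 1)%:~R = 4 * n%:~R ^+ 2 - 1 :> O.
    by rewrite rmorphB rmorphM rmorphXn.
  by rewrite b0 rmorphB rmorphM rmorphXn.
have := @odd_denom_not_quarter (n%:~R * s * b); apply=> //.
apply: odd_denomM (ob); apply: odd_denomM (odd_denom_int n) _.
rewrite sE; apply: odd_denom_horner.
have -> : v = 2%:~R + (-1)%:~R * (b * b) by rewrite /v rmorphN; ring.
apply: odd_denomD (odd_denom_int _) _.
by apply: odd_denomM (odd_denom_int _) _; apply: odd_denomM.
Qed.

End OddDenominator.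

Lemma dual_regular (O : idomainType) (a c : dual O) :
  dual0 a != 0 -> a * c = 0 -> c = 0.
Proof.
move=> a0 e; have e0 := congr1 (@dual0 O) e; have e1 := congr1 (@dual1 O) e.
have c0 : dual0 c = 0.
  by move/eqP: e0; rewrite dual0M mulf_eq0 (negbTE a0) => /eqP.
apply: dualP => //; move/eqP: e1; rewrite dual1M c0 mulr0 addr0 mulf_eq0.
by rewrite (negbTE a0) => /eqP.
Qed.

Section Jet.
Variables (O : idomainType) (n : int) (x y z : dual O).
Local Notation v := (comm_trace x y z).
Local Notation s := (chebv (n - 1) v).
Local Notation t := (chebv (n - 2) v).
Local Notation B := ((2 - x) * (2 - y)).
Hypothesis f0 : s * (x * y - z * v) + t * (2 * z - x * y) = 0.
Hypotheses (E0 : v - 2 + B = 0)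
  (W0 : (2 - x - y + z) * s * (v - 2) + B * (s - t - 1) = 0).
Local Notation v0 := (dual0 v).
Local Notation s0 := (chebv (n - 1) v0).
Local Notation t0 := (chebv (n - 2) v0).
Hypotheses (v2 : v0 != 2) (sn0 : s0 != 0).
Local Notation h0 := (v0 * s0 - 2 * t0 + 2).
Local Notation sum0 := (dual0 (x + y)).
Local Notation sum1 := (dual1 (x + y)).

Lemma jet_curve : [/\ sum0 * h0 = v0 + 2,
  h0 * (h0 - 4) = (v0 ^+ 2 - 4) * s0 ^+ 2,
  sum0 * (n%:~R * s0 * dual1 v) + sum1 * h0 = dual1 v &
  s0 ^+ 2 * (v0 - 2) * sum1 = (n%:~R * s0
    - (2 * s0 * chebv' (n - 1) v0 * (v0 - 2) + s0 ^+ 2) * sum0) * dual1 v].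
Proof.
have st (R : comNzRingType) (w : R) :
    chebv (n - 1) w ^+ 2 - w * chebv (n - 1) w * chebv (n - 2) w + chebv (n - 2) w ^+ 2 = 1.
  by have := chebv_norm (n - 1) w; have -> : n - 1 - 1 = n - 2 by lia.
have d2 : dual0 (2 : dual O) = 2 by exact: (rmorph_nat (@dual0 O)).
have d4 : dual0 (4 : dual O) = 4 by exact: (rmorph_nat (@dual0 O)).
have areg c : (v - 2) * c = 0 -> c = 0.
  apply: dual_regular; have -> : dual0 (v - 2) = v0 - 2 by rewrite -d2.
  by rewrite subr_eq0.
have sreg c : s * c = 0 -> c = 0.
  by apply: dual_regular; rewrite dual0_chebv.
have c1 := curve_sum (st _ v) f0 E0 W0 areg.
have c2 := curve_sum_h (st _ v) f0 E0 W0 areg sreg.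
have h1 : dual1 (v * s - 2 * t + 2) = n%:~R * s0 * dual1 v.
  transitivity (dual1 (v * s - 2 * t) + dual1 (2 : dual O)); first by [].
  by rewrite dual1_trace_power dual1_nat addr0.
have hh : dual0 (v * s - 2 * t + 2) = h0.
  by rewrite -!dual0_chebv -[in RHS]d2.
split.
- have := congr1 (@dual0 O) c2; rewrite dual0M hh => ->.
  by rewrite -[in RHS]d2.
- by have := h_quadratic (st _ v0).
- have := congr1 (@dual1 O) c2; rewrite dual1M hh h1 => ->.
  transitivity (dual1 v + dual1 (2 : dual O)); first by [].
  by rewrite dual1_nat addr0.
have := congr1 (@dual1 O) c1.
have -> : dual1 (v * s - 2 * t + 2 - 4) = n%:~R * s0 * dual1 v.
  transitivity (dual1 (v * s - 2 * t + 2) - dual1 (4 : dual O)); first by [].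
  by rewrite h1 dual1_nat subr0.
have s1 : dual1 s = chebv' (n - 1) v0 * dual1 v by exact: dual1_chebv.
have a0E : dual0 (v - 2) = v0 - 2 by rewrite -[in RHS]d2.
have a1E : dual1 (v - 2) = dual1 v.
  transitivity (dual1 v - dual1 (2 : dual O)); first by [].
  by rewrite dual1_nat subr0.
have leibniz (b a S : dual O) b0 b1 a0 a1 : dual0 b = b0 -> dual1 b = b1 ->
    dual0 a = a0 -> dual1 a = a1 -> dual1 (b ^+ 2 * a * S) =
    b0 ^+ 2 * a0 * dual1 S + (b0 ^+ 2 * a1 + 2 * b0 * b1 * a0) * dual0 S.
  by move=> <- <- <- <-; rewrite expr2 !dual1M !dual0M; ring.
rewrite (leibniz _ _ _ _ _ _ _ (dual0_chebv _ _) s1 a0E a1E).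
move: (dual0 _) (dual1 _) (dual0 (_ + _)) (dual1 (_ + _)) (chebv _ _) (chebv' _ _).
move=> V V1 S S1 b b' e.
rewrite mulrBl -e; ring.
Qed.
End Jet.

Section Morphisms.
Variables (R S : comNzRingType) (j : {rmorphism R -> S}) (x y z s t v : R).
Let j2 : j 2 = 2. Proof. exact: rmorph_nat. Qed.

Lemma rmorph_surface : j (s * (x * y - z * v) + t * (2 * z - x * y)) =
  j s * (j x * j y - j z * j v) + j t * (2 * j z - j x * j y).
Proof. by rewrite rmorphD !rmorphM !rmorphB !rmorphM j2. Qed.

Lemma rmorph_double_locus :
  j (v - 2 + (2 - x) * (2 - y)) = j v - 2 + (2 - j x) * (2 - j y).
Proof. by rewrite rmorphD rmorphM !rmorphB j2. Qed.

Lemma rmorph_tau_numerator :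
  j ((2 - x - y + z) * s * (v - 2) + (2 - x) * (2 - y) * (s - t - 1)) =
  (2 - j x - j y + j z) * j s * (j v - 2) + (2 - j x) * (2 - j y) * (j s - j t - 1).
Proof.
by rewrite rmorphD !rmorphM [j (_ + z)]rmorphD !rmorphB j2 rmorph1.
Qed.
End Morphisms.

Section Transversal.
Variables (O : idomainType) (char0 : forall k : int, k%:~R = 0 :> O -> k = 0).
Variables (n : int) (A B : O) (z : fps2 O).
Local Notation x := (fps2C O A + fps2X O).
Local Notation y := (fps2C O B + fps2Y O).
Local Notation v := (comm_trace x y z).
Local Notation s := (chebv (n - 1) v).
Local Notation t := (chebv (n - 2) v).
Local Notation E := (v - 2 + (2 - x) * (2 - y)).
Local Notation W := ((2 - x - y + z) * s * (v - 2) + (2 - x) * (2 - y) * (s - t - 1)).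
Hypothesis f0 : s * (x * y - z * v) + t * (2 * z - x * y) = 0.
Hypotheses (v2 : fps2_const O v != 2) (s0 : fps2_const O s != 0)
  (W0 : fps2_const O W = 0).

Section OneJet.
Variable j : {rmorphism fps2 O -> dual O}.
Hypothesis j0 : forall f, dual0 (j f) = fps2_const O f.
Hypothesis jE : j E = 0.

Let jv : j v = comm_trace (j x) (j y) (j z).
Proof. exact: rmorph_comm_trace. Qed.

Let jet_square (w e a b q : fps2 O) : w * (w + 2 * b) = a * (q * e ^+ 2) ->
  e = a + b -> fps2_const O w = 0 -> fps2_const O a != 0 -> j e = 0 -> j w = 0.
Proof.
move=> we eE w0 a0 je; have two : 2 != 0 :> O by apply/eqP => /(char0 (k := 2)).
apply: (@dual_regular _ (j (w + 2 * b))); last first.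
  by rewrite -rmorphM mulrC we !rmorphM je mul0r !mulr0.
have -> : w + 2 * b = w + 2 * (e - a) by rewrite eE; ring.
rewrite j0 rmorphD rmorphM rmorphB w0 add0r rmorph_nat -[fps2_const O e]j0 je sub0r.
by rewrite mulf_neq0 // oppr_eq0.
Qed.

(** By [tau_square] the product of W and W + 2 B vanishes to first order, and the
second factor is - 2 a there, which is nonzero. *)
Lemma jet_numerator : j W = 0.
Proof.
have st : s ^+ 2 - v * s * t + t ^+ 2 = 1.
  by have := chebv_norm (n - 1) v; have -> : n - 1 - 1 = n - 2 by lia.
apply: jet_square (tau_square st f0) (erefl _) W0 _ jE.
by rewrite rmorphB rmorph_nat subr_eq0.
Qed.

Let jet_hyps : [/\
  chebv (n - 1) (j v) * (j x * j y - j z * j v)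
    + chebv (n - 2) (j v) * (2 * j z - j x * j y) = 0,
  j v - 2 + (2 - j x) * (2 - j y) = 0 &
  (2 - j x - j y + j z) * chebv (n - 1) (j v) * (j v - 2)
    + (2 - j x) * (2 - j y) * (chebv (n - 1) (j v) - chebv (n - 2) (j v) - 1) = 0].
Proof.
rewrite -!rmorph_chebv; split.
- by rewrite -rmorph_surface f0 rmorph0.
- by rewrite -rmorph_double_locus.
- by rewrite -rmorph_tau_numerator jet_numerator.
Qed.

Lemma jet_of_curve (S1 := dual1 (j (x + y))) (V1 := dual1 (j v))
    (V := fps2_const O v) (b := chebv (n - 1) V)
    (h := V * b - 2 * chebv (n - 2) V + 2) (S0 := fps2_const O (x + y)) :
  [/\ S0 * h = V + 2, h * (h - 4) = (V ^+ 2 - 4) * b ^+ 2,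
    S0 * (n%:~R * b * V1) + S1 * h = V1 &
    b ^+ 2 * (V - 2) * S1 = (n%:~R * b
    - (2 * b * chebv' (n - 1) V * (V - 2) + b ^+ 2) * S0) * V1].
Proof.
case: jet_hyps; rewrite jv => h1 h2 h3.
have e := jet_curve h1 h2 h3; move: e.
rewrite -jv j0 -rmorphD j0; apply=> //.
by rewrite -rmorph_chebv.
Qed.
End OneJet.

(** If both derivatives of E vanish, then v = 2 - (2 - x)(2 - y) to first order
along both axes. *)
Lemma double_locus_transversal : ~ (jetX E = 0 /\ jetY E = 0).
Proof.
move=> [EX EY].
pose jX : {rmorphism fps2 O -> dual O} := @jetX O.
pose jY : {rmorphism fps2 O -> dual O} := @jetY O.
have [a1 a2 a3 a4] := jet_of_curve (j := jX) (fun f => erefl) EX.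
have [_ _ _ b4] := jet_of_curve (j := jY) (fun f => erefl) EY.
have xX : jetX x = Dual A 1.
  by apply: dualP; rewrite /= ?mulr0n ?mulr1n ?addr0 ?add0r.
have yX : jetX y = Dual B 0.
  by apply: dualP; rewrite /= ?mulr0n ?mulr1n ?addr0 ?add0r.
have xY : jetY x = Dual A 0.
  by apply: dualP; rewrite /= ?mulr0n ?mulr1n ?addr0 ?add0r.
have yY : jetY y = Dual B 1.
  by apply: dualP; rewrite /= ?mulr0n ?mulr1n ?addr0 ?add0r.
have vE (j : {rmorphism fps2 O -> dual O}) : j E = 0 -> j v = 2 - (2 - j x) * (2 - j y).
  rewrite rmorph_double_locus; move: (j v) (j x) (j y) => V X Y e.
  by rewrite -[LHS]subr0 -e; ring.
have two : (2 : dual O) = Dual 2 0.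
  by apply: dualP; [exact: (rmorph_nat (@dual0 O))|exact: dual1_nat].
have d1 a b : dual1 (2 - (2 - Dual A a) * (2 - Dual B b) : dual O) = a * (2 - B) + b * (2 - A).
  rewrite two; transitivity (0 - ((2 - A) * (0 - b) + (0 - a) * (2 - B))) => //.
  by ring.
have vX : dual1 (jetX v) = 2 - B.
  have -> : jetX v = 2 - (2 - Dual A 1) * (2 - Dual B 0).
    rewrite -xX -yX; exact: (vE jX EX).
  by rewrite d1; ring.
have vY' : jetY v = 2 - (2 - Dual A 0) * (2 - Dual B 1).
  rewrite -xY -yY; exact: (vE jY EY).
have vY : dual1 (jetY v) = 2 - A by rewrite vY' d1; ring.
have VE : fps2_const O v = 2 - (2 - A) * (2 - B).
  have -> : fps2_const O v = dual0 (jetY v) by [].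
  by rewrite vY' two; transitivity (2 - (2 - A) * (2 - B)) => //; ring.
have coef_sum (p q : dual O) a a' b b' : p = Dual a b -> q = Dual a' b' ->
    p + q = Dual (a + a') (b + b') by move=> -> ->.
have SE : fps2_const O (x + y) = 4 - (2 - A) - (2 - B).
  transitivity (A + B); last by ring.
  exact: (congr1 (@dual0 O) (coef_sum _ _ _ _ _ _ xX yX)).
have SX : dual1 (jetX (x + y)) = 1.
  by rewrite -[RHS]addr0; exact: (congr1 (@dual1 O) (coef_sum _ _ _ _ _ _ xX yX)).
have SY : dual1 (jetY (x + y)) = 1.
  by rewrite -[RHS]add0r; exact: (congr1 (@dual1 O) (coef_sum _ _ _ _ _ _ xY yY)).
rewrite SX SE vX in a3 a4; rewrite SE in a1; rewrite SY SE vY in b4.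
rewrite mulr1 in a4; rewrite mulr1 in b4; rewrite mul1r in a3.
have sE : fps2_const O s = chebv (n - 1) (fps2_const O v) by exact: rmorph_chebv.
have sn0 := s0; have vn2 := v2; rewrite sE VE in sn0; rewrite VE in vn2.
rewrite VE in a1 a2 a3 a4 b4.
exact: (branch_contradiction char0 (erefl _) sn0 vn2 b4 a4 a1 a3 a2).
Qed.
End Transversal.

(** * Irreducible representations have commutator trace different from 2 *)

(** A quadratic polynomial has a root or is irreducible, and in the second case
it acquires a root in the field it defines. *)
Lemma field_with_eigenvalue (F : fieldType) (N : 'M[F]_2) :
  exists (E : fieldType) (iota : {rmorphism F -> E}) (a : E),
    eigenvalue (map_mx iota N) a.
Proof.
have [[a ra]|noroot] := pselect (exists a, root (char_poly N) a).
  exists F, idfun, a; rewrite eigenvalue_root_char.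
  by have -> : map_mx idfun N = N by apply/matrixP => i j; rewrite mxE.
have irr : irreducible_poly (char_poly N).
  apply: cubic_irreducible; first by rewrite size_char_poly.
  by move=> a; apply/negP => ra; apply: noroot; exists a.
have [L _ [a ra _]] := irredp_FAdjoin irr.
exists L, (in_alg L), a; rewrite eigenvalue_root_char.
by rewrite -map_char_poly.
Qed.

Lemma rank1_of_singular (F : fieldType) (D : 'M[F]_2) :
  \det D = 0 -> D != 0 -> \rank D = 1%N.
Proof.
move=> dD D0; apply/eqP; rewrite eqn_leq lt0n mxrank_eq0 D0 andbT.
rewrite -ltnS ltn_neqAle rank_leq_row andbT.
apply/negP => rD; have : row_free D by [].
by rewrite row_free_unit unitmxE dD unitr0.
Qed.

(** Cayley-Hamilton for D X, divided by X. *)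
Lemma sandwich (R : comNzRingType) (D X : 'M[R]_2) :
  D *m X *m D = \tr (D *m X) *: D - \det D *: adj2 X.
Proof.
apply: mx2P; rewrite !(mul2E, mxE, tr2E, det2E, mulr0n, mulr1n) /=; ring.
Qed.

Lemma commuting_eigenline (F : fieldType) (N P : 'M[F]_2) :
  N *m P = P *m N -> ~~ is_scalar_mx N ->
  exists (E : fieldType) (iota : {rmorphism F -> E}) (U : 'M[E]_2),
    [/\ \rank U = 1%N, stablemx U (map_mx iota N) & stablemx U (map_mx iota P)].
Proof.
move=> cNP nsN; have [E [iota [a ea]]] := field_with_eigenvalue N.
exists E, iota, (eigenspace (map_mx iota N) a); split.
- apply/eqP; rewrite eqn_leq lt0n mxrank_eq0 andbC; apply/andP; split.
    by move: ea; rewrite /eigenvalue.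
  rewrite -ltnS ltn_neqAle rank_leq_row andbT.
  apply: contra nsN => rU.
  have : row_full (eigenspace (map_mx iota N) a) by [].
  rewrite -sub1mx => /eigenspaceP; rewrite mul1mx scalemx1 => eN.
  have e01 : iota (N 0 1) = 0 by have := congr1 (fun X : 'M_2 => X 0 1) eN; rewrite !mxE mulr0n.
  have e10 : iota (N 1 0) = 0 by have := congr1 (fun X : 'M_2 => X 1 0) eN; rewrite !mxE mulr0n.
  have e11 : iota (N 0 0) = iota (N 1 1).
    have := congr1 (fun X : 'M_2 => X 1 1) eN; rewrite !mxE mulr1n => ->.
    by have := congr1 (fun X : 'M_2 => X 0 0) eN; rewrite !mxE mulr1n.
  apply/is_scalar_mxP; exists (N 0 0); apply: mx2P; rewrite !mxE ?mulr1n ?mulr0n //.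
  + by apply: (fmorph_inj iota); rewrite e01 rmorph0.
  + by apply: (fmorph_inj iota); rewrite e10 rmorph0.
  + exact/esym/(fmorph_inj iota).
- exact: comm_mx_stable_eigenspace.
- by apply: comm_mx_stable_eigenspace; rewrite /comm_mx -!map_mxM cNP.
Qed.

(** If D = N P - P N is nonzero and singular, then it has trace 0 and rank 1, so
D X D = tr(D X) D; as tr(D N) = tr(D P) = 0, the line of D is stable. If D = 0,
an eigenspace of a nonscalar one of the two matrices is stable under both. *)
Lemma common_eigenline (F : fieldType) (N P : 'M[F]_2) :
  \det (N *m P - P *m N) = 0 ->
  exists (E : fieldType) (iota : {rmorphism F -> E}) (U : 'M[E]_2),
    [/\ \rank U = 1%N, stablemx U (map_mx iota N) & stablemx U (map_mx iota P)].
Proof.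
set D := N *m P - P *m N => dD.
have [D0|D0] := eqVneq D 0.
  have cNP : N *m P = P *m N by apply/eqP; rewrite -subr_eq0; apply/eqP.
  have [/is_scalar_mxP[a aN]|] := boolP (is_scalar_mx N); last exact: commuting_eigenline.
  have [/is_scalar_mxP[b bP]|nsP] := boolP (is_scalar_mx P); last first.
    have [E [iota [U [rU sP sN]]]] := commuting_eigenline (esym cNP) nsP.
    by exists E, iota, U.
  exists F, idfun, (delta_mx 0 0); split; first by rewrite mxrank_delta.
    by rewrite aN map_scalar_mx stablemxC.
  by rewrite bP map_scalar_mx stablemxC.
exists F, idfun, D; split; first exact: rank1_of_singular.
all: have idE (X : 'M[F]_2) : map_mx idfun X = X by apply/matrixP => i j; rewrite mxE.
all: rewrite idE.
all: have rD := rank1_of_singular dD D0.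
all: have trD : \tr D = 0 by rewrite /D raddfB /= mxtrace_mulC subrr.
all: have stab (X : 'M[F]_2) : \tr (D *m X) = 0 -> stablemx D X.
1,3: move=> tX; have DD : (D <= kermx D)%MS.
1,3: apply/sub_kermxP; have := sandwich D 1%:M; rewrite mulmx1 => ->.
1,2: by rewrite trD dD !scale0r subrr.
1,2: have kD : (kermx D <= D)%MS.
1,3: by move: DD => /mxrank_leqif_sup[_ /esym]; rewrite mxrank_ker rD eqxx.
1,2: apply: submx_trans kD; apply/sub_kermxP.
1,2: by rewrite sandwich tX dD !scale0r subrr.
all: apply: stab; rewrite /D mulmxBl raddfB /= -!mulmxA.
- by rewrite [X in X - _]mxtrace_mulC -mulmxA subrr.
- by rewrite [X in _ - X]mxtrace_mulC -mulmxA subrr.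
Qed.

Lemma stablemx_word (F E : fieldType) (iota : {rmorphism F -> E}) (U : 'M[E]_2)
    (g : bool -> 'M[F]_2) w :
  (forall i, stablemx U (map_mx iota (g i))^T) ->
  stablemx U (map_mx iota (weval g w))^T.
Proof.
move=> sg; elim: w => [|l w IH] /=.
  by rewrite map_scalar_mx tr_scalar_mx stablemxC.
rewrite map_mxM trmx_mul; apply: stablemxM => //.
rewrite /lmat; case: ifP => _ //.
rewrite map_adj2 /adj2 linearB /= tr_scalar_mx.
by apply: stablemxD; rewrite ?stablemxN ?stablemxC.
Qed.

Lemma irreducible_trace_commutator (rels : seq (word bool * word bool))
    (F : fieldType) (rho : pres_group rels -> 'M[F]_2)
    (m := rho (pres_gen rels false)) (u := rho (pres_gen rels true)) :
  is_SL2_rep (G := pres_group rels) rho ->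
  absolutely_irreducible (G := pres_group rels) rho ->
  comm_trace (\tr m) (\tr u) (\tr (m *m u)) != 2.
Proof.
move=> rhoP irr; apply/eqP => v2.
have [dm du] : \det m = 1 /\ \det u = 1 by case: (rhoP) => d1 _ _; split; apply: d1.
have : \det (m^T *m u^T - u^T *m m^T) = 0.
  rewrite -!trmx_mul -linearB /= det_tr -opprB -scaleN1r detZ det_commutator // v2.
  by rewrite subrr mulr0.
move=> /common_eigenline[E [iota [U [rU sm su]]]].
suff : \rank U = 0%N \/ \rank U = 2%N by rewrite rU => -[].
apply: (irr E iota U) => a.
rewrite -[a]word_elt_repr (rep_word rhoP).
by apply: stablemx_word => -[]; rewrite matrix.map_trmx.
Qed.

(** * A deformation over the dual numbers *)

Lemma map_weval (R S : comNzRingType) (h : {rmorphism R -> S})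
    (g : bool -> 'M[R]_2) w :
  map_mx h (weval g w) = weval (fun i => map_mx h (g i)) w.
Proof.
elim: w => [|l w IH] /=; first by rewrite map_scalar_mx rmorph1.
by rewrite map_mxM IH /lmat; congr (_ *m _); case: ifP; rewrite ?map_adj2.
Qed.

Section DualLocal.
Variables (O : comUnitRingType) (F : fieldType) (res : {rmorphism O -> F}).
Local Notation D := (dual F).
Let iS : {rmorphism O -> D} := @dualC F \o res.
Let rS : {rmorphism D -> F} := @dual0 F.

Lemma dual_local_residue : local_residue rS.
Proof.
split=> [c|a]; first by exists (dualC c).
by rewrite -unitfE.
Qed.

(** The square of the maximal ideal is zero, so every Cauchy sequence is constant
from its third term on. *)
Lemma dual_adic_complete : adic_complete (fun a : D => rS a = 0).
Proof.
have exp0 (a : D) : ideal_exp (fun b : D => rS b = 0) 0 a.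
  exists 1, (fun=> a), (fun _ _ => 0); split=> [_ []//|].
  by rewrite big_ord1 big_ord0 mulr1.
have exp1 (a : D) : rS a = 0 -> ideal_exp (fun b : D => rS b = 0) 1 a.
  move=> a0; exists 1, (fun=> 1), (fun _ _ => a); split=> [//|].
  by rewrite !big_ord1 mul1r.
have exp2 k (a : D) : ideal_exp (fun b : D => rS b = 0) k.+2 a -> a = 0.
  have nil2 (b1 b2 d : D) : rS b1 = 0 -> rS b2 = 0 -> b1 * (b2 * d) = 0.
    move=> b10 b20; have b12 : b1 * b2 = 0.
      by apply: dualP; rewrite ?dual0M ?dual1M /= b10 b20 ?(mul0r, mulr0, addr0).
    by rewrite mulrA b12 mul0r.
  move=> [q [c [b [b0 ->]]]]; apply: big1 => i _.
  by rewrite !big_ord_recl (nil2 (b i ord0)) ?mulr0 //; exact: b0.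
split=> [a /(_ 2) /exp2 //|u uP].
have const k : u k.+2 = u 2.
  elim: k => [//|k IH]; apply/eqP; rewrite -IH -subr_eq0; apply/eqP.
  exact: exp2 (uP _).
exists (u 2) => -[|[|k]]; first exact: exp0.
  exact: uP 1.
by rewrite const subrr; exists 0, (fun=> 0), (fun _ _ => 0); rewrite big_ord0.
Qed.

Lemma dual_complete_local : complete_local_algebra res iS rS.
Proof.
by split; [exact: dual_local_residue|exact: dual_adic_complete|].
Qed.
End DualLocal.

Section DualLift.
Variables (F : fieldType) (m u : 'M[F]_2).
Hypotheses (dm : \det m = 1) (du : \det u = 1).
Local Notation v := (comm_trace (\tr m) (\tr u) (\tr (m *m u))).
Hypotheses (two : 2 != 0 :> F) (v2 : v != 2).
Local Notation D := (dual F).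
Let inj (A : 'M[F]_2) : 'M[D]_2 := map_mx (@dualC F) A.
Let C := m *m u - u *m m.
Let c : F := (2 * (v - 2))^-1.
Let E : 'M[D]_2 := (dual_eps F * dualC c) *: inj C.
(** With C = m mu - mu m, conjugating mu by 1 + eps c C preserves the traces of m
and mu and moves the trace of m mu by c tr(C^2) = 2 c (v - 2); the factor c
makes this displacement equal to eps. *)
Definition conj_factor : 'M[D]_2 := 1%:M + E.
Definition tilted : 'M[D]_2 := adj2 conj_factor *m inj u *m conj_factor.

Let trC : \tr C = 0.
Proof. by rewrite /C raddfB /= mxtrace_mulC subrr. Qed.

Let adjE : adj2 E = - E.
Proof.
rewrite /adj2 /E mxtraceZ /inj trace_map_mx trC rmorph0 mulr0.
by rewrite (raddf0 scalar_mx) sub0r.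
Qed.

Let EAE (A : 'M[D]_2) : E *m A *m E = 0.
Proof.
rewrite /E -!scalemxAl -scalemxAr scalerA.
have -> : dual_eps F * dualC c * (dual_eps F * dualC c) = 0.
  by apply: dualP; rewrite /= ?(mul0r, mulr0, addr0).
by rewrite scale0r.
Qed.

Let adjP : adj2 conj_factor = 1%:M - E.
Proof. by rewrite /conj_factor adj2D adj2_scalar adjE. Qed.

Let PP : conj_factor *m adj2 conj_factor = 1%:M.
Proof.
have EE : E *m E = 0 by rewrite -[X in X *m _]mulmx1 EAE.
by rewrite adjP /conj_factor mulmxDl !mulmxBr !mulmx1 !mul1mx EE subr0 subrK.
Qed.

Lemma det_tilted : \det tilted = 1.
Proof.
rewrite /tilted !det_mulmx mulrAC -det_mulmx mulrC.
have -> : \det (adj2 conj_factor *m conj_factor) = 1.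
  have := congr1 (fun X : 'M_2 => X 0 0) PP; rewrite mulmx_adj2 !mxE !mulr1n => e.
  by rewrite adj2_mulmx e det1.
by rewrite mulr1 /inj det_map_mx du rmorph1.
Qed.

Lemma tr_tilted : \tr tilted = dualC (\tr u).
Proof.
by rewrite /tilted mxtrace_mulC mulmxA PP mul1mx /inj trace_map_mx.
Qed.

Lemma tiltedE : tilted = inj u + (dual_eps F * dualC c) *: inj (u *m C - C *m u).
Proof.
have gen (A X : 'M[D]_2) : X *m A *m X = 0 ->
    (1%:M - X) *m A *m (1%:M + X) = A + (A *m X - X *m A).
  move=> XAX; rewrite mulmxBl mul1mx mulmxBl !mulmxDr !mulmx1 XAX addr0.
  by rewrite addrA.
rewrite /tilted adjP gen; last exact: EAE.
congr (_ + _); rewrite /E -scalemxAr -scalemxAl -scalerBr; congr (_ *: _).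
by rewrite /inj [RHS]map_mxB; congr (_ - _); symmetry; exact: map_mxM.
Qed.

Lemma tr_inj_tilted : \tr (inj m *m tilted) = dualC (\tr (m *m u)) + dual_eps F.
Proof.
rewrite tiltedE mulmxDr -scalemxAr raddfD /= mxtraceZ /inj -!map_mxM !trace_map_mx.
congr (_ + _).
have -> : \tr (m *m (u *m C - C *m u)) = 2 * (v - 2).
  have -> : 2 * (v - 2) = \tr (C *m C).
    have -> : C *m C = - (\det C)%:M.
      by rewrite -mulmx_adj2 /adj2 trC (raddf0 scalar_mx) sub0r mulmxN opprK.
    rewrite raddfN /= mxtrace_scalar /C det_commutator //; ring.
  rewrite mulmxBr !mulmxA raddfB /= [\tr (m *m C *m u)]mxtrace_mulC mulmxA -raddfB /=.
  by rewrite -mulmxBl.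
have c1 : c * (2 * (v - 2)) = 1 by rewrite /c mulVf // mulf_neq0 // subr_eq0.
have c1' : dualC c * dualC (2 * (v - 2)) = 1 by rewrite -rmorphM c1 rmorph1.
by rewrite -mulrA c1' mulr1.
Qed.

Lemma map_dual0_inj (A : 'M[F]_2) : map_mx (@dual0 F) (inj A) = A.
Proof. by apply/matrixP => i j; rewrite !mxE. Qed.

Lemma map_dual0_tilted : map_mx (@dual0 F) tilted = u.
Proof.
apply/matrixP => i j; rewrite tiltedE mxE mxE [in X in _ + X]mxE mxE.
transitivity (u i j + (0 * c) * (u *m C - C *m u) i j); last by rewrite !mul0r addr0.
by rewrite [X in _ + _ * X]mxE.
Qed.

End DualLift.

(** * Universality excludes the other component *)

Section Exclusion.
Variables (n : int) (O : idomainType) (F : fieldType) (res : {rmorphism O -> F}).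
Variables (rhobar : whitehead_group n -> 'M[F]_2) (A B : O)
  (rho : whitehead_group n -> 'M[fps2 O]_2).
Local Notation m := (rhobar (wh_m n)).
Local Notation u := (rhobar (wh_mu n)).
Local Notation v := (comm_trace (\tr m) (\tr u) (\tr (m *m u))).
Hypothesis rhobarP : is_SL2_rep rhobar.
Hypotheses (two : 2 != 0 :> F) (v2 : v != 2).
Hypothesis f0 : fval m u (chebv (n - 1) v) (chebv (n - 2) v) = 0.
Hypotheses (resA : res A = \tr m) (resB : res B = \tr u).
Hypothesis univ : universal_deformation res rhobar (fps2C O) (res \o fps2_const O) rho.
Hypotheses (trm : \tr (rho (wh_m n)) = fps2C O A + fps2X O)
  (tru : \tr (rho (wh_mu n)) = fps2C O B + fps2Y O).
Let r := ((false, false) :: whitehead_omega n, rcons (whitehead_omega n) (false, false)).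
Local Notation rels := [:: r].

Let det_m : \det m = 1. Proof. by case: rhobarP => d1 _ _; apply: d1. Qed.
Let det_u : \det u = 1. Proof. by case: rhobarP => d1 _ _; apply: d1. Qed.

Let gt (i : bool) : 'M[dual F]_2 := if i then tilted m u else map_mx (@dualC F) m.

Let det_gt i : \det (gt i) = 1.
Proof.
case: i; first exact: det_tilted.
by rewrite /gt det_map_mx det_m rmorph1.
Qed.

Let dual0_gt i : map_mx (@dual0 F) (gt i) = rhobar (pres_gen rels i).
Proof. by case: i; [exact: map_dual0_tilted|exact: map_dual0_inj]. Qed.

Let tr_gt_m : \tr (gt false) = dualC (\tr m).
Proof. by rewrite /gt trace_map_mx. Qed.
Let tr_gt_u : \tr (gt true) = dualC (\tr u).
Proof. exact: tr_tilted. Qed.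
Let tr_gt_mu : \tr (gt false *m gt true) = dualC (\tr (m *m u)) + dual_eps F.
Proof. exact: tr_inj_tilted. Qed.

(** If s and f_n both vanish at the residual point, then s f_n is zero at
(x, y, z + eps), so the tilted pair is a deformation. A morphism from the
universal ring that induces it kills X and Y, hence takes constant values,
which is impossible for the trace z + eps of m mu. *)
Lemma geometric_only : chebv (n - 1) v != 0.
Proof.
apply/eqP => s0.
have v0 : dual0 (comm_trace (\tr (gt false)) (\tr (gt true)) (\tr (gt false *m gt true))) = v.
  rewrite (rmorph_comm_trace (@dual0 F)) tr_gt_m tr_gt_u tr_gt_mu.
  by congr comm_trace; rewrite /= addr0.
have rel0 : weval gt r.1 = weval gt r.2.
  apply/eqP; rewrite -subr_eq0 (whitehead_relation n det_gt).
  set s := chebv _ _; set t := chebv _ _.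
  have s00 : dual0 s = 0 by rewrite dual0_chebv v0.
  have f00 : dual0 (fval (gt false) (gt true) s t) = 0.
    have sE : dual0 s = chebv (n - 1) v by rewrite s00 s0.
    have tE : dual0 t = chebv (n - 2) v by rewrite dual0_chebv v0.
    have xE : dual0 (\tr (gt false)) = \tr m by rewrite tr_gt_m.
    have yE : dual0 (\tr (gt true)) = \tr u by rewrite tr_gt_u.
    have zE : dual0 (\tr (gt false *m gt true)) = \tr (m *m u).
      by rewrite tr_gt_mu /= addr0.
    have surf (p q x y z w : dual F) p0 q0 x0 y0 z0 w0 :
        dual0 p = p0 -> dual0 q = q0 -> dual0 x = x0 -> dual0 y = y0 ->
        dual0 z = z0 -> dual0 w = w0 ->
        dual0 (p * (x * y - z * w) + q * (2 * z - x * y)) =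
        p0 * (x0 * y0 - z0 * w0) + q0 * (2 * z0 - x0 * y0).
      move=> <- <- <- <- <- <-.
      exact: (rmorph_surface (@dual0 F : {rmorphism dual F -> F})).
    exact: etrans (surf _ _ _ _ _ _ _ _ _ _ _ _ sE tE xE yE zE v0) f0.
  have -> : s * fval (gt false) (gt true) s t = 0.
    by apply: dualP; rewrite ?dual0M ?dual1M s00 f00 ?(mul0r, mulr0, addr0).
  by rewrite scale0r.
pose sigma : whitehead_group n -> 'M[dual F]_2 := @rep_of rels _ gt.
have relP r' : r' \in rels -> weval gt r'.1 = weval gt r'.2.
  by rewrite inE => /eqP ->.
have sigmaP : is_SL2_rep sigma by exact: rep_ofP.
have lift : is_lift rhobar (@dual0 F) sigma.
  split=> // a; rewrite /sigma /rep_of map_weval.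
  rewrite -{2}[a]word_elt_repr (rep_word rhobarP).
  by congr weval; apply/funext => i; apply: dual0_gt.
case: univ => _ _ /(_ _ _ _ _ (dual_complete_local res) lift)[phi [phiO phir [P uP [_ eqv]]] _].
have trs a : \tr (sigma a) = phi (\tr (rho a)).
  by rewrite eqv mxtrace_mulC mulmxA mulVmx // mul1mx trace_map_mx.
have phiX : phi (fps2X O) = 0.
  have : phi (fps2C O A + fps2X O) = dualC (res A).
    by rewrite -trm -trs /sigma rep_of_gen // tr_gt_m resA.
  rewrite rmorphD phiO => /eqP; rewrite -subr_eq0 => /eqP <-.
  by rewrite [LHS](_ : _ = dualC (res A) + phi (fps2X O) - dualC (res A)) //; ring.
have phiY : phi (fps2Y O) = 0.
  have : phi (fps2C O B + fps2Y O) = dualC (res B).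
    by rewrite -tru -trs /sigma rep_of_gen // tr_gt_u resB.
  rewrite rmorphD phiO => /eqP; rewrite -subr_eq0 => /eqP <-.
  by rewrite [LHS](_ : _ = dualC (res B) + phi (fps2Y O) - dualC (res B)) //; ring.
have phiE b : phi b = dualC (res (fps2_const O b)).
  have b0 : fps2_const O (b - fps2C O (fps2_const O b)) = 0.
    by rewrite rmorphB /= -[X in _ - X]/(fps2_const O b) subrr.
  have [c [d e]] := in_ideal2 b0.
  rewrite {1}(_ : b = c * fps2X O + d * fps2Y O + fps2C O (fps2_const O b)).
    by rewrite rmorphD phiO rmorphD !rmorphM phiX phiY !mulr0 !add0r.
  by rewrite -e subrK.
have := trs (wh_m n * wh_mu n)%g; rewrite phiE.
have [_ _ ->] := sigmaP.
have -> : sigma (wh_m n) = gt false by exact: rep_of_gen.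
have -> : sigma (wh_mu n) = gt true by exact: rep_of_gen.
rewrite tr_gt_mu => /(congr1 (@dual1 F)) /=.
by rewrite add0r => /eqP; rewrite oner_eq0.
Qed.

End Exclusion.

(** * The theorem *)

Lemma char0_intr (O : idomainType) : [pchar O] =i pred0 ->
  forall k : int, k%:~R = 0 :> O -> k = 0.
Proof.
move=> char0; have nat0 (k : nat) : k%:R = 0 :> O -> k = 0%N.
  by move=> /eqP; rewrite (pcharf0P O).1 // => /eqP.
case=> k; first by move=> /nat0 ->.
by rewrite NegzE mulrNz => /eqP; rewrite oppr_eq0 => /eqP /nat0.
Qed.

(** Two orders divide each other; in a local ring, L = c d L with c d a nonunit
forces L = 0. *)
Lemma order_unique (R : comUnitRingType) (F : fieldType) (res : {rmorphism R -> F})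
    (M : lmodType R) (Z B : M -> Prop) (L T : R) :
  local_residue res -> is_order Z B L -> is_order Z B T -> eq_up_to_unit L T.
Proof.
move=> [_ units] [_ L1 L2] [_ T1 T2].
have [d TE] := T2 _ L1; have [c LE] := L2 _ T1.
have [uc|nuc] := boolP (c \is a GRing.unit); first by exists c.
have u1 : 1 - d * c \is a GRing.unit.
  have c0 : res c = 0 by apply/eqP; rewrite -[_ == 0]negbK -units.
  by rewrite units rmorphB rmorphM c0 mulr0 rmorph1 subr0 oner_eq0.
have T0 : T = 0.
  apply: (mulrI u1); rewrite mulr0 mulrBl mul1r -mulrA -LE -TE subrr.
  by [].
by exists 1; rewrite ?unitr1 // LE T0 !mulr0.
Qed.

Lemma eq_comm_trace (R : comNzRingType) (x x' y y' z z' : R) :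
  x = x' -> y = y' -> z = z' -> comm_trace x y z = comm_trace x' y' z'.
Proof. by move=> -> -> ->. Qed.

Lemma eq_evalZ (R : comNzRingType) q (x x' y y' z z' : R) :
  x = x' -> y = y' -> z = z' -> evalZ q x y z = evalZ q x' y' z'.
Proof. by move=> -> -> ->. Qed.

Section Main.
Variables (n : int) (F : fieldType) (O : idomainType)
    (res : {rmorphism O -> F})
    (rhobar : whitehead_group n -> 'M[F]_2)
    (A B : O)
    (rho : whitehead_group n -> 'M[fps2 O]_2)
    (K : closedFieldType) (iota : {rmorphism {fraction O} -> K}).
Local Notation Abar := (\tr (rhobar (wh_m n))).
Local Notation Bbar := (\tr (rhobar (wh_mu n))).
Local Notation Cbar := (\tr (rhobar (wh_m n * wh_mu n)%g)).
Local Notation x := (fps2C O A + fps2X O).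
Local Notation y := (fps2C O B + fps2Y O).
Local Notation IK := (ideal2 (fps2X K) (fps2Y K)).
Hypotheses (two : 2 != 0 :> F) (char0 : forall k : int, k%:~R = 0 :> O -> k = 0).
Hypotheses (rhobarP : is_SL2_rep rhobar) (v2 : comm_trace Abar Bbar Cbar != 2).
Hypothesis f0 : evalZ (poly_f n) Abar Bbar Cbar = 0.
Hypothesis fz : evalZ (poly_f n)^`M(iz) Abar Bbar Cbar != 0.
Hypotheses (resA : res A = Abar) (resB : res B = Bbar).
Hypothesis univ : universal_deformation res rhobar (fps2C O) (res \o fps2_const O) rho.
Hypotheses (trm : \tr (rho (wh_m n)) = x) (tru : \tr (rho (wh_mu n)) = y).

Let red : {rmorphism fps2 O -> F} := res \o fps2_const O.
Let z := \tr (rho (wh_m n * wh_mu n)%g).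
Let v := comm_trace x y z.
Let s := chebv (n - 1) v.
Let t := chebv (n - 2) v.
Let r := ((false, false) :: whitehead_omega n, rcons (whitehead_omega n) (false, false)).

Let local : local_residue red.
Proof. by case: univ => -[]. Qed.
Let unitE a : (a \is a GRing.unit) = (red a != 0).
Proof. by case: local. Qed.
Let rhoP : is_SL2_rep rho.
Proof. by case: univ => _ []. Qed.
Let red_rho a : map_mx red (rho a) = rhobar a.
Proof. by case: univ => _ []. Qed.
Let zE : z = \tr (rho (wh_m n) *m rho (wh_mu n)).
Proof. by case: rhoP => _ _ rM; rewrite /z rM. Qed.
Let CbarE : Cbar = \tr (rhobar (wh_m n) *m rhobar (wh_mu n)).
Proof. by case: rhobarP => _ _ rM; rewrite rM. Qed.

Let red_tr a : red (\tr (rho a)) = \tr (rhobar a).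
Proof. by rewrite -trace_map_mx red_rho. Qed.
Let red_x : red x = Abar. Proof. by rewrite -trm red_tr. Qed.
Let red_y : red y = Bbar. Proof. by rewrite -tru red_tr. Qed.
Let red_z : red z = Cbar. Proof. by rewrite red_tr. Qed.
Let red_v : red v = comm_trace Abar Bbar Cbar.
Proof.
apply: (etrans (rmorph_comm_trace red x y z)).
exact: eq_comm_trace red_x red_y red_z.
Qed.
Let red_s : red s != 0.
Proof.
rewrite rmorph_chebv red_v CbarE.
apply: (geometric_only (res := res) (rho := rho) (A := A) (B := B)) => //.
  by rewrite -CbarE.
by move: f0; rewrite evalZ_f CbarE.
Qed.

Let surface : s * (x * y - z * v) + t * (2 * z - x * y) = 0.
Proof.
have dg := det_gval (r := r) rhoP.
have := whitehead_relation n dg; rewrite (weval_rel (r := r) rhoP) subrr.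
have -> : gval (r := r) rho false = rho (wh_m n) by [].
have -> : gval (r := r) rho true = rho (wh_mu n) by [].
rewrite /fval -zE trm tru -/v -/s -/t.
set k := s * _; set C := _ - _ => /esym kC.
apply: (mulrI (x := s)); first by rewrite unitE.
rewrite mulr0 -/k.
have uC : 2 - v \is a GRing.unit.
  by rewrite unitE rmorphB rmorph_nat red_v subr_eq0 eq_sym.
apply: (mulIr uC); rewrite mul0r.
have dC : \det C = 2 - v.
  by rewrite /v -trm -tru zE; apply: det_commutator; apply: (det_gval (r := r) rhoP _).
have := congr1 (fun X => (X *m adj2 C) 0 0) kC.
by rewrite -scalemxAl mulmx_adj2 mul0mx dC !mxE mulr1n.
Qed.

Let implicit_z : is_implicit_function res (poly_f n) A B Cbar z.
Proof. by split; [rewrite evalZ_f; exact: surface|exact: red_z]. Qed.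

(** For another solution z', Taylor expansion gives
   0 = (z' - z) (f_z(z) + (z' - z) q), and the second factor is a unit. *)
Let implicit_unique z' : is_implicit_function res (poly_f n) A B Cbar z' -> z = z'.
Proof.
move=> [e' c'].
have [q qE] := evalZ_taylor (poly_f n) x y z (z' - z).
have zz : z + (z' - z) = z' by rewrite addrC subrK.
move: qE; rewrite zz e' implicit_z.1 add0r => qE.
apply/esym/eqP; rewrite -subr_eq0; apply/eqP.
have uq : evalZ (poly_f n)^`M(iz) x y z + (z' - z) * q \is a GRing.unit.
  rewrite unitE rmorphD rmorphM.
  have -> : red (z' - z) = 0 by rewrite rmorphB red_z -c' subrr.
  rewrite mul0r addr0.
  have -> : red (evalZ (poly_f n)^`M(iz) x y z) = evalZ (poly_f n)^`M(iz) Abar Bbar Cbar.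
    apply: (etrans (rmorph_evalZ red _ x y z)); exact: eq_evalZ red_x red_y red_z.
  exact: fz.
apply: (mulIr uq); rewrite mul0r mulrDr mulrA -expr2.
by rewrite -qE.
Qed.

Let a := v - 2.
Let BB := (2 - x) * (2 - y).
Let E := a + BB.
Let tau := evalZ (poly_tau n) x y z.
Let W := (2 - x - y + z) * s * a + BB * (s - t - 1).

Let WE : tau * a = W.
Proof. exact: evalZ_tau. Qed.
Let st : s ^+ 2 - v * s * t + t ^+ 2 = 1.
Proof. by have := chebv_norm (n - 1) v; have -> : n - 1 - 1 = n - 2 by lia. Qed.
Let W_square : W * (W + 2 * BB) = a * (s ^+ 2 * E ^+ 2).
Proof. exact: tau_square st surface. Qed.

Let red2 : red 2 = 2. Proof. exact: rmorph_nat. Qed.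
Let red_a : red a != 0.
Proof. by rewrite rmorphB red2 red_v subr_eq0. Qed.
Let unit_a : a \is a GRing.unit. Proof. by rewrite unitE. Qed.

Let red_const0 b : fps2_const O b = 0 -> red b = 0.
Proof. by move=> b0; transitivity (res (fps2_const O b)); rewrite // b0 rmorph0. Qed.
Let const_neq0 b : red b != 0 -> fps2_const O b != 0.
Proof. by apply: contraNneq => /red_const0 ->. Qed.

Let L_function : exists T, is_L_function rho T /\ eq_up_to_unit T tau.
Proof.
pose V := comm_trace (\tr (rho (wh_m n))) (\tr (rho (wh_mu n)))
  (\tr (rho (wh_m n) *m rho (wh_mu n))).
have VE : V = v by rewrite /V -zE trm tru.
have V2 : red V != 2 by rewrite VE red_v.
have f0V : fval (rho (wh_m n)) (rho (wh_mu n)) (chebv (n - 1) V) (chebv (n - 2) V) = 0.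
  by rewrite VE /fval -zE trm tru; exact: surface.
have x2 : GRing.lreg (2 - \tr (rho (wh_m n))).
  rewrite trm.
  have -> : 2 - x = fpsC (fpsC (2 - A) - fpsX O).
    by rewrite rmorphB /= rmorphB rmorph_nat rmorphB rmorph_nat opprD addrA.
  exact/lreg_fpsC/lreg_fps_linear.
have [T [w [LT uw TE]]] := L_function_tau local rhoP V2 f0V x2.
have tauE : evalZ (poly_tau n) (\tr (rho (wh_m n))) (\tr (rho (wh_mu n)))
    (\tr (rho (wh_m n) *m rho (wh_mu n))) = tau by rewrite -zE trm tru.
exists T; split; first exact: LT.
exists (w * 2).
  by rewrite unitrM uw unitE red2.
move: TE; rewrite [X in w * (2 * X)]tauE => ->.
exact: mulrA.
Qed.

(** At a zero of tau, E vanishes and a tau + 2 B has residue - 2 a, so it is a unit. *)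
Let tau_factor : fps2_const O tau = 0 ->
  fps2_const O E = 0 /\ exists2 c, c \is a GRing.unit & tau = c * E ^+ 2.
Proof.
move=> tau0.
have W0 : fps2_const O W = 0 by rewrite -WE rmorphM tau0 mul0r.
have E0 : fps2_const O E = 0.
  have gen (f g h : fps2 O) : fps2_const O (f * (g ^+ 2 * h ^+ 2)) =
      fps2_const O f * (fps2_const O g ^+ 2 * fps2_const O h ^+ 2).
    by rewrite rmorphM [fps2_const O (_ ^+ 2 * _)]rmorphM !rmorphXn.
  have := congr1 (fps2_const O) W_square; rewrite gen rmorphM W0 mul0r.
  move=> /esym/eqP; rewrite !mulf_eq0 (negbTE (const_neq0 red_a)).
  by rewrite (negbTE (const_neq0 red_s)) !orFb orbb => /eqP.
split=> //.
have redE : red E = 0 by apply: red_const0.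
have redtau : red tau = 0 by apply: red_const0.
pose N := tau * a + 2 * BB.
have uN : N \is a GRing.unit.
  rewrite unitE /N (_ : BB = E - a); last by rewrite /E addrC addKr.
  have gen (b c d e : fps2 O) :
      red (b * c + 2 * (d - e)) = red b * red c + 2 * (red d - red e).
    by rewrite rmorphD !rmorphM rmorphB red2.
  rewrite gen redtau redE mul0r add0r sub0r.
  by rewrite mulf_neq0 // oppr_eq0.
have NE : tau * N = s ^+ 2 * E ^+ 2.
  by apply: (mulrI unit_a); rewrite -W_square -WE /N; ring.
exists (s ^+ 2 / N).
  by rewrite unitrM unitrV uN unitrX // unitE.
apply: (mulIr uN); rewrite NE.
by rewrite [RHS]mulrAC mulrVK.
Qed.

Let phi : {rmorphism O -> K} := iota \o @tofrac O.
Let phi_inj : injective phi.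
Proof. by move=> b c /fmorph_inj /eqP; rewrite tofrac_eq => /eqP. Qed.
Let phi2 : {rmorphism fps2 O -> fps2 K} := fps_map (fps_map phi).

Let multiplicity L : eq_up_to_unit L tau -> fps2_const O L = 0 ->
  let LK := fps2_map (fun b => iota (tofrac b)) L in
  ideal_exp IK 2 LK /\ ~ ideal_exp IK 3 LK.
Proof.
move=> [c uc LE] L0 LK.
have nz b : b \is a GRing.unit -> fps2_const O b != 0.
  by rewrite unitE; exact: const_neq0.
have tau0 : fps2_const O tau = 0.
  have := L0; rewrite LE rmorphM => /eqP.
  by rewrite mulf_eq0 (negbTE (nz _ uc)) => /eqP.
have [E0 [d ud tauE]] := tau_factor tau0.
have LKE : LK = phi2 (c * d) * phi2 E ^+ 2.
  by rewrite -rmorphXn -rmorphM -mulrA -tauE -LE.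
have EK0 : fps2_const K (phi2 E) = 0.
  by transitivity (phi (fps2_const O E)) => //; rewrite E0 rmorph0.
have cK0 : fps2_const K (phi2 (c * d)) != 0.
  have -> : fps2_const K (phi2 (c * d)) = phi (fps2_const O (c * d)) by [].
  rewrite -[0](rmorph0 phi) (inj_eq phi_inj).
  by apply: nz; rewrite unitrM uc ud.
rewrite LKE; split; first exact: square_in_ideal_exp.
move=> /(square_not_in_cube cK0 EK0)[eX eY].
have v20 : fps2_const O v != 2.
  have := const_neq0 red_a; apply: contraNneq => e.
  by rewrite rmorphB e rmorph_nat subrr.
have W0 : fps2_const O W = 0.
  by rewrite -WE rmorphM tau0 mul0r.
have TT := double_locus_transversal char0 surface v20 (const_neq0 red_s) W0.
apply: TT.
split.
- apply: dualP; first exact: E0.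
  by apply: phi_inj; rewrite rmorph0; exact: eX.
- apply: dualP; first exact: E0.
  by apply: phi_inj; rewrite rmorph0; exact: eY.
Qed.

Lemma main_conclusion : exists2 z : fps2 O,
    unique (is_implicit_function res (poly_f n) A B Cbar) z &
    (exists L, is_L_function rho L) /\
    forall L : fps2 O, is_L_function rho L ->
      eq_up_to_unit L (evalZ (poly_tau n) x y z) /\
      (fps2_const O L = 0 ->
         let LK := fps2_map (fun a => iota (tofrac a)) L in
         ideal_exp IK 2 LK /\ ~ ideal_exp IK 3 LK).
Proof.
exists z; first by split; [exact: implicit_z|exact: implicit_unique].
have [T [LT [w uw TE]]] := L_function.
split; first by exists T.
move=> L LL; have [c uc LE] := order_unique local LL LT.
have Ltau : eq_up_to_unit L tau.
  by exists (c * w); [rewrite unitrM uc uw|rewrite LE TE; exact: mulrA].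
by split; [exact: Ltau|exact: multiplicity].
Qed.

End Main.

Theorem theorem1p10 (n : int) (p : nat) (F : fieldType) (O : idomainType)
    (res : {rmorphism O -> F})
    (rhobar : whitehead_group n -> 'M[F]_2)
    (A B : O)
    (rho : whitehead_group n -> 'M[fps2 O]_2)
    (K : closedFieldType) (iota : {rmorphism {fraction O} -> K}) :
  let Abar := \tr (rhobar (wh_m n)) in
  let Bbar := \tr (rhobar (wh_mu n)) in
  let Cbar := \tr (rhobar (wh_m n * wh_mu n)%g) in
  let x := fps2C O A + fps2X O in
  let y := fps2C O B + fps2Y O in
  let IK := ideal2 (fps2X K) (fps2Y K) in
  n != 0 ->
  p \in [pchar F] -> (2 < p)%N ->
  [pchar O] =i pred0 -> complete_dvr res ->
  is_SL2_rep rhobar -> absolutely_irreducible rhobar -> non_acyclic rhobar ->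
  smooth_zero (poly_f n) Abar Bbar Cbar ->
  evalZ (poly_f n)^`M(iz) Abar Bbar Cbar != 0 ->
  res A = Abar -> res B = Bbar ->
  universal_deformation res rhobar (fps2C O) (res \o fps2_const O) rho ->
  \tr (rho (wh_m n)) = x -> \tr (rho (wh_mu n)) = y ->
  (forall a : K, algebraicOver iota a) ->
  exists2 z : fps2 O,
    unique (is_implicit_function res (poly_f n) A B Cbar) z &
    (exists L, is_L_function rho L) /\
    forall L : fps2 O, is_L_function rho L ->
      eq_up_to_unit L (evalZ (poly_tau n) x y z) /\
      (* (A, B) is a zero of L *)
      (fps2_const O L = 0 ->
         let LK := fps2_map (fun a => iota (tofrac a)) L in
         ideal_exp IK 2 LK /\ ~ ideal_exp IK 3 LK).
Proof.
move=> Abar Bbar Cbar x y IK n0 pF p2 charO _ rhobarP irr _ [f0 _] fz resA resB.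
move=> univ trm tru _.
have two : 2 != 0 :> F.
  by rewrite -(dvdn_pcharf pF) gtnNdvd.
apply: main_conclusion => //.
- exact: char0_intr.
- have [_ _ rM] := rhobarP; rewrite /Cbar rM.
  exact: irreducible_trace_commutator.
Qed.
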